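(* Let $V\in BC^2(\mathbf{R})$ satisfy $V(x)>0$ and $|V'(x)|\le \alpha V(x)$ for all $x\in\mathbf{R}$ with some constant $\alpha>0$, and assume $\alpha^2\|V\|_\infty<1$. Let $u_0,u_1\in H^3(\mathbf{R})$ satisfy $$\frac{u_0+u_1-\Delta u_1}{\sqrt{V(\cdot)}}\in L^2(\mathbf{R}).$$ Then the strong solution $u(t,x)$ of $$u_{tt}-u_{ttxx}-u_{xx}+V(x)u+u_t=0\ \text{ in }(0,\infty)\times\mathbf{R},\qquad u(0,x)=u_0(x),\quad u_t(0,x)=u_1(x)$$ satisfies, for all $t\ge 0$, $$E_u(t)\le C\left(\|u_0\|_{H^3}^2+\|u_1\|_{H^3}^2+\left\|\frac{u_0+u_1-\Delta u_1}{\sqrt{V(\cdot)}}\right\|^2\right)(1+t)^{-2},$$ $$\|u(t,\cdot)\|^2\le C\left(\|u_0\|_{H^3}^2+\|u_1\|_{H^3}^2+\left\|\frac{u_0+u_1-\Delta u_1}{\sqrt{V(\cdot)}}\right\|^2\right)(1+t)^{-1},$$ where $C=C(\alpha,\|V\|_\infty,\|V'\|_\infty,\|V''\|_\infty)>0$ is a constant depending only on $\alpha$, $\|V\|_\infty$, $\|V'\|_\infty$ and $\|V''\|_\infty$.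
   Context: All functions are real-valued. $BC^k(\mathbf{R})$ is the space of $C^k$ functions on $\mathbf{R}$ that are bounded together with their derivatives up to order $k$. $\Delta=\partial_x^2$, $\nabla=\partial_x$. $\|\cdot\|$ is the $L^2(\mathbf{R})$ norm, $\|\cdot\|_\infty$ the $L^\infty(\mathbf{R})$ norm, $\|\cdot\|_{H^l}$ the usual $H^l(\mathbf{R})$ norm. For data $(u_0,u_1)\in H^2(\mathbf{R})\times H^2(\mathbf{R})$ the strong solution is the unique $u\in C^2([0,\infty);H^2(\mathbf{R}))$ satisfying the equation and the initial conditions. The total energy is $$E_u(t)=\tfrac12\left(\|u_t(t,\cdot)\|^2+\|\nabla u_t(t,\cdot)\|^2+\|\nabla u(t,\cdot)\|^2+\|\sqrt{V(\cdot)}\,u(t,\cdot)\|^2\right).$$ *)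

(* Defs.v *)
From HB Require Import structures.
From mathcomp Require Export all_boot all_order all_algebra.
From mathcomp Require Export all_classical all_reals all_analysis.
Import Order.TTheory GRing.Theory Num.Theory.
Import numFieldNormedType.Exports.

Set Implicit Arguments.
Unset Strict Implicit.
Unset Printing Implicit Defensive.

Local Open Scope classical_set_scope.
Local Open Scope ring_scope.

Section Sobolev.
Context {R : realType}.
Local Notation mu := (@lebesgue_measure R).
Implicit Types (f g phi V : R -> R) (k l : nat) (t : R).

Definition L2 f : Prop := f \in Lfun mu 2%:E.

(* The real-valued norms below are meaningful only when the corresponding
   extended-real norm is finite, because [fine +oo = 0]. *)
Definition L2norm f : R := fine ('N[mu]_(2%:E)[EFin \o f])%E.

Definition supnorm f : R := fine ('N[mu]_(+oo)[EFin \o f])%E.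

Definition Ck k f : Prop :=
  (forall j, (j < k)%N -> forall x, derivable (derive1n j f) x 1) /\
  continuous (derive1n k f).

Definition BC k f : Prop :=
  Ck k f /\
  (forall j, (j <= k)%N -> exists M : R, forall x, `|derive1n j f x| <= M).

Definition test_function phi : Prop :=
  (forall k, Ck k phi) /\ (exists M : R, forall x, M < `|x| -> phi x = 0).

Definition is_weak_derivative k f g : Prop :=
  [/\ locally_integrable setT f, locally_integrable setT g &
      forall phi, test_function phi ->
        (\int[mu]_x (f x * derive1n k phi x) = (-1) ^+ k * \int[mu]_x (g x * phi x))%R].

(* A representative of the weak derivative of order [k], which is unique only
   up to a.e. equality; it is the zero function if there is none. *)
Definition wD k f : R -> R := xget (cst 0) [set g | is_weak_derivative k f g].

Definition Sobolev l f : Prop :=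
  L2 f /\
  (forall k, (k <= l)%N -> exists2 g, is_weak_derivative k f g & L2 g).

Definition Sobolev_norm l f : R :=
  Num.sqrt (\sum_(k < l.+1) L2norm (wD k f) ^+ 2).

(* Functions [[0, oo[ -> H^l(R)] are encoded as [R -> R -> R], time first;
   their values at negative times are irrelevant.  At time 0 the derivative
   and the continuity are one-sided. *)
Definition time_derivative l (u v : R -> R -> R) : Prop :=
  forall t, 0 <= t ->
    Sobolev_norm l (fun x => h^-1 * (u (t + h) x - u t x) - v t x)
      @[h --> within [set h : R | 0 <= t + h] (0:R)^'] --> (0 : R).

Definition time_continuous l (u : R -> R -> R) : Prop :=
  forall t, 0 <= t ->
    Sobolev_norm l (fun x => u s x - u t x)
      @[s --> within [set s : R | 0 <= s] (nbhs t)] --> (0 : R).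

Definition C2_Sobolev l (u ut utt : R -> R -> R) : Prop :=
  [/\ forall t, 0 <= t -> [/\ Sobolev l (u t), Sobolev l (ut t) & Sobolev l (utt t)],
      time_derivative l u ut,
      time_derivative l ut utt &
      time_continuous l utt].

(* [ut] and [utt] are the first and second time derivatives of [u]. *)
Definition strong_solution V (u0 u1 : R -> R) (u ut utt : R -> R -> R) : Prop :=
  [/\ C2_Sobolev 2 u ut utt,
      forall t, 0 < t -> {ae mu, forall x,
        utt t x - wD 2 (utt t) x - wD 2 (u t) x + V x * u t x + ut t x = 0},
      {ae mu, forall x, u 0 x = u0 x} &
      {ae mu, forall x, ut 0 x = u1 x}].

Definition energy V (u ut : R -> R -> R) t : R :=
  2^-1 * (L2norm (ut t) ^+ 2 + L2norm (wD 1 (ut t)) ^+ 2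
          + L2norm (wD 1 (u t)) ^+ 2
          + L2norm (fun x => Num.sqrt (V x) * u t x) ^+ 2).

Definition weighted_data V (u0 u1 : R -> R) : R -> R :=
  fun x => (u0 x + u1 x - wD 2 u1 x) / Num.sqrt (V x).

Definition data_size V (u0 u1 : R -> R) : R :=
  Sobolev_norm 3 u0 ^+ 2 + Sobolev_norm 3 u1 ^+ 2
  + L2norm (weighted_data V u0 u1) ^+ 2.

End Sobolev.

(* Main.v *)
(** Write a_k, b_k, c_k for the k-th space derivatives of u, u_t, u_tt, let E
be the energy and put kappa = alpha |V|_oo^(1/2) < 1.

- E' = -|b_0|^2.  With F = (b_0,a_0) + (b_1,a_1) + |a_0|^2/2 and E_2 the energy
  of u_x, the functional L = E_2 + F/2 + 2E satisfies L' <= -(1 - kappa) E: the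
  only bad term is the commutator (V' a_0, b_1), which |V'| <= alpha V bounds by
  kappa/2 (|sqrt(V) a_0|^2 + |b_1|^2).  So E is integrable in time.
- The integral w of u over [0, t] satisfies
  u_t - u_txx + u - w_xx + V w = u_1 - u_1'' + u_0.  Testing with u = w_t, the
  right-hand side is sqrt(V) times the weighted data and is absorbed by
  |sqrt(V) w|^2, whence a bound on the time integral of |u|^2.  No Bochner
  integral is used: w is replaced by finite Euler sums, extended step by step by
  real induction.
- The next weight needs the time integral of |b_2|^2, i.e. an energy estimate
  one order above the regularity of u.  It is run on difference quotients of
  u_x, whose bounds are uniform in the step because u_0 and u_1 are in H^3, and
  passes to the limit by Fatou's lemma.
- Multiplying L and E by 1 + t and (1 + t)^2 then gives both decay rates, the
  one of |u|^2 because L dominates |u|^2/8.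

In L^2 the space derivative is the strong limit of difference quotients; that a
weak derivative in L^2 is one follows from the du Bois-Reymond lemma, which
identifies the difference quotient with an average of the weak derivative. *)

From HB Require Import structures.
Require Import Defs.
From mathcomp Require Import measurable_realfun ess_sup_inf ring lra.
Import Order.TTheory GRing.Theory Num.Theory.
Import numFieldNormedType.Exports.

Set Implicit Arguments.
Unset Strict Implicit.
Unset Printing Implicit Defensive.

Local Open Scope classical_set_scope.
Local Open Scope ring_scope.

(** * Semi-inner products and time derivatives *)

(** Functions are not identified up to null sets, so the form on [L2space] is only semidefinite, and
    limits and space derivatives are determined only up to null vectors. Hence the semi-inner
    product, a relation [D] instead of a derivative operator, and the equation in tested form. Each
    of u, u_t, u_tt has exactly two space derivatives, all that H^2 offers, so the equation is never
    differentiated in x: the identities for u_x come from testing with u_txx or u_xx and moving one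
    derivative by skew-symmetry. The threshold alpha^2 |V|_oo < 1 comes from |V'| <= alpha sqrt(V)
    sqrt(V) <= kappa sqrt(V): one factor sqrt(V) stays with u and is paid by the potential energy,
    the other one becomes the constant. The integral of |b_2|^2 is needed because the weight 1 + t
    on L leaves the term L, hence E_2, which the dissipation of L does not control. The cross
    functional of u_x supplies -|a_2|^2 and -|sqrt(V) a_1|^2, at the price of |b_2|^2. *)

Record semi_inner (R : realType) (H : lmodType R) := SemiInner {
  ip :> H -> H -> R;
  ipC : forall f g, ip f g = ip g f;
  ip_linear : forall a f g z, ip (a *: f + g) z = a * ip f z + ip g z;
  ip_ge0 : forall f, 0 <= ip f f }.

Section SemiInnerTheory.
Context {R : realType} {H : lmodType R} (p : semi_inner H).
Implicit Types (f g z : H).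

Lemma ipDl f g z : p (f + g) z = p f z + p g z.
Proof. by rewrite -[f]scale1r ip_linear mul1r scale1r. Qed.

Lemma ip0l z : p 0 z = 0.
Proof. by have := ipDl 0 0 z; rewrite addr0 => ?; lra. Qed.

Lemma ipZl a f z : p (a *: f) z = a * p f z.
Proof. by rewrite -[a *: f]addr0 ip_linear ip0l addr0. Qed.

Lemma ipNl f z : p (- f) z = - p f z.
Proof. by rewrite -scaleN1r ipZl mulN1r. Qed.

Lemma ipDr f g z : p z (f + g) = p z f + p z g.
Proof. by rewrite ipC ipDl !(ipC p z). Qed.

Lemma ip0r z : p z 0 = 0. Proof. by rewrite ipC ip0l. Qed.

Lemma ipZr a f z : p z (a *: f) = a * p z f.
Proof. by rewrite ipC ipZl ipC. Qed.

Lemma ipNr f z : p z (- f) = - p z f.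
Proof. by rewrite ipC ipNl ipC. Qed.

Definition ipE := (ipDl, ipDr, ipNl, ipNr, ipZl, ipZr, ip0l, ip0r).

Lemma ip_young e f g : 0 < e -> `|p f g| *+ 2 <= e * p f f + e^-1 * p g g.
Proof.
move=> e0; have i0 : 0 < e^-1 by rewrite invr_gt0.
have K c : c ^+ 2 = 1 -> 0 <= e * p f f + e^-1 * p g g + c * (p f g *+ 2).
  (* A square divided by e, for both signs c, whence the absolute value. *)
  move=> c1; have -> : e * p f f + e^-1 * p g g + c * (p f g *+ 2) =
      e^-1 * p (e *: f + c *: g) (e *: f + c *: g).
    rewrite !ipE (ipC p g f) [c * (c * _)]mulrA -expr2 c1.
    by field; rewrite gt_eqF.
  by rewrite mulr_ge0 ?ip_ge0// ltW.
have := K 1 (expr1n _ _); have := K (-1) (sqrr_sign _ true).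
by have [] := ger0P (p f g); lra.
Qed.

(** A null vector g need not be zero, so [p g g = 0] is a separate case: Young's inequality with
    weight e / (p f f + 1) then bounds |p f g| by every e > 0. *)
Lemma ip_cauchy f g : p f g ^+ 2 <= p f f * p g g.
Proof.
have [g0|g0] := eqVneq (p g g) 0.
  rewrite g0 mulr0; suff -> : p f g = 0 by rewrite expr0n.
  apply/eqP; rewrite -normr_le0; apply/ler_addgt0Pl => e e0; rewrite addr0.
  have f1 : 0 < p f f + 1 by rewrite ltr_wpDl// ip_ge0.
  have := @ip_young (e / (p f f + 1)) f g (divr_gt0 e0 f1); rewrite g0 mulr0 addr0.
  have : e / (p f f + 1) * p f f <= e.
    by rewrite mulrAC ler_pdivrMr// ler_pM2l// lerDl.
  have := normr_ge0 (p f g); lra.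
have gp : 0 < p g g by rewrite lt_def g0 ip_ge0.
have := ip_ge0 p (p g g *: f - p f g *: g).
have -> : p (p g g *: f - p f g *: g) (p g g *: f - p f g *: g) =
    p g g * (p f f * p g g - p f g ^+ 2) by rewrite !ipE (ipC p g f); ring.
by rewrite pmulr_rge0// subr_ge0.
Qed.

Lemma ip_null f z : p f f = 0 -> p f z = 0.
Proof.
move=> f0; have := ip_cauchy f z; rewrite f0 mul0r => h.
by apply/eqP; rewrite -sqrf_eq0 eq_le h sqr_ge0.
Qed.

Lemma ip_sqrD_le f g : p (f + g) (f + g) <= 2 * p f f + 2 * p g g.
Proof. by have := ip_ge0 p (f - g); rewrite !ipE (ipC p g f); lra. Qed.

Definition nrm f := Num.sqrt (p f f).

Lemma nrm_ge0 f : 0 <= nrm f. Proof. exact: sqrtr_ge0. Qed.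

Lemma sqr_nrm f : nrm f ^+ 2 = p f f.
Proof. by rewrite sqr_sqrtr// ip_ge0. Qed.

Lemma ler_ip_nrm f g : `|p f g| <= nrm f * nrm g.
Proof.
rewrite -sqrtrM ?ip_ge0// -sqrtr_sqr ler_wsqrtr//; exact: ip_cauchy.
Qed.

Lemma ler_nrmD f g : nrm (f + g) <= nrm f + nrm g.
Proof.
rewrite -(@ler_pXn2r _ 2) ?nnegrE ?addr_ge0 ?nrm_ge0// sqrrD !sqr_nrm !ipE (ipC p g f).
by have := le_trans (ler_norm _) (ler_ip_nrm f g); lra.
Qed.

Lemma nrmN f : nrm (- f) = nrm f.
Proof. by rewrite /nrm !ipE opprK. Qed.

Lemma nrmZ a f : nrm (a *: f) = `|a| * nrm f.
Proof. by rewrite /nrm !ipE mulrA -expr2 sqrtrM ?sqr_ge0// sqrtr_sqr. Qed.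

End SemiInnerTheory.

(** * Convergence in the seminorm and bounded operators *)

Section StrongConvergence.
Context {R : realType} {H : lmodType R} (p : semi_inner H).
Context {T : Type} {F : set_system T} {FF : Filter F}.
Implicit Types (u w : T -> H) (l m : H).

Definition scvg u l := p (u x - l) (u x - l) @[x --> F] --> (0 : R).

Lemma cvg0_squeeze (f g : T -> R) :
  (forall x, `|f x| <= g x) -> g x @[x --> F] --> (0:R) -> f x @[x --> F] --> (0:R).
Proof.
move=> fg g0; apply/norm_cvg0P; apply: (squeeze_cvgr _ (cvg_cst 0) g0).
by apply: nearW => x; rewrite normr_ge0 fg.
Qed.

Lemma scvg_cst l : scvg (fun=> l) l.
Proof. by rewrite /scvg subrr ip0l; exact: cvg_cst. Qed.

Lemma scvg_ip0 u z : scvg u 0 -> p (u x) z @[x --> F] --> (0:R).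
Proof.
rewrite /scvg => u0; apply/norm_cvg0P.
apply: (@cvg0_squeeze _ (fun x => Num.sqrt (p (u x) (u x) * p z z))).
  move=> x; rewrite normr_id -sqrtr_sqr ler_wsqrtr//; exact: ip_cauchy.
rewrite -[X in _ --> X]sqrtr0; apply: continuous_cvg; first exact: sqrt_continuous.
rewrite -[X in _ --> X](mul0r (p z z)); apply: cvgMr_tmp.
by move: u0; under eq_fun do rewrite subr0.
Qed.

Lemma scvg_sub0 u l : scvg u l <-> scvg (fun x => u x - l) 0.
Proof. by rewrite /scvg; under [X in _ <-> X @ _ --> _]eq_fun do rewrite subr0. Qed.

Lemma scvg_ip u w l m :
  scvg u l -> scvg w m -> p (u x) (w x) @[x --> F] --> p l m.
Proof.
move=> ul wm.
have -> : (fun x => p (u x) (w x)) = (fun x => p (u x - l) (w x - m)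
   + (p (u x - l) m + (p (w x - m) l + p l m))).
  by apply/funext => x; rewrite !ipE (ipC p (w x)) (ipC p m l); lra.
rewrite -[X in _ --> X]add0r; apply: cvgD.
  apply: (@cvg0_squeeze _ (fun x => p (u x - l) (u x - l) + p (w x - m) (w x - m))).
    move=> x; have := @ip_young _ _ p 1 (u x - l) (w x - m) ltr01.
    rewrite invr1 !mul1r; have := normr_ge0 (p (u x - l) (w x - m)); lra.
  by rewrite -[X in _ --> X]addr0; exact: cvgD.
rewrite -[X in _ --> X]add0r; apply: cvgD.
  exact/scvg_ip0/(scvg_sub0 _ _).1.
rewrite -[X in _ --> X]add0r; apply: cvgD.
  exact/scvg_ip0/(scvg_sub0 _ _).1.
exact: cvg_cst.
Qed.

Lemma scvgD u w l m : scvg u l -> scvg w m -> scvg (fun x => u x + w x) (l + m).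
Proof.
move=> ul wm; apply: (@cvg0_squeeze _
  (fun x => 2 * p (u x - l) (u x - l) + 2 * p (w x - m) (w x - m))).
  move=> x; rewrite ger0_norm ?ip_ge0// opprD addrACA; exact: ip_sqrD_le.
rewrite -[X in _ --> X](addr0 0) -{1}(mulr0 2) -{2}(mulr0 2).
by apply: cvgD; apply: cvgMl_tmp.
Qed.

Definition bounded_linear (S : H -> H) :=
  (forall a f g, S (a *: f + g) = a *: S f + S g) /\
  exists C, forall f, p (S f) (S f) <= C * p f f.

Lemma bounded_linear0 S : bounded_linear S -> S 0 = 0.
Proof.
case=> SL _; have := SL 1 0 0; rewrite !scale1r addr0 => /eqP.
by rewrite -subr_eq0 opprD addrA subrr add0r oppr_eq0 => /eqP.
Qed.

Lemma bounded_linearD S f g : bounded_linear S -> S (f + g) = S f + S g.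
Proof. by case=> SL _; rewrite -[f in LHS]scale1r SL scale1r. Qed.

Lemma bounded_linearZ S a f : bounded_linear S -> S (a *: f) = a *: S f.
Proof. by move=> bS; have [SL _] := bS; rewrite -[a *: f]addr0 SL bounded_linear0// addr0. Qed.

Lemma bounded_linearN S f : bounded_linear S -> S (- f) = - S f.
Proof. by move=> bS; rewrite -scaleN1r bounded_linearZ// scaleN1r. Qed.

Lemma bounded_linearB S f g : bounded_linear S -> S (f - g) = S f - S g.
Proof. by move=> bS; rewrite bounded_linearD// bounded_linearN. Qed.

Lemma scvg_bounded S u l : bounded_linear S -> scvg u l -> scvg (S \o u) (S l).
Proof.
move=> bS ul; have [_ [C Sb]] := bS.
apply: (@cvg0_squeeze _ (fun x => C * p (u x - l) (u x - l))).
  by move=> x /=; rewrite ger0_norm ?ip_ge0// -bounded_linearB.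
by rewrite -[X in _ --> X](mulr0 C); exact: cvgMl_tmp.
Qed.

Lemma bounded_linear_scale a : bounded_linear (fun f => a *: f).
Proof.
split; first by move=> b f g; rewrite scalerDr !scalerA mulrC.
by exists (a ^+ 2) => f; rewrite !ipE mulrA expr2.
Qed.

Lemma scvgZ a u l : scvg u l -> scvg (fun x => a *: u x) (a *: l).
Proof. exact/scvg_bounded/bounded_linear_scale. Qed.

Lemma scvgZ0 (a : T -> R) u l :
  a x @[x --> F] --> (0:R) -> scvg u l -> scvg (fun x => a x *: u x) 0.
Proof.
move=> a0 ul; rewrite /scvg.
under eq_fun do rewrite subr0 !ipE.
have -> : (0 : R) = 0 * (0 * p l l) by rewrite mul0r.
by apply: cvgM => //; apply: cvgM => //; exact: scvg_ip.
Qed.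

End StrongConvergence.

Section TimeDerivative.
Context {R : realType} {H : lmodType R} (p : semi_inner H).
Implicit Types (A B : R -> H) (t : R).

(* Only nonnegative times matter, but the derivative is two-sided there. *)
Definition tder A A' := forall t, 0 <= t ->
  scvg p (F := 0^') (fun h : R => h^-1 *: (A (t + h) - A t)) (A' t).

Lemma tder_cvg A A' (t : R) : tder A A' -> 0 <= t -> scvg p (F := 0^') (fun h : R => A (t + h)) (A t).
Proof.
move=> dA t0; apply/scvg_sub0.
have : scvg p (F := 0^') (fun h : R => h *: (h^-1 *: (A (t + h) - A t))) 0.
  by apply: scvgZ0 (dA t t0); exact: cvg_within.
rewrite /scvg; apply: cvg_trans; apply: near_eq_cvg.
near=> h; congr (p _ _); congr (_ - _); rewrite scalerA mulfV ?scale1r//;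
  near: h; exact: nbhs_dnbhs_neq.
Unshelve. all: by end_near. Qed.

Lemma is_derive_ip A A' B B' t : tder A A' -> tder B B' -> 0 <= t ->
  is_derive t 1 (fun s => p (A s) (B s)) (p (A' t) (B t) + p (A t) (B' t)).
Proof.
move=> dA dB t0.
have E : h^-1 *: ((p (A (h *: 1 + t)) (B (h *: 1 + t)) : R^o) - p (A t) (B t)) @[h --> 0^']
   --> p (A' t) (B t) + p (A t) (B' t).
  have -> : (fun h : R => h^-1 *: ((p (A (h *: 1 + t)) (B (h *: 1 + t)) : R^o) - p (A t) (B t)))
    = (fun h => p (h^-1 *: (A (t + h) - A t)) (B (t + h))
        + p (A t) (h^-1 *: (B (t + h) - B t))).
    apply/funext => h; rewrite [h *: 1]mulr1 (addrC h) !ipE.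
    rewrite /GRing.scale /=; ring.
  apply: cvgD; first by apply: scvg_ip => //; [exact: dA|exact: tder_cvg dB _].
  by apply: scvg_ip => //; [exact: scvg_cst|exact: dB].
by apply: DeriveDef; [apply/cvg_ex; eexists; exact: E | apply/cvg_lim => //; exact: E].
Qed.

Lemma tder_bounded S A A' : bounded_linear p S -> tder A A' ->
  tder (S \o A) (S \o A').
Proof.
move=> bS dA t t0; rewrite [X in scvg p X](_ : _ = S \o (fun h => h^-1 *: (A (t + h) - A t))).
  by apply: scvg_bounded => //; exact: dA.
by apply/funext => h /=; rewrite (bounded_linearZ _ _ bS) (bounded_linearB _ _ bS).
Qed.

(** The first-order expansion for both signs of h: an Euler step may start or end at t. *)
Lemma tder_near A A' t e : tder A A' -> 0 <= t -> 0 < e ->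
  exists2 d, 0 < d & forall h, `|h| < d ->
    nrm p (A (t + h) - A t - h *: A' t) <= e * `|h|.
Proof.
move=> dA t0 e0; have /cvgr0_norm_lt/(_ (e ^+ 2)) := dA t t0.
rewrite exprn_gt0// => /(_ erefl).
rewrite /dnbhs /within/= => /nbhs_ballP[d /= d0 dB]; exists d => // h hd.
have [->|h0] := eqVneq h 0.
  by rewrite addr0 subrr scale0r subr0 /nrm ip0l sqrtr0 normr0 mulr0.
have := dB h; rewrite /ball/= sub0r normrN => /(_ hd h0).
rewrite ger0_norm ?ip_ge0// -sqr_nrm => eh.
have -> : A (t + h) - A t - h *: A' t = h *: (h^-1 *: (A (t + h) - A t) - A' t).
  by rewrite scalerBr scalerA mulfV// scale1r.
rewrite nrmZ mulrC ler_wpM2r// ltW// -(@ltr_pXn2r _ 2) ?nnegrE ?nrm_ge0//.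
exact: ltW.
Qed.

Lemma tderD A A' B B' : tder A A' -> tder B B' ->
  tder (fun t => A t + B t) (fun t => A' t + B' t).
Proof.
move=> dA dB t t0; rewrite [X in scvg p X](_ : _ =
    fun h => h^-1 *: (A (t + h) - A t) + h^-1 *: (B (t + h) - B t)).
  by apply: scvgD; [exact: dA|exact: dB].
by apply/funext => h; rewrite -scalerDr addrACA -opprD.
Qed.

End TimeDerivative.

(** * Monotonicity, derivatives and induction on the real line *)

Section RealLine.
Context {R : realType}.

Lemma nonincreasing_half_line (L L' : R -> R) :
  (forall t : R, 0 <= t -> is_derive t 1 L (L' t)) ->
  (forall t, 0 < t -> L' t <= 0) ->
  forall t, 0 <= t -> L t <= L 0.
Proof.
move=> dL L'0 t t0.
apply: (@ler0_derive1_le_cc R L 0 t) => //; rewrite ?bound_itvE//.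
- by move=> x /[!in_itv]/= /andP[/ltW x0 _]; have [] := dL _ x0.
- move=> x /[!in_itv]/= /andP[x0 _]; rewrite derive1E.
  by have d := dL _ (ltW x0); rewrite derive_val; exact: L'0.
- apply: derivable_within_continuous => x /[!in_itv]/= /andP[x0 _].
  by have [] := dL _ x0.
Qed.

Lemma is_derive_near (f : R -> R) (df t e : R) : is_derive t 1 f df -> 0 < e ->
  exists2 d, 0 < d & forall h, `|h| < d ->
    `|f (t + h) - f t - h * df| <= e * `|h|.
Proof.
move=> [df1 df2] e0.
have : h^-1 *: (f (h *: 1 + t) - f t) @[h --> 0^'] --> df by rewrite -df2; exact: df1.
move=> /cvgrPdist_lt/(_ e e0).
rewrite /dnbhs /within/= => /nbhs_ballP[d /= d0 dB]; exists d => // h hd.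
have [->|h0] := eqVneq h 0.
  by rewrite addr0 subrr mul0r subr0 normr0 mulr0.
have := dB h; rewrite /ball/= sub0r normrN => /(_ hd h0) /ltW eh.
have -> : f (t + h) - f t - h * df = h * (h^-1 *: (f (h *: 1 + t) - f t) - df).
  rewrite /GRing.scale/= mulr1 (addrC h) mulrBr mulrA mulfV// mul1r//.
by rewrite normrM mulrC ler_wpM2r// distrC.
Qed.

Lemma is_derive_add (f g : R -> R) (df dg t : R) :
  is_derive t 1 f df -> is_derive t 1 g dg ->
  is_derive t 1 (fun s => f s + g s) (df + dg).
Proof. exact: is_deriveD. Qed.

Lemma is_derive_mul (f g : R -> R) (df dg t : R) :
  is_derive t 1 f df -> is_derive t 1 g dg ->
  is_derive t 1 (fun s => f s * g s) (f t * dg + df * g t).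
Proof. by move=> d1 d2; have := is_deriveM d1 d2; rewrite /GRing.scale/= [g t * _]mulrC. Qed.

Lemma is_derive_scale (f : R -> R) (c df t : R) :
  is_derive t 1 f df -> is_derive t 1 (fun s => c * f s) (c * df).
Proof. exact: is_deriveZ. Qed.

(* Real induction: the hypothesis covers both one-sided steps at [t]. *)
Lemma real_induction (P : R -> Prop) (T : R) : 0 <= T -> P 0 ->
  (forall t, 0 <= t <= T -> exists2 d, 0 < d & forall s s',
    0 <= s -> s < s' -> s' <= T -> s' - s < d -> (s = t) \/ (s' = t) -> P s -> P s') ->
  P T.
Proof.
move=> T0 P0 step; pose A := [set s | 0 <= s <= T /\ P s].
have A0 : A 0 by split => //; rewrite lexx.
have supA : has_sup A by split; [exists 0 | exists T => s [/andP[]]].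
have sA x : A x -> x <= sup A by apply: ub_le_sup; case: supA.
have s0 : 0 <= sup A <= T.
  by rewrite (sA _ A0)/=; apply: ge_sup; [exists 0 | move=> s [/andP[]]].
have [d d0 dP] := step _ s0.
have [s As sd] := sup_adherent d0 supA.
have Ps : P (sup A).
  have := sA _ As; rewrite le_eqVlt => /predU1P[<-|ss]; first by case: As.
  case: As => /andP[s00 sT] Ps; apply: (dP s) => //; last by right.
    by case/andP: s0.
  by rewrite ltrBlDr -ltrBlDl.
case/andP: s0 => s0; rewrite le_eqVlt => /predU1P[<-//|sT].
pose s' := Num.min T (sup A + d / 2).
have ss' : sup A < s' by rewrite lt_min sT ltrDl divr_gt0.
have : A s'.
  split; first by rewrite (le_trans s0 (ltW ss')) ge_min lexx.
  apply: (dP (sup A)) => //; [by rewrite ge_min lexx| |by left].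
  have : s' <= sup A + d / 2 by rewrite /s' ge_min lexx orbT.
  lra.
by move=> /sA; rewrite leNgt ss'.
Qed.

End RealLine.

(** * Abstract energy estimates *)

Section DampedWave.
Context {R : realType} {H : lmodType R} (p : semi_inner H).
(** To be read as: [D] the space derivative, [P], [P1], [S] the multiplications by V, V', sqrt(V).
    [D_skew] is integration by parts and [D_P] the product rule. *)
Variables (D : H -> H -> Prop) (P P1 S : H -> H) (kappa : R).
Hypothesis D_skew : forall f f' g g', D f f' -> D g g' -> p f' g = - p f g'.
Hypothesis D_linear : forall a f f' g g', D f f' -> D g g' ->
  D (a *: f + g) (a *: f' + g').
Hypothesis bP : bounded_linear p P.
Hypothesis P_sym : forall f g, p (P f) g = p (S f) (S g).
Hypothesis D_P : forall f f', D f f' -> D (P f) (P1 f + P f').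
Hypothesis kappa01 : 0 <= kappa < 1.
Hypothesis P1_le : forall f g, `|p (P1 f) g| *+ 2 <= kappa * (p (P f) f + p g g).

Variables (a0 a1 a2 b0 b1 b2 c0 c1 c2 : R -> H).
Hypothesis Da0 : forall t, D (a0 t) (a1 t).
Hypothesis Da1 : forall t, D (a1 t) (a2 t).
Hypothesis Db0 : forall t, D (b0 t) (b1 t).
Hypothesis Db1 : forall t, D (b1 t) (b2 t).
Hypothesis Dc0 : forall t, D (c0 t) (c1 t).
Hypothesis Dc1 : forall t, D (c1 t) (c2 t).
Hypothesis da0 : tder p a0 b0.
Hypothesis da1 : tder p a1 b1.
Hypothesis da2 : tder p a2 b2.
Hypothesis db0 : tder p b0 c0.
Hypothesis db1 : tder p b1 c1.
Hypothesis db2 : tder p b2 c2.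
Hypothesis pde : forall t z, 0 <= t ->
  p (c0 t - c2 t - a2 t + P (a0 t) + b0 t) z = 0.

Implicit Types t : R.

Let sq (A : R -> H) t := p (A t) (A t).
Let pot (A : R -> H) t := p (P (A t)) (A t).

Let is_derive_sq A A' t : tder p A A' -> 0 <= t ->
  is_derive t 1 (sq A) (2 * p (A' t) (A t)).
Proof.
move=> dA t0; have := is_derive_ip dA dA t0.
by rewrite (ipC p (A t)) (_ : _ + _ = 2 * p (A' t) (A t)) //; ring.
Qed.

Let is_derive_pot A A' t : tder p A A' -> 0 <= t ->
  is_derive t 1 (pot A) (2 * p (P (A t)) (A' t)).
Proof.
move=> dA t0; have := is_derive_ip (tder_bounded bP dA) dA t0.
rewrite /= P_sym (ipC p (S _)) -P_sym.
by rewrite (_ : _ + _ = 2 * p (P (A t)) (A' t)) //; ring.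
Qed.

Let pot_ge0 A t : 0 <= pot A t. Proof. by rewrite /pot P_sym ip_ge0. Qed.

Let pdeE t z : 0 < t ->
  p (c0 t) z = p (c2 t) z + p (a2 t) z - p (P (a0 t)) z - p (b0 t) z.
Proof. by move=> t0; have := pde z (ltW t0); rewrite !ipE; lra. Qed.

Definition wave_energy t := 2^-1 * (sq b0 t + sq b1 t + sq a1 t + pot a0 t).

Definition dwave_energy t :=
  p (c0 t) (b0 t) + p (c1 t) (b1 t) + p (b1 t) (a1 t) + p (P (a0 t)) (b0 t).

Lemma is_derive_wave_energy t : 0 <= t ->
  is_derive t 1 wave_energy (dwave_energy t).
Proof.
move=> t0; have := is_derive_scale 2^-1 (is_derive_add (is_derive_add
  (is_derive_add (is_derive_sq db0 t0) (is_derive_sq db1 t0))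
  (is_derive_sq da1 t0)) (is_derive_pot da0 t0)).
by move/is_derive_eq; apply; rewrite /dwave_energy; lra.
Qed.

(** The equation tested with u_t; all terms but the damping cancel after integration by parts. *)
Lemma dwave_energyE t : 0 < t -> dwave_energy t = - sq b0 t.
Proof.
move=> t0; rewrite /dwave_energy /sq (pdeE _ t0).
have := D_skew (Dc1 t) (Db0 t); have := D_skew (Da1 t) (Db0 t).
rewrite (ipC p (b1 t) (a1 t)); lra.
Qed.

Definition wave_cross t := p (b0 t) (a0 t) + p (b1 t) (a1 t) + 2^-1 * sq a0 t.

Definition dwave_cross t := p (c0 t) (a0 t) + sq b0 t + (p (c1 t) (a1 t) + sq b1 t)
  + p (b0 t) (a0 t).

Lemma is_derive_wave_cross t : 0 <= t ->
  is_derive t 1 wave_cross (dwave_cross t).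
Proof.
move=> t0; have := is_derive_add (is_derive_add (is_derive_ip db0 da0 t0)
  (is_derive_ip db1 da1 t0)) (is_derive_scale 2^-1 (is_derive_sq da0 t0)).
by move/is_derive_eq; apply; rewrite /dwave_cross /sq; lra.
Qed.

(** The equation tested with u, which produces the dissipation of |a_1|^2 and of the potential
    energy. The summand |a_0|^2 / 2 of [wave_cross] is there to cancel the damping term (b_0,
    a_0). *)
Lemma dwave_crossE t : 0 < t ->
  dwave_cross t = sq b0 t + sq b1 t - sq a1 t - pot a0 t.
Proof.
move=> t0; rewrite /dwave_cross /sq (pdeE _ t0) /pot.
have := D_skew (Dc1 t) (Da0 t); have := D_skew (Da1 t) (Da0 t); lra.
Qed.

Definition wave_energy2 t := 2^-1 * (sq b1 t + sq b2 t + sq a2 t + pot a1 t).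

Definition dwave_energy2 t :=
  p (c1 t) (b1 t) + p (c2 t) (b2 t) + p (b2 t) (a2 t) + p (P (a1 t)) (b1 t).

Lemma is_derive_wave_energy2 t : 0 <= t ->
  is_derive t 1 wave_energy2 (dwave_energy2 t).
Proof.
move=> t0; have := is_derive_scale 2^-1 (is_derive_add (is_derive_add
  (is_derive_add (is_derive_sq db1 t0) (is_derive_sq db2 t0))
  (is_derive_sq da2 t0)) (is_derive_pot da1 t0)).
by move/is_derive_eq; apply; rewrite /dwave_energy2; lra.
Qed.

(** The equation tested with u_txx. Moving one derivative off u_txx in the potential term creates
    the commutator [P1]. *)
Lemma dwave_energy2E t : 0 < t ->
  dwave_energy2 t = - sq b1 t - p (P1 (a0 t)) (b1 t).
Proof.
move=> t0; rewrite /dwave_energy2 /sq.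
have := D_skew (Dc0 t) (Db1 t); rewrite (pdeE _ t0).
have := D_skew (Db0 t) (Db1 t).
have := D_skew (D_P (Da0 t)) (Db1 t); rewrite !ipE (ipC p (b2 t) (a2 t)); lra.
Qed.

Definition wave_cross2 t := p (b1 t) (a1 t) + p (b2 t) (a2 t) + 2^-1 * sq a1 t.

Definition dwave_cross2 t := p (c1 t) (a1 t) + sq b1 t + (p (c2 t) (a2 t) + sq b2 t)
  + p (b1 t) (a1 t).

Lemma is_derive_wave_cross2 t : 0 <= t ->
  is_derive t 1 wave_cross2 (dwave_cross2 t).
Proof.
move=> t0; have := is_derive_add (is_derive_add (is_derive_ip db1 da1 t0)
  (is_derive_ip db2 da2 t0)) (is_derive_scale 2^-1 (is_derive_sq da1 t0)).
by move/is_derive_eq; apply; rewrite /dwave_cross2 /sq; lra.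
Qed.

(** The equation tested with u_xx. The term [sq b2 t] has the wrong sign, and no identity of second
    order dissipates it. *)
Lemma dwave_cross2E t : 0 < t -> dwave_cross2 t =
  sq b1 t + sq b2 t - sq a2 t - pot a1 t - p (P1 (a0 t)) (a1 t).
Proof.
move=> t0; rewrite /dwave_cross2 /sq /pot.
have := D_skew (Dc0 t) (Da1 t); rewrite (pdeE _ t0).
have := D_skew (Db0 t) (Da1 t).
have := D_skew (D_P (Da0 t)) (Da1 t); rewrite !ipE; lra.
Qed.

Let cross_le A B t : `|p (A t) (B t)| <= 2^-1 * (sq A t + sq B t).
Proof.
have := @ip_young _ _ p 1 (A t) (B t) ltr01.
by rewrite invr1 !mul1r /sq; lra.
Qed.

(** The weights: the second energy dissipates |b_1|^2, of which half of the cross term spends one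
    half; twice the energy pays for the |b_0|^2 / 2 of the cross term, and one of its two copies
    keeps [lyap] positive. *)
Definition lyap t := wave_energy2 t + 2^-1 * wave_cross t + 2 * wave_energy t.
Definition dlyap t := dwave_energy2 t + 2^-1 * dwave_cross t + 2 * dwave_energy t.

Lemma is_derive_lyap t : 0 <= t -> is_derive t 1 lyap (dlyap t).
Proof.
move=> t0; apply: is_derive_add; first apply: is_derive_add.
- exact: is_derive_wave_energy2.
- exact/is_derive_scale/is_derive_wave_cross.
- exact/is_derive_scale/is_derive_wave_energy.
Qed.

(* The smallness of [kappa] is what absorbs the commutator [P1]. *)
Lemma dlyap_le t : 0 < t -> dlyap t <= - (1 - kappa) * wave_energy t.
Proof.
move=> t0; rewrite /dlyap dwave_energyE// dwave_crossE// dwave_energy2E//.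
rewrite /wave_energy.
have h1 := P1_le (a0 t) (b1 t); have := ler_norm (- p (P1 (a0 t)) (b1 t)).
rewrite normrN -/(pot a0 t) -/(sq b1 t) in h1 *.
have h2 : 0 <= kappa * sq b0 t by rewrite mulr_ge0 ?ip_ge0//; case/andP: kappa01.
have h3 : 0 <= kappa * sq a1 t by rewrite mulr_ge0 ?ip_ge0//; case/andP: kappa01.
have h4 : 0 <= sq b0 t by exact: ip_ge0.
rewrite mulrDr in h1; lra.
Qed.

Lemma lyap_ge t : wave_energy2 t + 8^-1 * sq a0 t + wave_energy t <= lyap t.
Proof.
rewrite /lyap /wave_cross /wave_energy.
have := cross_le b1 a1 t; have := ler_norm (- p (b1 t) (a1 t)); rewrite normrN.
(* With weight 2, half of (b_0, a_0) costs |b_0|^2 / 2, exactly the share of the spare energy, and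
   |a_0|^2 / 8 out of the available |a_0|^2 / 4. *)
have := @ip_young _ _ p 2 (b0 t) (a0 t) (ltr0Sn R 1); have := ler_norm (- p (b0 t) (a0 t)).
rewrite normrN -/(sq b0 t) -/(sq a0 t).
have := ip_ge0 p (b0 t); have := ip_ge0 p (b1 t); have := ip_ge0 p (a1 t).
have := pot_ge0 a0 t; have := ip_ge0 p (a0 t).
rewrite -/(sq a0 t) -/(sq b0 t) -/(sq b1 t) -/(sq a1 t); lra.
Qed.

Lemma lyap_le t : lyap t <= wave_energy2 t + 3 * wave_energy t + 2^-1 * sq a0 t.
Proof.
rewrite /lyap /wave_cross /wave_energy.
have := cross_le b1 a1 t; have := ler_norm (p (b1 t) (a1 t)).
have := cross_le b0 a0 t; have := ler_norm (p (b0 t) (a0 t)).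
have := ip_ge0 p (b0 t); have := ip_ge0 p (b1 t); have := ip_ge0 p (a1 t).
have := pot_ge0 a0 t; have := ip_ge0 p (a0 t).
rewrite -/(sq a0 t) -/(sq b0 t) -/(sq b1 t) -/(sq a1 t); lra.
Qed.

Lemma wave_energy_ge0 t : 0 <= wave_energy t.
Proof. by rewrite mulr_ge0// !addr_ge0 ?ip_ge0 ?pot_ge0. Qed.

Lemma wave_energy2_ge0 t : 0 <= wave_energy2 t.
Proof. by rewrite mulr_ge0// !addr_ge0 ?ip_ge0 ?pot_ge0. Qed.

Lemma wave_cross2_ge t : - (wave_energy t + wave_energy2 t) <= wave_cross2 t.
Proof.
rewrite /wave_energy /wave_energy2 /wave_cross2.
have := cross_le b1 a1 t; have := ler_norm (- p (b1 t) (a1 t)); rewrite normrN.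
have := cross_le b2 a2 t; have := ler_norm (- p (b2 t) (a2 t)); rewrite normrN.
have := ip_ge0 p (b0 t); have := ip_ge0 p (b1 t); have := ip_ge0 p (a1 t).
have := pot_ge0 a0 t; have := pot_ge0 a1 t.
rewrite -/(sq b0 t) -/(sq b1 t) -/(sq a1 t); lra.
Qed.

Lemma lyap_ge0 t : 0 <= lyap t.
Proof.
have := ip_ge0 p (a0 t); have := lyap_ge t.
have := wave_energy_ge0 t; have := wave_energy2_ge0 t; rewrite -/(sq a0 t); lra.
Qed.

(** * Energy estimate one order above the regularity of u *)

Section ThirdOrder.
Variables (d Q : H -> H) (B : R).
Hypothesis bd : bounded_linear p d.
Hypothesis bQ : bounded_linear p Q.
Hypothesis Q_sym : forall f g, p (Q f) g = p f (Q g).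
Hypothesis Q_ge0 : forall f, 0 <= p (Q f) f.
Hypothesis D_d : forall f f', D f f' -> D (d f) (d f').
(** Here [d] is a difference quotient and [Q] the multiplication by the translated V, the factor
    that the discrete Leibniz rule puts in front of [d (a1 t)]. Subtracting it leaves a commutator
    that involves no second derivative of u. *)
Let rest t := d (P1 (a0 t) + P (a1 t)) - Q (d (a1 t)).
Hypothesis rest_le : forall t, 0 <= t -> p (rest t) (rest t) <= B * (sq a0 t + sq a1 t).

Let potQ (A : R -> H) t := p (Q (A t)) (A t).

Let is_derive_potQ A A' t : tder p A A' -> 0 <= t ->
  is_derive t 1 (potQ A) (2 * p (Q (A t)) (A' t)).
Proof.
move=> dA t0; have := is_derive_ip (tder_bounded bQ dA) dA t0.
rewrite /= Q_sym (ipC p (A' t)).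
by rewrite (_ : _ + _ = 2 * p (Q (A t)) (A' t)) //; ring.
Qed.

Definition wave_energy3 t := 2^-1 *
  (sq (d \o b1) t + sq (d \o b2) t + sq (d \o a2) t + potQ (d \o a1) t).

Definition dwave_energy3 t := p (d (c1 t)) (d (b1 t)) + p (d (c2 t)) (d (b2 t))
  + p (d (b2 t)) (d (a2 t)) + p (Q (d (a1 t))) (d (b1 t)).

Lemma is_derive_wave_energy3 t : 0 <= t ->
  is_derive t 1 wave_energy3 (dwave_energy3 t).
Proof.
move=> t0; have := is_derive_scale 2^-1 (is_derive_add (is_derive_add
  (is_derive_add (is_derive_sq (tder_bounded bd db1) t0)
  (is_derive_sq (tder_bounded bd db2) t0)) (is_derive_sq (tder_bounded bd da2) t0))
  (is_derive_potQ (tder_bounded bd da1) t0)).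
by move/is_derive_eq; apply; rewrite /dwave_energy3/=; lra.
Qed.

(** Difference quotient of the equation, tested with that of u_txx; half of the damping absorbs the
    commutator [rest]. *)
Lemma dwave_energy3_le t : 0 < t ->
  dwave_energy3 t <= 2^-1 * (B * (sq a0 t + sq a1 t)) - 2^-1 * sq (d \o b1) t.
Proof.
move=> t0; pose e := c0 t - c2 t - a2 t + P (a0 t) + b0 t.
have de : p (d e) (d (b2 t)) = 0.
  (* The residual e is a null vector but perhaps not zero; a bounded operator keeps it null. *)
  apply: ip_null; apply/eqP; rewrite eq_le ip_ge0 andbT.
  have [_ [C /(_ e)]] := bd; rewrite pde ?(ltW t0)// mulr0; exact.
move: de; rewrite /e !(bounded_linearD _ _ bd) !(bounded_linearN _ bd) !ipE.
have := D_skew (D_d (Dc0 t)) (D_d (Db1 t)).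
have := D_skew (D_d (Db0 t)) (D_d (Db1 t)).
have := D_skew (D_d (D_P (Da0 t))) (D_d (Db1 t)).
have := rest_le (ltW t0).
have := cross_le rest (d \o b1) t; have := ler_norm (- p (rest t) (d (b1 t))).
rewrite normrN /dwave_energy3 /sq /= (ipC p (d (b2 t)) (d (a2 t))).
have -> : p (rest t) (d (b1 t)) =
    p (d (P1 (a0 t) + P (a1 t))) (d (b1 t)) - p (Q (d (a1 t))) (d (b1 t)).
  by rewrite /rest !ipE.
lra.
Qed.

Lemma wave_energy3_ge0 t : 0 <= wave_energy3 t.
Proof. by rewrite mulr_ge0// !addr_ge0 ?ip_ge0 ?Q_ge0. Qed.

Lemma third_order_dissipation (q q3 : R -> R) : 0 <= B ->
  q 0 = 0 -> (forall t, 0 <= t -> is_derive t 1 q (sq a0 t)) ->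
  q3 0 = 0 -> (forall t, 0 <= t -> is_derive t 1 q3 (sq (d \o b1) t)) ->
  forall t, 0 <= t -> 2^-1 * q3 t <=
    wave_energy3 0 + B / (1 - kappa) * lyap 0 + 2^-1 * B * q t.
Proof.
move=> B0 q0 dq q30 dq3.
have k0 : 0 < 1 - kappa by rewrite subr_gt0; case/andP: kappa01.
(* The commutator costs B / 2 times |a_0|^2 + |a_1|^2. The dissipation of [lyap], scaled to B times
   the energy, pays for |a_1|^2; |a_0|^2 is not part of the energy and is compensated by its own
   time integral q. *)
pose L t := wave_energy3 t + 2^-1 * q3 t + B / (1 - kappa) * lyap t
   + (- (2^-1 * B)) * q t.
have dL t : 0 <= t -> is_derive t 1 L (dwave_energy3 t + 2^-1 * sq (d \o b1) t
    + B / (1 - kappa) * dlyap t + (- (2^-1 * B)) * sq a0 t).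
  move=> t0; apply: is_derive_add; first apply: is_derive_add; first apply: is_derive_add.
  - exact: is_derive_wave_energy3.
  - exact/is_derive_scale/dq3.
  - exact/is_derive_scale/is_derive_lyap.
  - exact/is_derive_scale/dq.
move=> t t0; have := nonincreasing_half_line dL _ t0; rewrite /L q0 q30 !mulr0 !addr0.
have lt0 : 0 <= B / (1 - kappa) * lyap t.
  apply: mulr_ge0; first by rewrite divr_ge0// ltW.
  exact: lyap_ge0.
have := wave_energy3_ge0 t.
suff h : forall s, 0 < s -> dwave_energy3 s + 2^-1 * sq (d \o b1) s
    + B / (1 - kappa) * dlyap s + (- (2^-1 * B)) * sq a0 s <= 0.
  by move=> ? /(_ h); lra.
move=> s s0; have h1 := dwave_energy3_le s0.
have h2 : B / (1 - kappa) * dlyap s <= - (B * wave_energy s).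
  apply: (@le_trans _ _ (B / (1 - kappa) * (- (1 - kappa) * wave_energy s))).
    by rewrite ler_wpM2l ?dlyap_le// divr_ge0// ltW.
  by rewrite mulNr mulrN mulrA divfK// gt_eqF.
have h3 : B * sq a1 s <= B * (2 * wave_energy s).
  rewrite ler_wpM2l// /wave_energy mulrA divff// mul1r.
  have := pot_ge0 a0 s; have := ip_ge0 p (b0 s); have := ip_ge0 p (b1 s).
  rewrite -/(sq b0 s) -/(sq b1 s); lra.
lra.
Qed.

End ThirdOrder.

(** * Time integral of the squared norm of u *)

Section Primitive.
Variables (q : R -> R) (f0 : H).
Hypothesis q0 : q 0 = 0.
Hypothesis dq : forall t, 0 <= t -> is_derive t 1 q (sq a0 t).
Hypothesis f0E : forall z, p (b0 0 - b2 0 + a0 0) z = p f0 (S z).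

(** By the equation the time derivative of u_t - u_txx + u is u_xx - V u, so that m t - m 0 is w_xx
    - V w for the integral w of u. *)
Let m t := b0 t + (- 1) *: b2 t + a0 t.
Let dm : tder p m (fun t => c0 t + (-1) *: c2 t + b0 t).
Proof.
exact: tderD (tderD db0 (tder_bounded (bounded_linear_scale _ _) db2)) da0.
Qed.

(** Chosen as a primitive of (m, u): the part (u_t - u_txx, u) of it is an exact derivative and the
    part (u, u) is integrated by q. *)
Let G t := q t + 2^-1 * (sq a0 t + sq a1 t).
Let dG t : 0 <= t -> is_derive t 1 G (p (m t) (a0 t)).
Proof.
move=> t0; have := is_derive_add (dq t0) (is_derive_scale 2^-1 (is_derive_add
  (is_derive_sq da0 t0) (is_derive_sq da1 t0))).
move/is_derive_eq; apply; rewrite /m !ipE /sq.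
have := D_skew (Db1 t) (Da0 t); lra.
Qed.

(* [w], [w1], [w2] stand for [int_0^s u] and its space derivatives; the first
   inequality is the equation integrated in time and the second one the energy
   inequality of [w], both up to an error proportional to [e]. *)
Let approx_primitive (e K s : R) := exists w w1 w2, [/\ D w w1, D w1 w2,
  nrm p (m s - m 0 - w2 + P w) <= e * s &
  G s - G 0 + 2^-1 * (p w1 w1 + p (P w) w) <= p (m 0) w + e * K * s].

(** The increment of w is h times the value of u at t, even when t is the right end s' of the step;
    then [m] has to be compared at s and t, which is the purpose of [d3]. Per unit of time the
    errors are e from the expansion of [G], e from that comparison, e T K from the residual of the
    integrated equation tested with u, and e / 2 from the quadratic term of the step: at most e (3 +
    T K). *)
Lemma approx_primitive_step (e K T t : R) : 0 < e -> 0 <= t <= T ->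
  nrm p (a0 t) <= K ->
  exists2 d, 0 < d & forall s s', 0 <= s -> s < s' -> s' <= T -> s' - s < d ->
    (s = t) \/ (s' = t) -> approx_primitive e (3 + T * K) s ->
    approx_primitive e (3 + T * K) s'.
Proof.
move=> e0 /andP[t0 tT] aK.
pose h0 := p (a1 t) (a1 t) + p (P (a0 t)) (a0 t).
have h00 : 0 <= h0 by rewrite addr_ge0 ?ip_ge0 ?pot_ge0.
have [d1 d10 m1] := tder_near dm t0 e0.
have [d2 d20 G1] := is_derive_near (dG t0) e0.
have [d3 d30 m2] : exists2 d, 0 < d & forall h, `|h| < d ->
    `|p (m (t + h)) (a0 t) - p (m t) (a0 t)| <= e.
  have cc : tder p (fun=> a0 t) (fun=> 0).
    move=> s _; rewrite /scvg; under eq_fun do rewrite subrr scaler0 subrr ip0l.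
    exact: cvg_cst.
  have /derivable1_diffP/differentiable_continuous := @ex_derive _ _ _ _ _ _ _ (is_derive_ip dm cc t0).
  move=> /cvgrPdist_le/(_ e e0) /nbhs_ballP[d /= d0 dB]; exists d => // h hd.
  by rewrite distrC; apply: dB; rewrite /ball/= opprD addrA subrr add0r normrN.
have d4 : 0 < e / (h0 + 1) by rewrite divr_gt0// ltr_wpDl.
(* The last bound makes the quadratic term h^2 h0 of the energy of w at most h e. *)
exists (Num.min (Num.min d1 d2) (Num.min d3 (e / (h0 + 1)))).
  by rewrite !lt_min d10 d20 d30 d4.
move=> s s' s0 ss' s'T; rewrite !lt_min => /andP[/andP[sd1 sd2] /andP[sd3 sd4]] st.
move=> [w [w1 [w2 [Dw Dw1 me Ge]]]]; set h := s' - s in sd1 sd2 sd3 sd4.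
have h_gt0 : 0 < h by rewrite subr_gt0.
have mh : nrm p (m s' - m s - h *: (c0 t + (-1) *: c2 t + b0 t)) <= e * h.
  case: st => st.
    by have := m1 h; rewrite (gtr0_norm h_gt0) -st /h subrKC; exact.
  have := m1 (- h); rewrite normrN (gtr0_norm h_gt0) -st /h opprB subrKC => /(_ sd1).
  by rewrite -nrmN; congr (nrm p _ <= _); rewrite opprD opprB opprK -scaleNr opprB.
have Gh : `|G s' - G s - h * p (m t) (a0 t)| <= e * h.
  case: st => st.
    by have := G1 h; rewrite (gtr0_norm h_gt0) -st /h subrKC; exact.
  have := G1 (- h); rewrite normrN (gtr0_norm h_gt0) -st /h opprB subrKC => /(_ sd2).
  by rewrite -normrN; congr (`|_| <= _); ring.
have mt : p (m t) (a0 t) <= p (m s) (a0 t) + e.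
  case: st => st; first by rewrite st lerDl ltW.
  have := m2 (- h); rewrite normrN (gtr0_norm h_gt0) -st /h opprB subrKC => /(_ sd3).
  by rewrite ler_norml => /andP[+ _]; lra.
exists (h *: a0 t + w), (h *: a1 t + w1), (h *: a2 t + w2); split.
- exact: D_linear.
- exact: D_linear.
(* The equation says that v is null, so the step adds only the Taylor remainder of [m] to the
   error. *)
- pose v := c0 t - c2 t - a2 t + P (a0 t) + b0 t.
  have v0 : nrm p v = 0 by rewrite /nrm pde// sqrtr0.
  have -> : m s' - m 0 - (h *: a2 t + w2) + P (h *: a0 t + w) =
      (m s' - m s - h *: (c0 t + (-1) *: c2 t + b0 t)) +
      (m s - m 0 - w2 + P w) + h *: v.
    rewrite (bounded_linearD _ _ bP) (bounded_linearZ _ _ bP) /v scaleN1r.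
    rewrite !scalerDr !scalerN; move: (m s') (m s) (m 0) (h *: a2 t) (h *: c0 t)
      (h *: c2 t) (h *: b0 t) (h *: P (a0 t)) (P w) => x1 x2 x3 x4 x5 x6 x7 x8 x9.
    rewrite [RHS]addrAC (_ : x5 - x6 - x4 + x8 + x7 = (x5 - x6 + x7) + (x8 - x4)); last first.
      by rewrite -!addrA; congr (_ + (_ + _)); rewrite addrA [RHS]addrC [- x4 + x8]addrC.
    rewrite [X in _ = X + _]addrA subrK opprD -!addrA; congr (x1 + _).
    rewrite [- x4 + (x2 + _)]addrCA [x8 + (x2 + _)]addrCA addKr.
    rewrite [- w2 + (x8 + _)]addrCA [- x4 + (x8 + _)]addrCA [- x3 + (x8 + _)]addrCA.
    by rewrite [- x3 + (- x4 + _)]addrCA.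
  apply: le_trans (ler_nrmD _ _ _) _; rewrite nrmZ v0 mulr0 addr0.
  apply: le_trans (ler_nrmD _ _ _) _; have -> : e * s' = e * h + e * s by rewrite /h; ring.
  exact: lerD.
- have Dwa := D_skew Dw1 (Da0 t).
  have h1 : p (m s - m 0 - w2 + P w) (a0 t) <= e * T * K.
    apply: le_trans (ler_norm _) _; apply: le_trans (ler_ip_nrm _ _ _) _.
    apply: ler_pM; rewrite ?nrm_ge0//; apply: (le_trans me).
    by rewrite ler_pM2l// (le_trans (ltW ss')).
  have h2 : h * h0 <= e.
    move: sd4; rewrite ltr_pdivlMr ?ltr_wpDl// => /ltW; apply: le_trans.
    by rewrite ler_pM2l// lerDl.
  have h3 : h * (h * h0) <= h * e by rewrite ler_pM2l.
  have h4 : h * p (m t) (a0 t) <= h * (p (m s) (a0 t) + e) by rewrite ler_pM2l.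
  have h5 : h * p (m s - m 0 - w2 + P w) (a0 t) <= h * (e * T * K) by rewrite ler_pM2l.
  have h6 := le_trans (ler_norm _) Gh.
  have -> : e * (3 + T * K) * s' = e * (3 + T * K) * s + e * (3 + T * K) * h.
    by rewrite /h; ring.
  have Pwa : p (P (a0 t)) w = p (P w) (a0 t) by rewrite !P_sym ipC.
  move: h5; rewrite (bounded_linearD _ _ bP) (bounded_linearZ _ _ bP).
  rewrite [p (m 0) (_ + _)]ipDr [p (m 0) (_ *: _)]ipZr.
  rewrite (ipDl p _ (P w)) (ipDl p _ (- w2)) (ipDl p (m s)) !(ipNl p _ (a0 t)) => h5.
  have -> : p (h *: a1 t + w1) (h *: a1 t + w1) + p (h *: P (a0 t) + P w) (h *: a0 t + w)
     = h * (h * h0) + 2 * h * (p w1 (a1 t) + p (P w) (a0 t)) + (p w1 w1 + p (P w) w).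
    by rewrite !ipE Pwa (ipC p (a1 t) w1) /h0; ring.
  (* Turns the increment of the energy of w into the pairing of -w2 + P w with u, which [h5]
     evaluates by the integrated equation. *)
  have : p w1 (a1 t) = - p w2 (a0 t) by lra.
  move=> ->; have := mulr_gt0 e0 h_gt0; lra.
Qed.

Lemma time_integral_le T : 0 <= T ->
  q T + 2^-1 * (sq a0 T + sq a1 T) <= 2^-1 * (sq a0 0 + sq a1 0) + 2^-1 * p f0 f0.
Proof.
move=> T0.
have [K aK] : exists K, forall t, 0 <= t <= T -> nrm p (a0 t) <= K.
  have : {within `[0, T], continuous (sq a0)}.
    apply: derivable_within_continuous => x /[!in_itv]/= /andP[x0 _].
    by have [] := is_derive_sq da0 x0.
  move=> /(EVT_max T0)[c _ cM]; exists (Num.sqrt (sq a0 c)) => t tT.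
  by rewrite ler_wsqrtr// cM// in_itv.
suff H1 e : 0 < e -> G T - G 0 <= 2^-1 * p f0 f0 + e.
  have : G T - G 0 <= 2^-1 * p f0 f0 by apply/ler_addgt0Pr.
  by rewrite /G q0; lra.
(* The accumulated error at T is (3 + T K) T times the precision, so precision e / K1 gives at most
   e; the summand 1 keeps K1 positive. *)
move=> e0; pose K1 := (3 + T * K) * T + 1.
have K1_gt0 : 0 < K1.
  rewrite ltr_wpDl// mulr_ge0// addr_ge0// mulr_ge0//.
  by apply: le_trans (aK 0 _); rewrite ?nrm_ge0 ?lexx.
have e1 : 0 < e / K1 by rewrite divr_gt0.
have [||w [w1 [w2 [Dw Dw1 _ wE]]]] :=
    @real_induction R (approx_primitive (e / K1) (3 + T * K)) T T0.
- have D0 : D 0 0.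
    have := D_linear (-1) (Da0 0) (Da0 0); rewrite !scaleN1r !addNr; exact.
  exists 0, 0, 0; split => //; rewrite ?(bounded_linear0 bP) subrr ?subr0 ?addr0 ?mulr0.
    by rewrite /nrm ip0l sqrtr0.
  by rewrite !ipE !addr0 mulr0.
- move=> t tT; exact: approx_primitive_step e1 tT (aK _ tT).
have h1 : p (m 0) w <= 2^-1 * (p f0 f0 + p (P w) w).
  rewrite /m scaleN1r f0E P_sym.
  have := @ip_young _ _ p 1 f0 (S w) ltr01; have := ler_norm (p f0 (S w)).
  rewrite invr1 !mul1r; lra.
have h2 : e / K1 * (3 + T * K) * T <= e.
  have -> : e / K1 * (3 + T * K) * T = e * (((3 + T * K) * T) / K1) by ring.
  by rewrite ger_pMr// ler_pdivrMr// mul1r /K1 lerDl.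
have := ip_ge0 p w1; lra.
Qed.

End Primitive.

(** Here q and q2 are the time integrals of |u|^2 and |u_txx|^2, bounded for all times; subtracting
    them inside a Lyapunov functional cancels the terms without dissipation. *)
Lemma wave_decay (q q2 : R -> R) (K K2 : R) :
  q 0 = 0 -> (forall t, 0 <= t -> is_derive t 1 q (sq a0 t)) ->
  q2 0 = 0 -> (forall t, 0 <= t -> is_derive t 1 q2 (sq b2 t)) ->
  (forall t, 0 <= t -> q t <= K) -> (forall t, 0 <= t -> q2 t <= K2) ->
  let c := 1 - kappa in
  forall t, 0 <= t ->
  (1 + t) ^+ 2 * wave_energy t + 4^-1 / c * (1 + t) * sq a0 t <=
  wave_energy 0 + 2 / c * (lyap 0 * (1 + (6 / c + 2^-1)) + 2^-1 * wave_cross2 0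
    + K2 + 2^-1 * K).
Proof.
move=> q0 dq q20 dq2 qK q2K c.
have k0 : 0 < c by rewrite subr_gt0; case/andP: kappa01.
(* The part 6 / c produces -6 times the energy, against 3 from [lyap_le], 2 from |b_1|^2 and 1/2
   from the commutator. The part 1/2 lets A [lyap] dominate the negative part of half of
   [wave_cross2]. *)
pose A := 6 / c + 2^-1.
have A0 : 2^-1 <= A by rewrite lerDr divr_ge0// ltW.
(* In the derivative, [lyap] comes from the weight 1 + t. Its |a_2|^2 and potential parts of second
   order are cancelled by half of [wave_cross2], its |a_0|^2 / 2 by q / 2, and the two halves of
   |b_2|^2 by q2. *)
pose L t := (1 + t) * lyap t + 2^-1 * wave_cross2 t + A * lyap t
  + (-1) * q2 t + (- 2^-1) * q t.
pose dL t := ((1 + t) * dlyap t + 1 * lyap t) + 2^-1 * dwave_cross2 t + A * dlyap t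
  + (-1) * sq b2 t + (- 2^-1) * sq a0 t.
have d1t t : is_derive t 1 (fun s : R => 1 + s) 1.
  by have := is_derive_add (is_derive_cst (1 : R) t 1) (is_derive_id t 1); rewrite add0r.
have dLd t : 0 <= t -> is_derive t 1 L (dL t).
  move=> t0; apply: is_derive_add; first apply: is_derive_add; first apply: is_derive_add;
    first apply: is_derive_add.
  - exact: (is_derive_mul (d1t t) (is_derive_lyap t0)).
  - exact/is_derive_scale/is_derive_wave_cross2.
  - exact/is_derive_scale/is_derive_lyap.
  - exact/is_derive_scale/dq2.
  - exact/is_derive_scale/dq.
have dL_le t : 0 < t -> dL t <= - (c * (1 + t) * wave_energy t).
  move=> t0; have E0 := wave_energy_ge0 t.
  have h1 : (1 + t) * dlyap t <= (1 + t) * (- c * wave_energy t).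
    by rewrite ler_wpM2l ?dlyap_le//; lra.
  have h2 : A * dlyap t <= - (6 * wave_energy t).
    apply: (@le_trans _ _ (A * (- c * wave_energy t))).
      by rewrite ler_wpM2l ?dlyap_le//; lra.
    have -> : A * (- c * wave_energy t) = - (6 + 2^-1 * c) * wave_energy t.
      by rewrite /A; field; rewrite gt_eqF.
    have := mulr_ge0 (ltW k0) E0; lra.
  have h3 := lyap_le t.
  have h4 := P1_le (a0 t) (a1 t); have h5 := ler_norm (- p (P1 (a0 t)) (a1 t)).
  rewrite normrN in h5.
  have h6 : kappa * (p (P (a0 t)) (a0 t) + p (a1 t) (a1 t)) <= pot a0 t + sq a1 t.
    rewrite ler_piMl ?addr_ge0 ?ip_ge0 ?pot_ge0//; by case/andP: kappa01 => _ /ltW.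
  have := ip_ge0 p (b0 t); have := ip_ge0 p (b1 t); have := pot_ge0 a0 t.
  have := ip_ge0 p (a1 t); rewrite -/(sq b0 t) -/(sq b1 t) -/(sq a1 t) => ? ? ? ?.
  rewrite /dL dwave_cross2E//; rewrite /wave_energy2 /wave_energy in E0 h1 h2 h3 *; lra.
(* The factor 2 / c turns the dissipation c (1 + t) of L into 2 (1 + t), the derivative of the
   weight (1 + t)^2. *)
pose M t := (1 + t) * ((1 + t) * wave_energy t) + 2 / c * L t.
have dM t : 0 <= t -> is_derive t 1 M
   (((1 + t) * ((1 + t) * dwave_energy t + 1 * wave_energy t)
    + 1 * ((1 + t) * wave_energy t)) + 2 / c * dL t).
  move=> t0; apply: is_derive_add; last exact/is_derive_scale/dLd.
  have := is_derive_mul (d1t t) (is_derive_mul (d1t t) (is_derive_wave_energy t0)).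
  exact.
move=> t t0; have := nonincreasing_half_line dM _ t0.
have h : forall s, 0 < s -> ((1 + s) * ((1 + s) * dwave_energy s + 1 * wave_energy s)
    + 1 * ((1 + s) * wave_energy s)) + 2 / c * dL s <= 0.
  move=> s s0; have : 2 / c * dL s <= - (2 * (1 + s) * wave_energy s).
    apply: (@le_trans _ _ (2 / c * (- (c * (1 + s) * wave_energy s)))).
      by rewrite ler_wpM2l ?dL_le// divr_ge0// ltW.
    by rewrite le_eqVlt; apply/orP; left; apply/eqP; field; rewrite gt_eqF.
  have : 0 <= (1 + s) * ((1 + s) * sq b0 s) by rewrite !mulr_ge0 ?ip_ge0//; lra.
  rewrite dwave_energyE//; lra.
move=> /(_ h); rewrite /M /L q0 q20.
have -> : (1 + 0 : R) = 1 by rewrite addr0.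
rewrite !mulr0 !addr0 !mul1r => main.
apply: le_trans (_ : _ <= (1 + t) * ((1 + t) * wave_energy t) +
  2 / c * (8^-1 * ((1 + t) * sq a0 t))) _.
  by rewrite le_eqVlt; apply/orP; left; apply/eqP; field; rewrite gt_eqF.
have c_gt0 : 0 < 2 / c by rewrite divr_gt0.
have l1 : (1 + t) * (8^-1 * sq a0 t) <= (1 + t) * lyap t.
  rewrite ler_wpM2l//; first lra.
  have := lyap_ge t; have := wave_energy_ge0 t; have := wave_energy2_ge0 t; lra.
have l2 : 0 <= 2^-1 * wave_cross2 t + A * lyap t.
  have l3 := wave_cross2_ge t; have l4 := lyap_ge t.
  have : 2^-1 * lyap t <= A * lyap t.
    rewrite ler_wpM2r//.
    have := ip_ge0 p (a0 t); have := wave_energy_ge0 t; have := wave_energy2_ge0 t.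
    rewrite -/(sq a0 t); lra.
  have := ip_ge0 p (a0 t); rewrite -/(sq a0 t); lra.
have m1 : 2 / c * (8^-1 * ((1 + t) * sq a0 t)) <= 2 / c * ((1 + t) * lyap t +
    2^-1 * wave_cross2 t + A * lyap t - q2 t - 2^-1 * q t + K2 + 2^-1 * K).
  rewrite ler_pM2l//; have := qK _ t0; have := q2K _ t0; lra.
rewrite -/A; lra.
Qed.

End DampedWave.

(** * Weak derivatives in L^2 and difference quotients *)

Section L2.
Context {R : realType}.
Local Notation mu := (@lebesgue_measure R).
Implicit Types (f g b : R -> R) (h : R).

Lemma L2_measurable f : L2 f -> measurable_fun setT f.
Proof. by rewrite /L2 inE => /andP[/[!inE]]. Qed.

Lemma Lnorm2_powE f : ('N[mu]_(2%:E)[EFin \o f] `^ 2 = \int[mu]_x (f x ^+ 2)%:E)%E.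
Proof.
rewrite poweR_Lnorm//; apply: eq_integral => x _.
by rewrite /= ?poweR_EFin powR_mulrn// real_normK// num_real.
Qed.

Lemma L2P f : L2 f <->
  measurable_fun setT f /\ mu.-integrable setT (EFin \o (fun x => f x ^+ 2)).
Proof.
split=> [f2|[mf /integrableP[_ f2]]].
  by split; [exact: L2_measurable|exact: Lfun2_integrable_sqr].
rewrite /L2 inE; apply/andP; split; rewrite inE//= /finite_norm.
rewrite (@lty_poweRy _ _ 2)// Lnorm2_powE; apply: le_lt_trans f2.
rewrite le_eqVlt; apply/orP; left; apply/eqP; apply: eq_integral => x _.
by rewrite /= ger0_norm ?sqr_ge0.
Qed.

Lemma L2_mul_integrable f g : L2 f -> L2 g ->
  mu.-integrable setT (EFin \o (fun x => f x * g x)).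
Proof. by move=> f2 g2; apply/Lfun1_integrable/Lfun2_mul_Lfun1. Qed.

Lemma sqr_L2norm f : L2 f -> L2norm f ^+ 2 = \int[mu]_x (f x * f x).
Proof.
move=> f2; have := Lnorm2_powE f; rewrite /L2norm.
have fin : ('N[mu]_(2%:E)[EFin \o f])%E \is a fin_num.
  rewrite ge0_fin_numE ?Lnorm_ge0//.
  by move: f2; rewrite /L2 inE => /andP[_]; rewrite inE.
rewrite -[X in (X `^ 2)%E](fineK fin) poweR_EFin.
rewrite powR_mulrn ?fine_ge0 ?Lnorm_ge0// => h.
rewrite /Rintegral; under eq_integral do rewrite -expr2.
by rewrite -h.
Qed.

Lemma L2_lin (a : R) f g : L2 f -> L2 g -> L2 (fun x => a * f x + g x).
Proof.
move=> f2 g2; have [_ S] := @Lfun_submod_closed _ _ R mu 2%:E (lee1n 2).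
exact: S.
Qed.

Lemma L2_cst0 : L2 (fun _ : R => 0 : R).
Proof.
apply/L2P; split; first exact: measurable_cst.
by under eq_fun do rewrite expr0n; exact: integrable0.
Qed.

Lemma L2_dominated f g : measurable_fun setT g -> L2 f ->
  (forall x, `|g x| <= `|f x|) -> L2 g.
Proof.
move=> mg /L2P[mf f2] gf; apply/L2P; split => //.
apply: le_integrable f2 => //.
  exact/measurable_EFinP/measurable_funX.
by move=> x _ /=; rewrite lee_fin !normrX lerXn2r ?nnegrE.
Qed.

Lemma L2Z (a : R) f : L2 f -> L2 (fun x => a * f x).
Proof. by move=> f2; have := L2_lin a f2 L2_cst0; under eq_fun do rewrite addr0. Qed.

Lemma L2D f g : L2 f -> L2 g -> L2 (fun x => f x + g x).
Proof. by move=> f2 g2; have := L2_lin 1 f2 g2; under eq_fun do rewrite mul1r. Qed.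

Lemma L2B f g : L2 f -> L2 g -> L2 (fun x => f x - g x).
Proof.
by move=> f2 g2; have := L2_lin (-1) g2 f2; under eq_fun do rewrite mulN1r addrC.
Qed.

Lemma L2_mul_bounded (M : R) b f : measurable_fun setT b -> (forall x, `|b x| <= M) ->
  L2 f -> L2 (fun x => b x * f x).
Proof.
move=> mb bM f2; apply: (@L2_dominated (fun x => M * f x)).
- by apply: measurable_funM => //; exact: L2_measurable.
- exact: L2Z.
- move=> x; rewrite !normrM ler_wpM2r// (le_trans (bM x))//; exact: ler_norm.
Qed.

Lemma L2_bounded_support (M : R) f : measurable_fun setT f -> (forall x, `|f x| <= M) ->
  (forall x, M < `|x| -> f x = 0) -> L2 f.
Proof.
move=> mf fM f0; apply/L2P; split => //.
have M0 : 0 <= M := le_trans (normr_ge0 _) (fM 0).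
apply: (@le_integrable _ _ _ mu setT measurableT _ (EFin \o (cst (M ^+ 2) \_ `[-M, M]))).
- exact/measurable_EFinP/measurable_funX.
- move=> x _ /=; rewrite lee_fin patchE; case: ifPn => xM.
    by rewrite [cst _ x]/= [leRHS]ger0_norm ?sqr_ge0// normrX lerXn2r ?nnegrE.
  rewrite f0 ?expr0n ?normr0// ltNge ler_norml.
  by apply: contra xM; rewrite inE/= in_itv.
- rewrite -restrict_EFin; apply/integrable_restrict => //; rewrite setTI.
  apply: continuous_compact_integrable; first exact: segment_compact.
  by apply: continuous_subspaceT; exact: cst_continuous.
Qed.

Lemma L2_locally_integrable f : L2 f -> locally_integrable setT f.
Proof.
move=> f2; split; [exact: L2_measurable|exact: openT|move=> K _ cK].
have mK : measurable K by exact: compact_measurable.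
(* On a compact set |f| <= 1 + f^2 suffices. *)
have : mu.-integrable K (EFin \o (fun x => 1 + f x ^+ 2)).
  apply: (@integrableD _ _ _ mu K mK (EFin \o cst 1) (EFin \o (fun x => f x ^+ 2))).
    apply: continuous_compact_integrable => //.
    by apply: continuous_subspaceT; exact: cst_continuous.
  by apply: (@integrableS _ _ _ mu setT) => //; have [] := (L2P f).1 f2.
move/integrableP => [m1]; apply: le_lt_trans; apply: ge0_le_integral => //=.
- apply/measurable_EFinP/measurableT_comp => //.
  by apply: measurable_funTS; exact: L2_measurable.
- by apply/measurable_EFinP/measurableT_comp => //; exact/measurable_EFinP.
- move=> x _; rewrite lee_fin [leRHS]ger0_norm ?addr_ge0 ?sqr_ge0// ler_norml.
  by apply/andP; split; have := sqr_ge0 (f x + 1); have := sqr_ge0 (f x - 1); nra.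
Qed.

Definition translate h (x : measurableTypeR R) : measurableTypeR R := x + h.

Lemma measurable_translate h : measurable_fun setT (translate h).
Proof. exact: measurable_funD. Qed.

HB.instance Definition _ h :=
  @isMeasurableFun.Build _ _ _ _ (translate h) (measurable_translate h).

(** Uniqueness of the measure that gives half-open intervals their length. *)
Lemma lebesgue_translate h (A : set R) : measurable A ->
  pushforward mu (translate h) A = mu A.
Proof.
move=> mA; apply/esym/lebesgue_measure_unique => //= _ [[a b]] _ <-.
rewrite /pushforward (_ : _ @^-1` _ = `]a - h, b - h]%classic).
  rewrite !lebesgue_measure_itv/= !lte_fin ltrD2r.
  by rewrite -!EFinD opprB addrA subrK.
by apply/seteqP; split => x /=; rewrite !in_itv/= /translate ltrBlDr lerBrDr.
Qed.

Lemma ge0_integral_shift h (f : R -> \bar R) : measurable_fun setT f ->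
  (forall x, 0 <= f x)%E -> (\int[mu]_x f (x + h)%R = \int[mu]_x f x)%E.
Proof.
move=> mf f0; have := @ge0_integral_pushforward _ _ _ _ R _ (measurable_translate h) mu setT f.
rewrite preimage_setT => <- //.
by apply: eq_measure_integral => //= A mA _; exact: lebesgue_translate.
Qed.

Lemma integral_shift h (f : R -> \bar R) : measurable_fun setT f ->
  (\int[mu]_x f (x + h)%R = \int[mu]_x f x)%E.
Proof.
move=> mf; rewrite integralE [RHS]integralE; congr (_ - _)%E.
  under eq_integral do rewrite (funepos_comp f (fun x => x + h)).
  exact: (ge0_integral_shift h (measurable_funepos mf) (funepos_ge0 _)).
under eq_integral do rewrite (funeneg_comp f (fun x => x + h)).
exact: (ge0_integral_shift h (measurable_funeneg mf) (funeneg_ge0 _)).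
Qed.

Lemma Rintegral_shift h f : measurable_fun setT f ->
  \int[mu]_x f (x + h) = \int[mu]_x f x.
Proof.
by move=> mf; rewrite /Rintegral (integral_shift h (f := EFin \o f))//; exact/measurable_EFinP.
Qed.

Lemma measurable_fun_shift h f : measurable_fun setT f ->
  measurable_fun setT (fun x : R => f (x + h)).
Proof. by move=> mf; apply: (measurableT_comp mf); exact: measurable_translate. Qed.

Lemma L2_shift h f : L2 f -> L2 (fun x => f (x + h)).
Proof.
move=> /L2P[mf /integrableP[mf2 f2]]; apply/L2P; split.
  exact: measurable_fun_shift.
apply/integrableP; split.
  by apply/measurable_EFinP/measurable_funX; exact: measurable_fun_shift.
by rewrite (ge0_integral_shift h (f := fun x => `|(f x ^+ 2)%:E|%E))//; exact: measurableT_comp.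
Qed.

End L2.

(** * Smooth compactly supported bumps *)

Section Bump.
Context {R : realType}.
Local Notation mu := (@lebesgue_measure R).
Variables (a b : R) (N : nat).
Implicit Types (Q : {poly R}) (k : nat) (x : R).

(** The factor N + 1 makes exp (-1/Y) tend to the indicator of ]a, b[ as N grows. *)
Let Y : {poly R} := (N.+1%:R)%:P * (('X - a%:P) * (b%:P - 'X)).

Let YE x : Y.[x] = N.+1%:R * ((x - a) * (b - x)).
Proof. by rewrite /Y !hornerE. Qed.

Let Y_gt0 x : a < x < b -> 0 < Y.[x].
Proof. by case/andP=> ax xb; rewrite YE !mulr_gt0// subr_gt0. Qed.

(* Closed under differentiation, see [is_derive_bump_family]. *)
Definition bump_family Q k x := if a < x < b
  then Q.[x] * Y.[x]^-1 ^+ k * expR (- Y.[x]^-1) else 0.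

(** The point x0 may be an end of the interval. A quadratic bound there gives the derivative 0 at
    once, without one-sided limits, and holds for the whole family, hence for all derivatives. *)
Lemma bump_family_quadratic Q k x0 : ~~ (a < x0 < b) ->
  exists M, forall x, `|bump_family Q k x| <= M * (x - x0) ^+ 2.
Proof.
move=> x0ab; have [ab|ba] := ltP a b; last first.
  exists 0 => x; rewrite /bump_family; case: ifPn => [/andP[ax xb]|_].
    by have := lt_trans ax xb; rewrite ltNge ba.
  by rewrite normr0 mul0r.
have /EVT_max : {within `[a, b], continuous (fun x => `|Q.[x]|)}.
  apply: continuous_subspaceT => x.
  by apply: continuous_comp; [exact: continuous_horner|exact: norm_continuous].
move=> /(_ (ltW ab))[c _ cM].
pose L := N.+1%:R * (b - a).
exists (`|Q.[c]| * (k.+2)`!%:R * L ^+ 2) => x; rewrite /bump_family; case: ifPn => xab; last first.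
  by rewrite normr0 mulr_ge0 ?sqr_ge0// mulr_ge0 ?sqr_ge0// mulr_ge0.
have Y0 := Y_gt0 xab; have Y1 : 0 < Y.[x]^-1 by rewrite invr_gt0.
(* A single term of the exponential series: z^(k+2) <= (k+2)! exp z at z = 1/Y. The two extra powers
   leave Y^2, and Y vanishes linearly at the ends. *)
have e1 : Y.[x]^-1 ^+ k * expR (- Y.[x]^-1) <= (k.+2)`!%:R * Y.[x] ^+ 2.
  have h1 := expR_ge1Dxn k.+1 (ltW Y1).
  have f0 : 0 < (k.+2)`!%:R :> R by rewrite ltr0n fact_gt0.
  have h2 : Y.[x]^-1 ^+ k.+2 <= (k.+2)`!%:R * expR (Y.[x]^-1).
    by rewrite mulrC -ler_pdivrMr//; lra.
  rewrite expRN ler_pdivrMr ?expR_gt0// mulrAC -(@ler_pM2r _ (Y.[x]^-1 ^+ 2)) ?exprn_gt0//.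
  have -> : (k.+2)`!%:R * expR Y.[x]^-1 * Y.[x] ^+ 2 * Y.[x]^-1 ^+ 2 =
     (k.+2)`!%:R * expR Y.[x]^-1.
    by field; rewrite gt_eqF.
  by rewrite -exprD addn2.
have Yle : Y.[x] <= L * `|x - x0|.
  rewrite YE /L -mulrA ler_pM2l//; case/andP: xab => ax xb.
  move: x0ab; rewrite negb_and -!leNgt => /orP[x0a|bx0].
    rewrite ger0_norm; last lra.
    rewrite mulrC; apply: ler_pM; lra.
  rewrite ler0_norm; last lra.
  apply: ler_pM; lra.
rewrite !normrM -mulrA; rewrite (ger0_norm (expR_ge0 _)) [`|_ ^+ k|]ger0_norm; last first.
  by rewrite exprn_ge0// ltW.
have -> : `|Q.[c]| * (k.+2)`!%:R * L ^+ 2 * (x - x0) ^+ 2 =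
   `|Q.[c]| * ((k.+2)`!%:R * (L * `|x - x0|) ^+ 2).
  by rewrite [(L * _) ^+ 2]exprMn [`|_| ^+ 2]real_normK ?num_real//; ring.
apply: ler_pM => //.
- by rewrite mulr_ge0 ?expR_ge0// exprn_ge0// ltW.
- by apply: cM; rewrite in_itv/=; case/andP: xab => /ltW -> /ltW ->.
- apply: (le_trans e1); rewrite ler_pM2l ?ltr0n ?fact_gt0//.
  by rewrite lerXn2r ?nnegrE ?(ltW Y0)// mulr_ge0// mulr_ge0// subr_ge0 ltW.
Qed.

Lemma is_derive_quadratic (f : R -> R) (M x0 : R) :
  (forall x, `|f x| <= M * (x - x0) ^+ 2) -> is_derive x0 1 f 0.
Proof.
move=> fM; have f0 : f x0 = 0.
  by apply/eqP; rewrite -normr_le0 (le_trans (fM _))// subrr expr0n mulr0.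
have cv : h^-1 *: (f (h *: 1 + x0) - f x0) @[h --> 0^'] --> (0 : R).
  apply: (@cvg0_squeeze _ _ _ _ _ (fun h => M * `|h|)) => [h|].
    have [->|h0] := eqVneq h 0.
      by rewrite invr0 scale0r !normr0 mulr0.
    rewrite f0 subr0 normrM normfV ler_pdivrMl ?normr_gt0//.
    apply: (le_trans (fM _)); rewrite [h *: 1]mulr1 addrK -[h ^+ 2]real_normK ?num_real//.
    by rewrite expr2 mulrCA.
  rewrite -[X in _ --> X](mulr0 M) -[in X in _ --> X](@normr0 _ R).
  apply: cvgMl_tmp; apply: cvg_norm; exact: cvg_within.
by apply: DeriveDef; [apply/cvg_ex; exists 0; exact: cv|apply/cvg_lim => //; exact: cv].
Qed.

Lemma is_derive_bump_family Q k x : is_derive x 1 (bump_family Q k)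
  (bump_family (Q^`() * Y ^+ 2 - k%:R *: (Q * Y^`() * Y) + Q * Y^`()) k.+2 x).
Proof.
have [xab|xab] := boolP (a < x < b); last first.
  rewrite {2}/bump_family (negbTE xab).
  by have [M /is_derive_quadratic] := bump_family_quadratic Q k xab.
have Y0 := Y_gt0 xab; have Yn : Y.[x] != 0 by rewrite gt_eqF.
pose z y := Y.[y]^-1.
have dz : is_derive x 1 z (- Y^`().[x] * z x ^+ 2).
  have := is_deriveV Yn (is_derive_poly Y x).
  by move=> /is_derive_eq; apply; rewrite /GRing.scale/= /z exprVn; ring.
have dzk : is_derive x 1 (fun y => z y ^+ k) (- (k%:R * Y^`().[x]) * z x ^+ k.+1).
  have := is_deriveX k dz; rewrite exprfctE => /is_derive_eq; apply; rewrite /GRing.scale/=.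
  by case: k => [|k']; rewrite ?mul0r ?oppr0 ?mul0r// !exprS; ring.
have de : is_derive x 1 (fun y => expR (- z y)) (Y^`().[x] * z x ^+ 2 * expR (- z x)).
  have := @is_derive1_comp _ _ _ x _ _ (is_derive_expR (- z x)) (is_deriveN dz).
  by move=> /is_derive_eq; apply; ring.
apply: (@near_eq_is_derive _ _ _ (fun y => Q.[y] * z y ^+ k * expR (- z y))).
  near=> y; rewrite /bump_family ifT//.
  near: y; apply: (@filterS _ _ _ `]a, b[%classic); first by move=> y /=; rewrite in_itv.
  by apply: open_nbhs_nbhs; split; [exact: interval_open|rewrite /= in_itv].
have := is_derive_mul (is_derive_mul (is_derive_poly Q x) dzk) de.
move=> /is_derive_eq; apply; rewrite /bump_family xab -/(z x).
have -> : (Q^`() * Y ^+ 2 - k%:R *: (Q * Y^`() * Y) + Q * Y^`()).[x] =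
    Q^`().[x] * Y.[x] ^+ 2 - k%:R * (Q.[x] * Y^`().[x] * Y.[x]) + Q.[x] * Y^`().[x].
  by move: (Y) => Z; rewrite !(hornerD, hornerN, hornerZ, hornerM, horner_exp).
have zY : Y.[x] = (z x)^-1 by rewrite invrK.
rewrite zY !exprS expr0; field.
by rewrite /z invr_eq0.
Unshelve. all: by end_near. Qed.

Lemma derive1n_bump_family j Q k :
  exists Q' k', derive1n j (bump_family Q k) = bump_family Q' k'.
Proof.
elim: j => [|j [Q1 [k1 IH]]]; first by exists Q, k.
eexists; exists k1.+2; rewrite derive1nS IH; apply/funext => x.
by rewrite derive1E; have d := is_derive_bump_family Q1 k1 x; rewrite derive_val.
Qed.

Lemma test_function_bump_family Q k : test_function (bump_family Q k).
Proof.
split=> [j|].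
  split=> [i _ x|].
    have [Q1 [k1 ->]] := derive1n_bump_family i Q k.
    by have [] := is_derive_bump_family Q1 k1 x.
  have [Q1 [k1 ->]] := derive1n_bump_family j Q k.
  move=> x; apply/differentiable_continuous/derivable1_diffP.
  by have [] := is_derive_bump_family Q1 k1 x.
exists (Num.max `|a| `|b|) => x; rewrite gt_max => /andP[xa xb].
rewrite /bump_family ifF//; apply/negP => /andP[ax bx].
have [x0|x0] := leP 0 x.
  move: xb; rewrite (ger0_norm x0) ltNge => /negP; apply.
  by rewrite (le_trans (ltW bx))// ler_norm.
move: xa; rewrite (ltr0_norm x0) ltNge => /negP; apply.
by rewrite -normrN (le_trans _ (ler_norm _))// lerN2 ltW.
Qed.

End Bump.

(** * The du Bois-Reymond lemma *)

Section DuBoisReymond.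
Context {R : realType}.
Local Notation mu := (@lebesgue_measure R).
Implicit Types (g : R -> R) (a b x : R).

Definition bump a b n : R -> R := bump_family a b n 1 0.

Lemma bumpE a b n x : bump a b n x = if a < x < b
  then expR (- (n.+1%:R * ((x - a) * (b - x)))^-1) else 0.
Proof. by rewrite /bump /bump_family !hornerE. Qed.

Lemma bump_le a b n x : `|bump a b n x| <= \1_(`[a, b]%classic) x.
Proof.
rewrite bumpE indicE; case: ifPn => [/andP[ax xb]|_]; last by rewrite normr0.
rewrite mem_set/=; last by rewrite in_itv/= !ltW.
rewrite ger0_norm ?expR_ge0// -expR0 ler_expR oppr_le0 invr_ge0.
by rewrite mulr_ge0// mulr_ge0// subr_ge0 ltW.
Qed.

Lemma bump_cvg a b x : bump a b n x @[n --> \oo] --> (\1_(`]a, b[%classic) x : R).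
Proof.
rewrite indicE; have [xab|xab] := boolP (a < x < b); last first.
  under eq_fun do rewrite bumpE (negbTE xab).
  by rewrite memNset//= ?in_itv/=; [exact: cvg_cst|exact/negP].
under eq_fun do rewrite bumpE xab; rewrite mem_set; last by rewrite /= in_itv.
rewrite (_ : true%:R = expR (- 0)); last by rewrite oppr0 expR0.
apply: continuous_cvg; first exact: continuous_expR.
apply: cvgN; under eq_fun do rewrite invfM.
rewrite (_ : (0 : R) = 0 * ((x - a) * (b - x))^-1); last by rewrite mul0r.
by apply: cvgMr_tmp; exact: cvg_harmonic.
Qed.

Lemma locally_integrable_itv g a b : locally_integrable setT g ->
  mu.-integrable `[a, b] (EFin \o g).
Proof.
move=> [mg _ gK]; apply/integrableP; split.
  by apply/measurable_EFinP; exact: measurable_funTS.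
by apply: gK => //; exact: segment_compact.
Qed.

(** Dominated convergence along the bumps on ]a, b[, which stay below the indicator of [a, b]. *)
Lemma integral_itv_eq0 g : locally_integrable setT g ->
  (forall phi, test_function phi -> \int[mu]_x (g x * phi x) = 0) ->
  forall a b, (\int[mu]_(x in `]a, b[) (g x)%:E)%E = 0%E.
Proof.
move=> lg g0 a b; have [mg _ _] := lg.
have mbump n : measurable_fun setT (bump a b n).
  apply: continuous_measurable_fun => x; have [+ _] := test_function_bump_family a b n 1 0.
  by move=> /(_ 0%N)[_]; exact.
have ig : mu.-integrable setT (EFin \o (fun x => g x * \1_(`[a, b]%classic) x)).
  have := locally_integrable_itv a b lg.
  rewrite integrable_mkcond; last exact: measurable_itv.
  congr (integrable _ _ _).
  apply/funext => x; rewrite /= patchE indicE; case: ifP => _; rewrite ?mulr1 ?mulr0//.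
have bound n x : `|g x * bump a b n x| <= `|g x * \1_(`[a, b]%classic) x|.
  rewrite !normrM ler_wpM2l// (le_trans (bump_le _ _ _ _))//; exact: ler_norm.
have [_ _ cv] := @dominated_convergence _ _ R mu setT measurableT
  (fun n x => (g x * bump a b n x)%:E) (fun x => (g x * \1_(`]a, b[%classic) x)%:E)
  (fun x => `|(g x * \1_(`[a, b]%classic) x)%:E|)%E
  (fun n => (measurable_EFinP _ _).2 (measurable_funM mg (mbump n)))
  ((measurable_EFinP _ _).2 (measurable_funM mg (measurable_indic (measurable_itv _))))
  ltac:(apply: nearW => x _; apply/fine_cvgP; split; [exact: nearW|]; apply: cvgMl_tmp; exact: bump_cvg)
  ltac:(exact: integrable_abse)
  ltac:(apply: nearW => x n _; rewrite /= lee_fin; exact: bound).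
have z n : (\int[mu]_x (g x * bump a b n x)%:E = 0)%E.
  have := g0 _ (test_function_bump_family a b n 1 0); rewrite /Rintegral => h0.
  rewrite -[LHS]fineK ?h0//; apply: integrable_fin_num => //.
  apply: le_integrable ig => //.
    exact: (measurable_EFinP _ _).2 (measurable_funM mg (mbump n)).
  by move=> x _; rewrite /= lee_fin.
have <- : (\int[mu]_x (g x * \1_(`]a, b[%classic) x)%:E = \int[mu]_(x in `]a, b[) (g x)%:E)%E.
  rewrite [RHS]integral_mkcond; apply: eq_integral => x _; rewrite patchE indicE.
  by case: ifP => _; rewrite ?mulr1 ?mulr0.
move: cv; rewrite [X in X @ _ --> _](_ : _ = cst 0%E); last first.
  by apply/funext => n; rewrite /= z.
by move=> /(cvg_unique (@ereal_hausdorff R) (cvg_cst _)) <-.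
Qed.

Lemma nicely_shrinking_right x : nicely_shrinking x (fun n => `]x, x + n.+1%:R^-1[%classic).
Proof.
split=> [n|]; first exact: measurable_itv.
have r0 n : 0 < (n.+1%:R^-1 : R) by rewrite invr_gt0.
(* The one-sided interval fills half of the ball of the same radius, hence the ratio 2. *)
exists (2, fun n => PosNum (r0 n)); split => //=.
- exact: cvg_harmonic.
- by move=> n y /=; rewrite in_itv/= /ball/= => /andP[xy yx]; rewrite distrC ger0_norm ?subr_ge0 ?ltrBlDl// ltW.
- move=> n; rewrite lebesgue_measure_ball; last exact: ltW.
  rewrite lebesgue_measure_itv/= lte_fin ltrDl r0.
  by rewrite -EFinB -EFinM lee_fin [x + _]addrC addrK mulr_natl.
Qed.

(** At a Lebesgue point g is the limit of its averages over ]x, x + 1/(n+1)[, and these vanish. *)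
Lemma du_bois_reymond g : locally_integrable setT g ->
  (forall phi, test_function phi -> \int[mu]_x (g x * phi x) = 0) ->
  {ae mu, forall x, g x = 0}.
Proof.
move=> lg g0; have := lebesgue_differentiation lg; apply: filterS;
  first exact: (ae_filter_ringOfSetsType mu).
move=> x gx.
have := nice_lebesgue_differentiation nicely_shrinking_right lg gx.
under eq_fun do rewrite (integral_itv_eq0 lg g0) mule0.
by move=> /(cvg_unique _ (cvg_cst _)) => /(_ (@ereal_hausdorff R)) [].
Qed.

End DuBoisReymond.

(** * The semi-inner product of square integrable functions *)

Section L2Space.
Context {R : realType}.
Local Notation mu := (@lebesgue_measure R).

Definition L2space := LfunType mu (lee1n 2).
HB.instance Definition _ := GRing.Lmodule.on L2space.

Definition l2ip (f g : R -> R) : R := \int[mu]_x (f x * g x).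

Lemma L2_L2space (f : L2space) : L2 f. Proof. exact: LfunP. Qed.

Definition toL2 f (f2 : L2 f) : L2space := Lfun_Sub (lee1n 2) f2.

Lemma l2ip_linear a f g z : L2 f -> L2 g -> L2 z ->
  l2ip (fun x => a * f x + g x) z = a * l2ip f z + l2ip g z.
Proof.
move=> f2 g2 z2; rewrite /l2ip -RintegralZl//; last exact: L2_mul_integrable.
rewrite -RintegralD//; last exact: L2_mul_integrable.
  by apply: eq_Rintegral => x _; rewrite mulrDl mulrA.
by have := L2_mul_integrable (L2Z a f2) z2; congr (integrable _ _ _);
   apply/funext => x /=; rewrite mulrA.
Qed.

Lemma l2ip_ge0 f : 0 <= l2ip f f.
Proof. by apply: Rintegral_ge0 => x _; exact: sqr_ge0. Qed.

Lemma l2ipC f g : l2ip f g = l2ip g f.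
Proof. by apply: eq_Rintegral => x _; rewrite mulrC. Qed.

Definition l2inner : semi_inner L2space := SemiInner
  (fun f g : L2space => l2ipC f g)
  (fun a f g z => l2ip_linear a (L2_L2space f) (L2_L2space g) (L2_L2space z))
  (fun f => l2ip_ge0 f).

Lemma l2ip_cauchy f g : L2 f -> L2 g -> l2ip f g ^+ 2 <= l2ip f f * l2ip g g.
Proof. by move=> f2 g2; exact: (ip_cauchy l2inner (toL2 f2) (toL2 g2)). Qed.

Lemma l2ipE f g : L2 f -> L2 g -> (\int[mu]_x (f x * g x)%:E)%E = (l2ip f g)%:E.
Proof.
move=> f2 g2; rewrite /l2ip /Rintegral fineK//.
exact/integrable_fin_num/L2_mul_integrable.
Qed.

End L2Space.

(** * Exchange of integrals for translates *)

Section Fubini.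
Context {R : realType}.
Local Notation mu := (@lebesgue_measure R).
Implicit Types (P : R * R -> R).

Lemma measurable_section_integral P : measurable_fun setT P ->
  measurable_fun setT (fun x => \int[mu]_y (P (x, y))%:E)%E.
Proof.
move=> mP; have mEP := (measurable_EFinP _ _).2 mP.
have -> : (fun x => \int[mu]_y (P (x, y))%:E)%E = (fun x =>
    \int[mu]_y (EFin \o P)^\+%E (x, y) - \int[mu]_y (EFin \o P)^\-%E (x, y))%E.
  apply/funext => x; rewrite [LHS]integralE.
  by rewrite (funepos_comp (EFin \o P) (fun y => (x, y))) (funeneg_comp (EFin \o P) (fun y => (x, y))).
apply: emeasurable_funB; apply: measurable_fun_fubini_tonelli_F => //.
- exact: measurable_funepos.
- exact: measurable_funeneg.
Qed.

Lemma Rfubini P : (mu \x mu)%E.-integrable setT (EFin \o P) ->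
  \int[mu]_x (\int[mu]_y P (x, y)) = \int[mu]_y (\int[mu]_x P (x, y)).
Proof.
move=> iP; have mP : measurable_fun setT P by case/integrableP : iP => /measurable_EFinP.
have mPC : measurable_fun setT (fun z : R * R => P (z.2, z.1)).
  by apply: (measurableT_comp mP); exact: measurable_swap.
rewrite /Rintegral.
transitivity (fine (\int[mu]_x \int[mu]_y (P (x, y))%:E)%E).
  congr fine; apply: ae_eq_integral => //.
  - apply/measurable_EFinP/(measurableT_comp (fine_measurable measurableT)) => //.
    exact: measurable_section_integral.
  - exact: measurable_section_integral.
  (* The inner integral is known to be finite only almost everywhere; [fine] sends infinite values
     to 0. *)
  - have := ae_integrable1 iP; apply: filterS => x ix _.
    by rewrite fineK//; exact: integrable_fin_num.
rewrite (Fubini iP); congr fine; apply: ae_eq_integral => //.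
- exact: (measurable_section_integral mPC).
- apply/measurable_EFinP/(measurableT_comp (fine_measurable measurableT)) => //.
  exact: (measurable_section_integral mPC).
- have := ae_integrable2 iP; apply: filterS => x ix _.
  by rewrite fineK//; exact: integrable_fin_num.
Qed.

Lemma Rintegral_indic (D : set R) (f : R -> R) :
  \int[mu]_(x in D) f x = \int[mu]_x (f x * \1_D x).
Proof.
rewrite Rintegral_mkcond; apply: eq_Rintegral => x _.
by rewrite patchE indicE; case: ifP => _; rewrite ?mulr1 ?mulr0.
Qed.

Lemma integral_indic_mul (D : set R) (f : R -> R) :
  (\int[mu]_(x in D) (f x)%:E = \int[mu]_x (f x * \1_D x)%:E)%E.
Proof.
rewrite [LHS]integral_mkcond; apply: eq_integral => x _; rewrite patchE indicE.
by case: ifP => _; rewrite ?mulr1 ?mulr0.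
Qed.

Lemma measurable_add_mul (s : R) : measurable_fun setT (fun z : R * R => z.1 + s * z.2).
Proof.
apply: measurable_funD; first exact: measurable_fst.
by apply: measurable_funM => //; exact: measurable_snd.
Qed.

(** Uses |f g| <= (f^2 + g^2) / 2 and translation invariance, then the finite length of ]0, h[. The
    factor s is the direction of translation, 1 or -1 in the applications. *)
Lemma integrable_translates (s h : R) (f g : R -> R) : L2 f -> L2 g ->
  (mu \x mu)%E.-integrable setT
    (EFin \o (fun z : R * R => f (z.1 + s * z.2) * g z.1 * \1_(`]0, h[%classic) z.2)).
Proof.
move=> f2 g2; have mf := L2_measurable f2; have mg := L2_measurable g2.
have mF : measurable_fun setT
    (fun z : R * R => f (z.1 + s * z.2) * g z.1 * \1_(`]0, h[%classic) z.2).
  apply: measurable_funM; first apply: measurable_funM.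
  - exact: (measurableT_comp mf (measurable_add_mul s)).
  - exact: (measurableT_comp mg measurable_fst).
  - exact: (measurableT_comp (measurable_indic (measurable_itv _)) measurable_snd).
apply/integrable21ltyP; first exact/measurable_EFinP.
pose K := 2^-1 * (l2ip f f + l2ip g g).
apply: (@le_lt_trans _ _ (\int[mu]_y (K * \1_(`]0, h[%classic) y)%:E)%E); last first.
  rewrite -integral_indic_mul integral_cst; last exact: measurable_itv.
  rewrite (_ : lebesgue_measure_lebesgue_measure__canonical__measure_function_Measure R _ = mu `]0, h[%classic)//.
  by rewrite lebesgue_measure_itv/=; case: ifP => _; rewrite ?mule0// -EFinB -EFinM ltry.
apply: ge0_le_integral => //.
- by move=> y _; exact: integral_ge0.
- pose F (z : R * R) := abse (f (z.1 + s * z.2) * g z.1 * \1_(`]0, h[%classic) z.2)%:E.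
  apply: (@measurable_fun_fubini_tonelli_G _ _ _ _ R mu F) => //.
    by apply: measurableT_comp => //; exact/measurable_EFinP.
  by move=> z; exact: abse_ge0.
- apply/measurable_EFinP/measurable_funM => //; exact: (measurable_indic (measurable_itv _)).
move=> y _ /=.
apply: (@le_trans _ _ (\int[mu]_x ((2^-1 * (f (x + s * y) * f (x + s * y) + g x * g x)) * \1_(`]0, h[%classic) y)%:E)%E).
  apply: ge0_le_integral => //.
  - apply/measurable_EFinP/measurableT_comp => //; apply: measurable_funM => //.
    by apply: measurable_funM => //; exact: measurable_fun_shift.
  - apply/measurable_EFinP/measurable_funM => //; apply: measurable_funM => //.
    by apply: measurable_funD; apply: measurable_funM => //; exact: measurable_fun_shift.
  - move=> x _; rewrite lee_fin normrM (ger0_norm (_ : 0 <= \1_ _ y)) ?indicE//.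
    rewrite ler_wpM2r// ler_norml; apply/andP; split.
      by have := sqr_ge0 (f (x + s * y) + g x); rewrite sqrrD !expr2; lra.
    by have := sqr_ge0 (f (x + s * y) - g x); rewrite sqrrB !expr2; lra.
have fs2 := L2_shift (s * y) f2.
have -> : (\int[mu]_x ((2^-1 * (f (x + s * y) * f (x + s * y) + g x * g x)) * \1_(`]0, h[%classic) y)%:E
    = (K * \1_(`]0, h[%classic) y)%:E)%E.
  under eq_integral do rewrite mulrC mulrA EFinM.
  rewrite integralZl//; last first.
    by have := integrableD measurableT (L2_mul_integrable fs2 fs2) (L2_mul_integrable g2 g2).
  under eq_integral do rewrite EFinD.
  rewrite integralD//; [|exact: (L2_mul_integrable fs2 fs2)|exact: (L2_mul_integrable g2 g2)].
  rewrite (l2ipE fs2 fs2) (l2ipE g2 g2) -EFinD -EFinM /K; congr (_%:E).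
  rewrite (_ : l2ip (fun x => f (x + s * y)) _ = l2ip f f); first ring.
  by apply: (Rintegral_shift (s * y) (f := fun x => f x * f x)); exact: measurable_funM.
exact: lexx.
Qed.

Lemma fubini_translates (s h : R) (f g : R -> R) : L2 f -> L2 g ->
  \int[mu]_x (\int[mu]_(y in `]0, h[) (f (x + s * y) * g x)) =
  \int[mu]_(y in `]0, h[) (\int[mu]_x (f (x + s * y) * g x)).
Proof.
move=> f2 g2; have := Rfubini (integrable_translates s h f2 g2).
rewrite /=; under eq_Rintegral do rewrite -Rintegral_indic.
move=> ->; rewrite [RHS]Rintegral_indic; apply: eq_Rintegral => y _.
rewrite RintegralZr//; have fs2 := L2_shift (s * y) f2; exact: (L2_mul_integrable fs2 g2).
Qed.

End Fubini.

(** * Test functions, their primitives and increments *)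

Section TestFunctions.
Context {R : realType}.
Local Notation mu := (@lebesgue_measure R).
Implicit Types (phi Phi : R -> R) (k j : nat) (h x y : R).

Lemma derive1nD k j phi : derive1n j (derive1n k phi) = derive1n (j + k) phi.
Proof. by elim: j => [|j IH] //; rewrite derive1nS IH -derive1nS. Qed.

Lemma test_function_is_derive phi k x : test_function phi ->
  is_derive x 1 (derive1n k phi) (derive1n k.+1 phi x).
Proof.
move=> [/(_ k.+1)[/(_ k (ltnSn k) x) d _] _].
by apply: (DeriveDef d); rewrite derive1nS derive1E.
Qed.

Lemma test_function_support phi k : test_function phi ->
  exists2 M, 0 <= M & forall x, M < `|x| -> derive1n k phi x = 0.
Proof.
move=> [_ [M phi0]]; exists (Num.max 0 M); first by rewrite le_max lexx.
elim: k => [x|k IH x xM]; first by rewrite gt_max => /andP[_ /phi0].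
rewrite derive1nS derive1E (@near_eq_derive _ _ _ _ (cst 0)) ?derive_cst//.
near=> y; apply: IH; near: y.
apply: (@open_nbhs_nbhs _ x [set y | Num.max 0 M < `|y|]); split => //.
by apply: (@open_comp _ _ (fun y : R => `|y|) [set z | Num.max 0 M < z]) => [y _|];
  [exact: norm_continuous|exact: open_gt].
Unshelve. all: by end_near. Qed.

Lemma test_function_derive1n phi k : test_function phi -> test_function (derive1n k phi).
Proof.
move=> tphi; split; last by have [M _ M0] := test_function_support k tphi; exists M.
move=> j; split=> [i _ x|].
  by rewrite derive1nD; have [] := test_function_is_derive (i + k) x tphi.
by rewrite derive1nD; case: tphi => /(_ (j + k)%N)[].
Qed.

Lemma test_function_continuous phi k : test_function phi -> continuous (derive1n k phi).
Proof. by case=> /(_ k)[]. Qed.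

Lemma test_function_bounded phi k : test_function phi ->
  exists M, (forall x, `|derive1n k phi x| <= M) /\
    (forall x, M < `|x| -> derive1n k phi x = 0).
Proof.
move=> tphi; have [M M0 phi0] := test_function_support k tphi.
have MM : - M <= M by rewrite (le_trans _ M0)// oppr_le0.
have /(EVT_max MM)[c _ cM] : {within `[-M, M], continuous (fun x => `|derive1n k phi x|)}.
  apply: continuous_subspaceT => x; apply: continuous_comp; last exact: norm_continuous.
  exact: test_function_continuous.
exists (Num.max M `|derive1n k phi c|); split=> x.
  have [xM|xM] := leP `|x| M; last by rewrite phi0// normr0 le_max M0.
  by rewrite le_max cM ?orbT// in_itv/= -ler_norml.
by rewrite gt_max => /andP[/phi0].
Qed.

Lemma test_function_L2 phi k : test_function phi -> L2 (derive1n k phi).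
Proof.
move=> tphi; have [M [M1 M2]] := test_function_bounded k tphi.
apply: L2_bounded_support M1 M2; apply: continuous_measurable_fun.
exact: test_function_continuous.
Qed.

Lemma L2_indic (a b : R) : L2 (\1_(`]a, b[%classic) : R -> R).
Proof.
apply: (@L2_bounded_support _ (Num.max 1 (Num.max `|a| `|b|))).
- exact: measurable_indic (measurable_itv _).
- move=> x; rewrite indicE le_max; case: (_ \in _); by rewrite ?normr1 ?normr0 ?lexx ?ler01.
- move=> x; rewrite !gt_max => /and3P[_ ax bx].
  rewrite indicE memNset//= in_itv/= => /andP[ax' xb'].
  have [x0|x0] := leP 0 x.
    move: bx; rewrite (ger0_norm x0) ltNge => /negP; apply.
    by rewrite (le_trans (ltW xb'))// ler_norm.
  move: ax; rewrite (ltr0_norm x0) ltNge => /negP; apply.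
  by rewrite -normrN (le_trans _ (ler_norm _))// lerN2 ltW.
Qed.

(** The primitive is in general not compactly supported; only its increments over a fixed step serve
    as test functions. *)
Lemma test_function_primitive phi : test_function phi ->
  exists Phi, forall x, is_derive x 1 Phi (phi x).
Proof.
move=> tphi; have iphi : mu.-integrable setT (EFin \o phi).
  have [M [_ M0]] := test_function_bounded 0 tphi.
  have := L2_mul_integrable (test_function_L2 0 tphi) (L2_indic (- (`|M| + 1)) (`|M| + 1)).
  congr (integrable _ _ _); apply/funext => x /=; rewrite indicE.
  have [xM|xM] := boolP (x \in _); first by rewrite mulr1.
  rewrite mulr0; congr (_%:E); apply/esym/M0.
  apply: (@le_lt_trans _ _ `|M|); first exact: ler_norm.
  rewrite ltNge; apply: contra xM => xM; rewrite inE/= in_itv/= -ltr_norml.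
  by rewrite (le_lt_trans xM)// ltrDl.
exists (fun x => \int[mu]_(t in [set` `]-oo, x]]) phi t) => x.
have [] := @continuous_FTC1 R phi -oo%O x (x + 1).
- by rewrite ltrDl.
- by apply: integrableS iphi => //; exact: measurable_itv.
- by rewrite ltNyr.
- exact: (@test_function_continuous phi 0 tphi).
by move=> d e; apply: (DeriveDef d); rewrite -derive1E; exact: e.
Qed.

Lemma is_derive_shift_sub (f : R -> R) (df h x : R) : is_derive (x - h) 1 f df ->
  is_derive x 1 (fun y => f (y - h)) df.
Proof.
move=> d; have d2 : is_derive x 1 (fun y : R => y - h) 1.
  by have := is_derive_add (is_derive_id x 1) (is_derive_cst (- h) x 1); rewrite addr0.
by have := @is_derive1_comp _ f (fun y => y - h) x _ _ d d2; rewrite mulr1.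
Qed.

Lemma is_derive_bdiff (f : R -> R) (df : R -> R) (c h x : R) : (forall y : R, is_derive y 1 f (df y)) ->
  is_derive x 1 (fun y => c * (f y - f (y - h))) (c * (df x - df (x - h))).
Proof.
move=> d; have d2 := is_derive_scale (-1) (is_derive_shift_sub (d (x - h))).
have := is_derive_scale c (is_derive_add (d x) d2).
by rewrite mulN1r; under eq_fun do rewrite mulN1r.
Qed.

Lemma derive1n_bdiff phi c h j : test_function phi ->
  derive1n j (fun y => c * (phi y - phi (y - h))) =
  (fun y => c * (derive1n j phi y - derive1n j phi (y - h))).
Proof.
move=> tphi; elim: j => [//|j IH]; rewrite derive1nS IH; apply/funext => x.
have d := is_derive_bdiff c h x (fun y => test_function_is_derive j y tphi).
by rewrite derive1E derive_val.
Qed.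

Lemma primitive_sub (Phi phi : R -> R) h x : 0 < h -> continuous phi ->
  (forall x, is_derive x 1 Phi (phi x)) ->
  Phi x - Phi (x - h) = \int[mu]_(s in `]0, h[) phi (x - s).
Proof.
move=> h0 cphi dPhi.
have dF (s : R) : is_derive s 1 (fun s => - Phi (x - s)) (phi (x - s)).
  have d1 : is_derive s 1 (fun s : R => x - s) (-1).
    have := is_derive_add (is_derive_cst x s 1) (is_derive_scale (-1) (is_derive_id s 1)).
    by rewrite add0r mulr1; under eq_fun do rewrite mulN1r.
  have := is_derive_scale (-1) (@is_derive1_comp _ Phi (fun s => x - s) s _ _ (dPhi (x - s)) d1).
  by rewrite mulrN1 mulrN mulN1r opprK; under eq_fun do rewrite mulN1r.
have cF : continuous (fun s => - Phi (x - s)).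
  by move=> s; apply/differentiable_continuous/derivable1_diffP; case: (dF s).
have cphis : continuous (fun s : R => phi (x - s)).
  move=> s; apply: (@continuous_comp _ _ _ (fun s => x - s) phi); last exact: cphi.
  by apply: continuousB; [exact: cst_continuous|exact: id].
have := @continuous_FTC2 R (fun s => phi (x - s)) (fun s => - Phi (x - s)) 0 h h0 _ _ _.
rewrite !subr0 -EFinB opprK addrC => FTC.
rewrite /Rintegral -(@integral_itv_bndoo _ _ _ _ true false); last first.
  by apply/measurable_EFinP; apply: measurable_funTS; exact: continuous_measurable_fun.
rewrite FTC//.
- exact: continuous_subspaceT.
- split=> [s _||]; first by have [] := dF s.
    exact/cvg_at_right_filter/cF.
  exact/cvg_at_left_filter/cF.
- by move=> s _; rewrite derive1E; have d := dF s; rewrite derive_val.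
Qed.

(** The increment is the integral of phi over [x - h, x], which vanishes when x is farther than h
    from the support. *)
Lemma test_function_bdiff_primitive phi Phi h : 0 < h -> test_function phi ->
  (forall x, is_derive x 1 Phi (phi x)) ->
  test_function (fun x => h^-1 * (Phi x - Phi (x - h))).
Proof.
move=> h0 tphi dPhi; have d x := is_derive_bdiff h^-1 h x dPhi.
have dE j : derive1n j.+1 (fun x => h^-1 * (Phi x - Phi (x - h))) =
    (fun y => h^-1 * (derive1n j phi y - derive1n j phi (y - h))).
  rewrite derive1Sn -derive1n_bdiff//; congr derive1n; apply/funext => x.
  by rewrite derive1E; have dx := d x; rewrite derive_val.
have dd j x : derivable (derive1n j (fun x => h^-1 * (Phi x - Phi (x - h)))) x 1.
  case: j => [|j]; first by have [] := d x.
  rewrite dE; have [] // := is_derive_bdiff h^-1 h x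
    (fun y => test_function_is_derive j y tphi).
split=> [j|].
  split=> [i _ x|x]; first exact: dd.
  exact/differentiable_continuous/derivable1_diffP/dd.
have [M M0 phi0] := test_function_support 0 tphi.
exists (M + h) => x xM; rewrite (primitive_sub x h0 (@test_function_continuous phi 0 tphi) dPhi).
rewrite /Rintegral integral0_eq ?mulr0// => s /=; rewrite in_itv/= => /andP[s0 sh].
congr (_%:E); apply: phi0.
have := ler_normB x s; rewrite -(lerD2r (- `|s|)) addrK.
have := ler_dist_dist x s; have := ler_norm (`|x| - `|s|).
by rewrite (gtr0_norm s0); lra.
Qed.

End TestFunctions.

(** * Difference quotients as averages of the weak derivative *)

Section DifferenceQuotient.
Context {R : realType}.
Local Notation mu := (@lebesgue_measure R).
Implicit Types (f g phi : R -> R) (h x : R).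

Definition dquot h f x := h^-1 * (f (x + h) - f x).

Definition avg h g x := h^-1 * \int[mu]_(s in `]0, h[) g (x + s).

Lemma L2_dquot h f : L2 f -> L2 (dquot h f).
Proof. by move=> f2; apply: L2Z; apply: L2B => //; exact: L2_shift. Qed.

Lemma l2ip_indic_itv h : 0 < h ->
  l2ip (\1_(`]0, h[%classic) : R -> R) \1_(`]0, h[%classic) = h.
Proof.
move=> h0; rewrite /l2ip -(Rintegral_indic `]0, h[%classic \1_(`]0, h[%classic)).
rewrite /Rintegral (eq_integral (cst 1%E)); last first.
  by move=> x xh; rewrite indicE xh.
rewrite integral_cst; last exact: measurable_itv.
rewrite mul1e (_ : lebesgue_measure_lebesgue_measure__canonical__measure_function_Measure R _ = mu `]0, h[%classic)//.
by rewrite lebesgue_measure_itv/= lte_fin h0 -EFinB/= subr0.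
Qed.

(** Jensen's inequality, as Cauchy-Schwarz against the indicator of ]0, h[, whose squared norm is
    h. *)
Lemma avg_sqr_le h g x : L2 g -> 0 < h ->
  avg h g x ^+ 2 <= h^-1 * \int[mu]_(s in `]0, h[) (g (x + s) ^+ 2).
Proof.
move=> g2 h0; have gx2 : L2 (fun s => g (x + s)).
  by have := L2_shift x g2; congr L2; apply/funext => s; rewrite addrC.
have i2 := L2_indic 0 h.
have gi2 : L2 (fun s => g (x + s) * \1_(`]0, h[%classic) s).
  have := @L2_mul_bounded _ 1 \1_(`]0, h[%classic) _ (L2_measurable i2) _ gx2.
  under [X in _ -> L2 X]eq_fun do rewrite mulrC; apply => s.
  by rewrite indicE; case: (_ \in _); rewrite ?normr1 ?normr0 ?ler01.
have := l2ip_cauchy gi2 i2; rewrite l2ip_indic_itv//.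
have -> : l2ip (fun s => g (x + s) * \1_(`]0, h[%classic) s) \1_(`]0, h[%classic) =
    \int[mu]_(s in `]0, h[) g (x + s).
  rewrite Rintegral_indic; apply: eq_Rintegral => s _; rewrite indicE.
  by case: (_ \in _); rewrite ?mulr1 ?mulr0.
have -> : l2ip (fun s => g (x + s) * \1_(`]0, h[%classic) s)
    (fun s => g (x + s) * \1_(`]0, h[%classic) s) =
    \int[mu]_(s in `]0, h[) (g (x + s) ^+ 2).
  rewrite Rintegral_indic; apply: eq_Rintegral => s _; rewrite indicE expr2.
  by case: (_ \in _); rewrite ?mulr1 ?mulr0.
move=> H; rewrite /avg exprMn expr2 -mulrA ler_pM2l ?invr_gt0//.
by rewrite ler_pdivrMl// mulrC.
Qed.

Lemma measurable_avg h g : L2 g -> measurable_fun setT (avg h g).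
Proof.
move=> g2; apply: measurable_funM => //.
have -> : (fun x => \int[mu]_(s in `]0, h[) g (x + s)) =
    fun x => fine (\int[mu]_s (g (x + s) * \1_(`]0, h[%classic) s)%:E)%E.
  by apply/funext => x; rewrite Rintegral_indic.
apply: (measurableT_comp (fine_measurable measurableT)).
apply: (@measurable_section_integral _ (fun z => g (z.1 + z.2) * \1_(`]0, h[%classic) z.2)).
apply: measurable_funM.
  have := measurableT_comp (L2_measurable g2) (measurable_add_mul 1).
  by congr measurable_fun; apply/funext => z /=; rewrite mul1r.
exact: (measurableT_comp (measurable_indic (measurable_itv _)) measurable_snd).
Qed.

(** Integrate [avg_sqr_le], exchange the integrals by Tonelli and use translation invariance: the
    length h cancels the factor 1/h. *)
Lemma L2_avg h g : L2 g -> 0 < h ->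
  L2 (avg h g) /\ l2ip (avg h g) (avg h g) <= l2ip g g.
Proof.
move=> g2 h0; have mg := L2_measurable g2.
have mG : measurable_fun setT (fun z : R * R => g (z.1 + z.2) ^+ 2 * \1_(`]0, h[%classic) z.2).
  apply: measurable_funM; last first.
    exact: (measurableT_comp (measurable_indic (measurable_itv _)) measurable_snd).
  apply: measurable_funX; have := measurableT_comp mg (measurable_add_mul 1).
  by congr measurable_fun; apply/funext => z /=; rewrite mul1r.
have key : (\int[mu]_x (avg h g x ^+ 2)%:E <= (l2ip g g)%:E)%E.
  apply: (@le_trans _ _ (\int[mu]_x (h^-1%:E * \int[mu]_s
      (g (x + s) ^+ 2 * \1_(`]0, h[%classic) s)%:E))%E).
    apply: ge0_le_integral => //.
    - by move=> x _; rewrite lee_fin sqr_ge0.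
    - apply/measurable_EFinP; apply: measurable_funX; exact: measurable_avg.
    - apply: emeasurable_funM => //; exact: (measurable_section_integral mG).
    move=> x _; have := avg_sqr_le x g2 h0; rewrite -lee_fin => /le_trans; apply.
    rewrite EFinM Rintegral_indic /Rintegral fineK//.
    have gx2 : L2 (fun s => g (x + s)).
      by have := L2_shift x g2; congr L2; apply/funext => s; rewrite addrC.
    apply: integrable_fin_num => //.
    have := (L2P _).1 gx2 => -[_]; apply: le_integrable => //.
      apply/measurable_EFinP/measurable_funM; last exact: measurable_indic (measurable_itv _).
      apply: measurable_funX; exact: (L2_measurable gx2).
    move=> s _; rewrite /= lee_fin normrM ler_piMr// indicE.
    by case: (_ \in _); rewrite ?normr1 ?normr0 ?ler01.
  rewrite ge0_integralZl//; first last.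
  - by rewrite lee_fin invr_ge0 ltW.
  - by move=> x _; apply: integral_ge0 => s _; rewrite lee_fin mulr_ge0 ?sqr_ge0.
  - exact: (measurable_section_integral mG).
  rewrite (@fubini_tonelli _ _ _ _ R mu mu (fun z => (g (z.1 + z.2) ^+ 2 * \1_(`]0, h[%classic) z.2)%:E)); first last.
  - by move=> z; rewrite lee_fin mulr_ge0 ?sqr_ge0.
  - exact/measurable_EFinP.
  have -> : (\int[mu]_s \int[mu]_x (g (x + s) ^+ 2 * \1_(`]0, h[%classic) s)%:E =
      \int[mu]_s (l2ip g g * \1_(`]0, h[%classic) s)%:E)%E.
    apply: eq_integral => s _; under eq_integral do rewrite mulrC EFinM.
    rewrite ge0_integralZl//; first last.
    - by move=> x _; rewrite lee_fin sqr_ge0.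
    - apply/measurable_EFinP; apply: measurable_funX; exact: measurable_fun_shift.
    rewrite (ge0_integral_shift s (f := fun x => (g x ^+ 2)%:E)).
    - under eq_integral do rewrite expr2.
      by rewrite (l2ipE g2 g2) -EFinM mulrC.
    - exact/measurable_EFinP/measurable_funX.
    - by move=> x; rewrite lee_fin sqr_ge0.
  rewrite -integral_indic_mul integral_cst; last exact: measurable_itv.
  rewrite (_ : lebesgue_measure_lebesgue_measure__canonical__measure_function_Measure R _ = mu `]0, h[%classic)//.
  rewrite lebesgue_measure_itv/= lte_fin h0 -EFinB -!EFinM subr0 lee_fin.
  by rewrite mulrCA mulVf ?mulr1// gt_eqF.
have a2 : L2 (avg h g).
  apply/L2P; split; first exact: measurable_avg.
  apply/integrableP; split.
    by apply/measurable_EFinP; apply: measurable_funX; exact: measurable_avg.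
  apply: le_lt_trans (ltry (l2ip g g)); apply: le_trans key.
  by under eq_integral do rewrite /= ger0_norm ?sqr_ge0//.
by split=> //; rewrite -lee_fin -l2ipE//; under eq_integral do rewrite -expr2.
Qed.

Lemma l2ip_ae f f' g : L2 f -> L2 f' -> L2 g -> {ae mu, forall x, f x = f' x} ->
  l2ip f g = l2ip f' g.
Proof.
move=> f2 f2' g2 ff'; rewrite /l2ip /Rintegral; congr fine; apply: ae_eq_integral => //.
- by have /integrableP[] := L2_mul_integrable f2 g2.
- by have /integrableP[] := L2_mul_integrable f2' g2.
- move: ff'; apply: filterS; first exact: (ae_filter_ringOfSetsType mu).
  by move=> x -> _.
Qed.

Lemma l2ip_shift f g h : L2 f -> L2 g ->
  l2ip (fun x => f (x + h)) g = l2ip f (fun x => g (x - h)).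
Proof.
move=> f2 g2; rewrite /l2ip.
rewrite -(Rintegral_shift h (f := fun x => f x * g (x - h))).
  by apply: eq_Rintegral => x _; rewrite addrK.
apply: measurable_funM; first exact: L2_measurable.
exact: (measurable_fun_shift (- h) (L2_measurable g2)).
Qed.

Lemma l2ipZB (c : R) f g z : L2 f -> L2 g -> L2 z ->
  l2ip (fun x => c * (f x - g x)) z = c * (l2ip f z - l2ip g z).
Proof.
move=> f2 g2 z2; have := ipZl l2inner c (toL2 f2 - toL2 g2) (toL2 z2).
by rewrite ipDl ipNl.
Qed.

(* Tests the weak derivative against an average of [phi] over translates. *)
Lemma l2ip_dquot_test h f g phi : L2 f -> L2 g -> is_weak_derivative 1 f g ->
  0 < h -> test_function phi -> l2ip (dquot h f) phi = l2ip (avg h g) phi.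
Proof.
move=> f2 g2 [_ _ fg] h0 tphi.
have [Phi dPhi] := test_function_primitive tphi.
have phi2 : L2 phi := test_function_L2 0 tphi.
pose psi x := h^-1 * (Phi x - Phi (x - h)).
have tpsi : test_function psi by exact: test_function_bdiff_primitive.
have psi1 : derive1n 1 psi = fun x => h^-1 * (phi x - phi (x - h)).
  by apply/funext => x; rewrite derive1n1 derive1E; have d := is_derive_bdiff h^-1 h x dPhi; rewrite derive_val.
have phih2 : L2 (fun x => phi (x - h)) by exact: L2_shift.
have E1 : l2ip (dquot h f) phi = - l2ip f (derive1n 1 psi).
  rewrite psi1 (l2ipC f) /dquot (l2ipZB _ (L2_shift h f2))// (l2ipZB _ phi2)//.
  by rewrite l2ip_shift// (l2ipC f phi) (l2ipC f (fun x => phi (x - h))); ring.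
rewrite E1 /l2ip fg// expr1 mulN1r opprK.
have hn : h != 0 by rewrite gt_eqF.
have cphi x : continuous (fun s : R => phi (x + (-1) * s)).
  move=> s; apply: (@continuous_comp _ _ _ (fun s : R => x + (-1) * s) phi).
    by apply: continuousD; [exact: cst_continuous|apply: continuousM; [exact: cst_continuous|exact: id]].
  exact: (@test_function_continuous _ phi 0 tphi).
have iphi x : mu.-integrable `]0, h[ (EFin \o (fun s => phi (x + (-1) * s))).
  apply: (@integrableS _ _ _ mu `[0, h]%classic) => //; first exact: subset_itv_oo_cc.
  apply: continuous_compact_integrable; first exact: segment_compact.
  by apply: continuous_subspaceT; exact: cphi.
have ig x : mu.-integrable `]0, h[ (EFin \o (fun s => g (x + 1 * s))).
  apply: (@integrableS _ _ _ mu `[0, h]%classic) => //; first exact: subset_itv_oo_cc.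
  apply: locally_integrable_itv; apply: L2_locally_integrable.
  by have := L2_shift x g2; congr L2; apply/funext => s; rewrite mul1r addrC.
apply: (mulfI hn); rewrite -!RintegralZl//; first last.
- exact: (L2_mul_integrable g2 (test_function_L2 0 tpsi)).
- exact: (L2_mul_integrable (L2_avg g2 h0).1 phi2).
transitivity (\int[mu]_x (\int[mu]_(s in `]0, h[) (phi (x + (-1) * s) * g x))).
  apply: eq_Rintegral => x _; rewrite /psi mulrCA mulVKf//.
  rewrite (primitive_sub x h0 (@test_function_continuous _ phi 0 tphi) dPhi).
  rewrite RintegralZr// mulrC; congr (_ * _).
  by apply: eq_Rintegral => s _; rewrite mulN1r.
transitivity (\int[mu]_x (\int[mu]_(s in `]0, h[) (g (x + 1 * s) * phi x))); last first.
  apply: eq_Rintegral => x _; rewrite /avg mulrA mulVKf// RintegralZr//; congr (_ * _).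
  by apply: eq_Rintegral => s _; rewrite mul1r.
rewrite (fubini_translates (-1) h phi2 g2) (fubini_translates 1 h g2 phi2).
apply: eq_Rintegral => s _.
rewrite mul1r mulN1r; have := l2ip_shift s g2 phi2; rewrite /l2ip => ->.
by apply: eq_Rintegral => x _; rewrite mulrC.
Qed.

(** This stands in for the fundamental theorem of calculus for f, which is only a weak primitive of
    g. *)
Lemma dquot_avg h f g : L2 f -> L2 g -> is_weak_derivative 1 f g -> 0 < h ->
  {ae mu, forall x, dquot h f x = avg h g x}.
Proof.
move=> f2 g2 fg h0; have d2 := L2_dquot h f2; have [a2 _] := L2_avg g2 h0.
have : {ae mu, forall x, dquot h f x - avg h g x = 0}.
  apply: du_bois_reymond; first exact/L2_locally_integrable/L2B.
  move=> phi tphi; have phi2 : L2 phi := test_function_L2 0 tphi.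
  have := l2ipZB 1 d2 a2 phi2; rewrite (l2ip_dquot_test f2 g2 fg h0 tphi) subrr mulr0.
  by under [X in X = _ -> _]eq_Rintegral do rewrite mul1r.
by apply: filterS; [exact: (ae_filter_ringOfSetsType mu)|move=> x /eqP; rewrite subr_eq0 => /eqP].
Qed.

Lemma dquot_le h f g : L2 f -> L2 g -> is_weak_derivative 1 f g -> 0 < h ->
  l2ip (dquot h f) (dquot h f) <= l2ip g g.
Proof.
move=> f2 g2 fg h0; have d2 := L2_dquot h f2; have [a2] := L2_avg g2 h0.
have da := dquot_avg f2 g2 fg h0.
by apply: le_trans; rewrite (l2ip_ae d2 a2 d2 da) l2ipC (l2ip_ae d2 a2 a2 da).
Qed.

Lemma avgE h g x : L2 g -> avg h g x = h^-1 * \int[mu]_(y in `]x, x + h[) g y.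
Proof.
move=> g2; rewrite /avg (Rintegral_indic `]0, h[%classic) (Rintegral_indic `]x, x + h[%classic).
rewrite -[X in _ = _ * X](Rintegral_shift x (f := fun y => g y * \1_(`]x, x + h[%classic) y)).
  congr (_ * _); apply: eq_Rintegral => s _; rewrite addrC !indicE; congr (_ * (_ : bool)%:R).
  by apply/idP/idP; rewrite !inE/= !in_itv/= ltrDr (addrC s) ltrD2l.
apply: measurable_funM; [exact: L2_measurable|exact: measurable_indic (measurable_itv _)].
Qed.

Lemma avg_cvg g : L2 g ->
  {ae mu, forall x, (fun n => avg n.+1%:R^-1 g x) @ \oo --> g x}.
Proof.
move=> g2; have lg := L2_locally_integrable g2.
have := lebesgue_differentiation lg; apply: filterS; first exact: (ae_filter_ringOfSetsType mu).
move=> x gx; pose I n := `]x, x + n.+1%:R^-1[%classic.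
rewrite [X in X @ _ --> _](_ : _ = fine \o (fun n =>
    (mu (I n))^-1 * \int[mu]_(y in I n) (g y)%:E)%E).
  by apply: fine_cvg; exact: nice_lebesgue_differentiation nicely_shrinking_right _ lg _ gx.
apply/funext => n; rewrite /I /=.
have r0 : 0 < (n.+1%:R^-1 : R) by rewrite invr_gt0.
rewrite avgE// lebesgue_measure_itv/= lte_fin ltrDl r0 -EFinD addrAC subrr add0r.
rewrite inver gt_eqF// /Rintegral.
have fin : (\int[mu]_(y in I n) (g y)%:E)%E \is a fin_num.
  apply: integrable_fin_num; first exact: measurable_itv.
  apply: (@integrableS _ _ _ mu `[x, x + n.+1%:R^-1]%classic) => //.
  - exact: measurable_itv.
  - exact: subset_itv_oo_cc.
  - exact: locally_integrable_itv.
by move: fin; rewrite /I => fin; rewrite -[in RHS](fineK fin).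
Qed.

Lemma limn_einf_squeeze (b : nat -> R) (L : R) : (forall n, b n <= L) ->
  (L%:E <= limn_einf (EFin \o b))%E -> b @ \oo --> L.
Proof.
move=> bL; rewrite limn_einf_lim => Lb; apply/cvgrPdist_le => e e0.
have E : limn (einfs (EFin \o b)) = ereal_sup (range (einfs (EFin \o b))).
  by apply/cvg_lim; [exact: ereal_hausdorff|exact: cvg_einfs_sup].
have : (L%:E - e%:E < ereal_sup (range (einfs (EFin \o b))))%E.
  by rewrite -E; apply: lt_le_trans Lb; rewrite -EFinB lte_fin ltrBlDr ltrDl.
move=> /ereal_sup_gt[_ [N _ <-]] LN; near=> n.
rewrite ger0_norm ?subr_ge0// lerBlDr -lerBlDl; apply: ltW.
rewrite -lte_fin; apply: (lt_le_trans LN); apply: ereal_inf_lbound.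
by exists n => //=; near: n; exact: nbhs_infty_ge.
Unshelve. all: by end_near. Qed.

(** Averages converge almost everywhere and do not increase the norm. By Fatou the lower limit of
    |avg + g|^2 is at least 4 |g|^2, while the parallelogram identity bounds it by 4 |g|^2; so it
    converges, and the same identity sends |avg - g|^2 to 0. *)
Lemma avg_strong_cvg g : L2 g ->
  (fun n => l2ip (fun x => avg n.+1%:R^-1 g x - g x) (fun x => avg n.+1%:R^-1 g x - g x))
    @ \oo --> (0 : R).
Proof.
move=> g2; pose k n := avg n.+1%:R^-1 g.
have r0 n : 0 < (n.+1%:R^-1 : R) by rewrite invr_gt0.
have k2 n : L2 (k n) := (L2_avg g2 (r0 n)).1.
have kle n : l2ip (k n) (k n) <= l2ip g g := (L2_avg g2 (r0 n)).2.
pose b n := l2ip (fun x => k n x + g x) (fun x => k n x + g x).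
have par n : l2ip (fun x => k n x - g x) (fun x => k n x - g x) =
    2 * l2ip (k n) (k n) + 2 * l2ip g g - b n.
  pose K := toL2 (k2 n); pose G := toL2 g2.
  have -> : b n = l2inner (K + G) (K + G) by [].
  have -> : l2ip (fun x => k n x - g x) (fun x => k n x - g x) = l2inner (K - G) (K - G) by [].
  have -> : l2ip (k n) (k n) = l2inner K K by [].
  have -> : l2ip g g = l2inner G G by [].
  by rewrite !ipE; ring.
have bL n : b n <= 4 * l2ip g g.
  have := kle n; have := l2ip_ge0 (fun x => k n x - g x); rewrite par; lra.
suff bc : b @ \oo --> 4 * l2ip g g.
  apply: (@cvg0_squeeze _ _ _ _ _ (fun n => 4 * l2ip g g - b n)).
    by move=> n; rewrite ger0_norm ?l2ip_ge0// par; have := kle n; lra.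
  by rewrite -(subrr (4 * l2ip g g)); apply: cvgB => //; exact: cvg_cst.
apply: limn_einf_squeeze => //.
have s2 n : L2 (fun x => k n x + g x) := L2D (k2 n) g2.
have -> : (EFin \o b) = (fun n => \int[mu]_x ((k n x + g x) * (k n x + g x))%:E)%E.
  by apply/funext => n; rewrite /= (l2ipE (s2 n) (s2 n)).
have mu2 n : measurable_fun setT (fun x => ((k n x + g x) * (k n x + g x))%:E).
  by apply/measurable_EFinP; apply: measurable_funM; exact: L2_measurable.
apply: le_trans (fatou mu measurableT mu2 _); last first.
  by move=> n x _; rewrite lee_fin -expr2 sqr_ge0.
have -> : ((4 * l2ip g g)%:E = \int[mu]_x ((2 * g x) * (2 * g x))%:E)%E.
  rewrite (l2ipE (L2Z 2 g2) (L2Z 2 g2)); congr (_%:E).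
  have := ipZl l2inner 2 (toL2 g2) (toL2 (L2Z 2 g2)).
  have := ipZr l2inner 2 (toL2 g2) (toL2 g2).
  rewrite /= => h1 h2; transitivity (2 * (2 * l2ip g g)); first ring.
  by rewrite -h1 -h2.
rewrite le_eqVlt; apply/orP; left; apply/eqP; apply: ae_eq_integral => //.
- by apply/measurable_EFinP; apply: measurable_funM; exact: (L2_measurable (L2Z 2 g2)).
- under eq_fun do rewrite /limn_einf; apply: measurableT_comp => //.
  apply: measurable_fun_limn_esup => n; exact: measurableT_comp (mu2 n).
- have := avg_cvg g2; apply: filterS; first exact: (ae_filter_ringOfSetsType mu).
  move=> x kx _; apply/esym.
  have : (fun n => ((k n x + g x) * (k n x + g x))%:E) @ \oo --> ((g x + g x) * (g x + g x))%:E.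
    apply/fine_cvgP; split; first exact: nearW.
    by apply: cvgM; apply: cvgD => //; exact: cvg_cst.
  by move=> /cvg_limn_einf_sup[-> _]; congr (_%:E); ring.
Qed.

Lemma dquot_strong_cvg f g : L2 f -> L2 g -> is_weak_derivative 1 f g ->
  (fun n => l2ip (fun x => dquot n.+1%:R^-1 f x - g x) (fun x => dquot n.+1%:R^-1 f x - g x))
    @ \oo --> (0 : R).
Proof.
move=> f2 g2 fg; rewrite [X in X @ _ --> _](_ : _ =
    fun n => l2ip (fun x => avg n.+1%:R^-1 g x - g x) (fun x => avg n.+1%:R^-1 g x - g x)).
  exact: avg_strong_cvg.
apply/funext => n; apply/esym.
have r0 : 0 < (n.+1%:R^-1 : R) by rewrite invr_gt0.
have d2 := L2_dquot n.+1%:R^-1 f2; have a2 := (L2_avg g2 r0).1.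
have ae : {ae mu, forall x, avg n.+1%:R^-1 g x - g x = dquot n.+1%:R^-1 f x - g x}.
  have := dquot_avg f2 g2 fg r0; apply: filterS; first exact: (ae_filter_ringOfSetsType mu).
  by move=> x ->.
rewrite (l2ip_ae _ _ _ ae); [|exact: L2B..].
by rewrite l2ipC (l2ip_ae _ _ _ ae) //; exact: L2B.
Qed.

End DifferenceQuotient.

(** * Calculus of weak derivatives up to null sets *)

Section WeakDerivative.
Context {R : realType}.
Local Notation mu := (@lebesgue_measure R).
Implicit Types (f g phi : R -> R) (k : nat).

Lemma locally_integrable_test g phi : locally_integrable setT g -> test_function phi ->
  mu.-integrable setT (EFin \o (fun x => g x * phi x)).
Proof.
move=> lg tphi; have [M [phiM phi0]] := test_function_bounded 0 tphi.
have [mg _ _] := lg.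
have M0 : 0 <= M := le_trans (normr_ge0 _) (phiM 0).
have ig : mu.-integrable setT (EFin \o (fun x => M * (g x * \1_(`[- M, M]%classic) x))).
  have := locally_integrable_itv (- M) M lg.
  rewrite integrable_mkcond; last exact: measurable_itv.
  move=> /(@integrableZl _ _ _ mu setT measurableT M).
  apply: eq_integrable => // x _; rewrite /= patchE indicE.
  by case: ifP => _; rewrite ?mulr1// !mulr0 (_ : point = 0%E)// mule0.
apply: le_integrable ig => //.
  apply/measurable_EFinP; apply: measurable_funM => //; apply: continuous_measurable_fun.
  exact: (@test_function_continuous _ phi 0 tphi).
move=> x _; rewrite /= lee_fin !normrM (ger0_norm M0) mulrCA ler_wpM2l// indicE.
have [xM|xM] := boolP (x \in _); first by rewrite normr1 mulr1; exact: phiM.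
rewrite normr0 mulr0 (_ : phi x = 0) ?normr0//; apply: phi0.
by rewrite ltNge; apply: contra xM => xM; rewrite inE/= in_itv/= -ler_norml.
Qed.

Lemma Rintegral_ae f g : measurable_fun setT f -> measurable_fun setT g ->
  {ae mu, forall x, f x = g x} -> \int[mu]_x f x = \int[mu]_x g x.
Proof.
move=> mf mg fg; rewrite /Rintegral; congr fine; apply: ae_eq_integral => //.
- exact/measurable_EFinP.
- exact/measurable_EFinP.
- by move: fg; apply: filterS; [exact: (ae_filter_ringOfSetsType mu)|move=> x -> _].
Qed.

Lemma L2_ae f g : measurable_fun setT g -> {ae mu, forall x, f x = g x} -> L2 f -> L2 g.
Proof.
move=> mg fg /L2P[mf /integrableP[_ f2]]; apply/L2P; split => //.
have mg2 : measurable_fun setT (EFin \o (fun x => g x ^+ 2)).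
  by apply/measurable_EFinP; exact: measurable_funX.
have mf2 : measurable_fun setT (EFin \o (fun x => f x ^+ 2)).
  by apply/measurable_EFinP; exact: measurable_funX.
apply/integrableP; split => //; apply: le_lt_trans f2.
rewrite le_eqVlt; apply/orP; left; apply/eqP; apply: ae_eq_integral => //.
- exact: measurableT_comp.
- exact: measurableT_comp.
- by move: fg; apply: filterS; [exact: (ae_filter_ringOfSetsType mu)|move=> x /= -> _].
Qed.

Lemma aeW (P : R -> Prop) : (forall x, P x) -> {ae mu, forall x, P x}.
Proof. by move=> PW; apply: nearW. Qed.

Lemma aeS (P Q : R -> Prop) : (forall x, P x -> Q x) ->
  {ae mu, forall x, P x} -> {ae mu, forall x, Q x}.
Proof. by move=> PQ; apply: filterS => //; exact: (ae_filter_ringOfSetsType mu). Qed.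

Lemma aeS2 (P Q S : R -> Prop) : (forall x, P x -> Q x -> S x) ->
  {ae mu, forall x, P x} -> {ae mu, forall x, Q x} -> {ae mu, forall x, S x}.
Proof. by move=> PQ; apply: filterS2 => //; exact: (ae_filter_ringOfSetsType mu). Qed.

Lemma weak_derivative_unique k f g g' :
  is_weak_derivative k f g -> is_weak_derivative k f g' -> {ae mu, forall x, g x = g' x}.
Proof.
move=> [_ lg fg] [_ lg' fg'].
have : {ae mu, forall x, g x - g' x = 0}.
  apply: du_bois_reymond; first exact: locally_integrableB.
  move=> phi tphi; have i1 := locally_integrable_test lg tphi.
  have i2 := locally_integrable_test lg' tphi.
  under eq_Rintegral do rewrite mulrBl.
  rewrite RintegralB//; apply/eqP; rewrite subr_eq0; apply/eqP.
  apply: (@mulfI _ ((-1) ^+ k)); first by rewrite signr_eq0.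
  by rewrite -fg// -fg'.
by apply: aeS => x /eqP; rewrite subr_eq0 => /eqP.
Qed.

Lemma is_weak_derivative_ae k f f' g : locally_integrable setT f' ->
  {ae mu, forall x, f x = f' x} -> is_weak_derivative k f g -> is_weak_derivative k f' g.
Proof.
move=> lf' ff' [lf lg fg]; split => // phi tphi; rewrite -fg//.
have mphi := continuous_measurable_fun (@test_function_continuous _ phi k tphi).
apply: Rintegral_ae; [apply: measurable_funM => //; by case: lf'|apply: measurable_funM => //; by case: lf|].
by apply: aeS ff' => x ->.
Qed.

Lemma is_weak_derivative0 f : locally_integrable setT f -> is_weak_derivative 0 f f.
Proof. by move=> lf; split => // phi _; rewrite expr0 mul1r. Qed.

Lemma is_weak_derivative_lin k (a : R) f f' g g' : L2 f -> L2 f' -> L2 g -> L2 g' ->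
  is_weak_derivative k f f' -> is_weak_derivative k g g' ->
  is_weak_derivative k (fun x => a * f x + g x) (fun x => a * f' x + g' x).
Proof.
move=> f2 f2' g2 g2' [_ _ ff'] [_ _ gg']; split.
- exact/L2_locally_integrable/L2_lin.
- exact/L2_locally_integrable/L2_lin.
move=> phi tphi; have pk2 := test_function_L2 k tphi.
have p2 : L2 phi := test_function_L2 0 tphi.
have := l2ip_linear a f2 g2 pk2; rewrite /l2ip => ->.
have := l2ip_linear a f2' g2' p2; rewrite /l2ip => ->.
by rewrite ff'// gg'//; ring.
Qed.

Lemma is_weak_derivativeS k f g g' : is_weak_derivative k f g ->
  is_weak_derivative k.+1 f g' -> is_weak_derivative 1 g g'.
Proof.
move=> [_ lg fg] [_ lg' fg']; split => // phi tphi.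
apply: (@mulfI _ ((-1) ^+ k)); first by rewrite signr_eq0.
rewrite -fg; last exact: test_function_derive1n.
by rewrite derive1nD addn1 fg'// exprSr mulrA.
Qed.

Lemma wD_is_weak_derivative l k f : Sobolev l f -> (k <= l)%N ->
  is_weak_derivative k f (wD k f).
Proof.
move=> [_ fl] kl; have [g fg _] := fl k kl.
by rewrite /wD; apply: xgetPex; exists g.
Qed.

Lemma L2_wD l k f : Sobolev l f -> (k <= l)%N -> L2 (wD k f).
Proof.
move=> sf kl; have w := wD_is_weak_derivative sf kl; have [_ fl] := sf.
have [g fg g2] := fl k kl; apply: L2_ae (weak_derivative_unique fg w) g2.
by case: w => _ [].
Qed.

Lemma wD0_ae l f : Sobolev l f -> {ae mu, forall x, wD 0 f x = f x}.
Proof.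
move=> sf; apply: weak_derivative_unique (wD_is_weak_derivative sf (leq0n _)) _.
by apply/is_weak_derivative0/L2_locally_integrable; case: sf.
Qed.

Lemma wD_ae l k f f' : Sobolev l f -> L2 f' -> (k <= l)%N ->
  {ae mu, forall x, f x = f' x} -> Sobolev l f' -> {ae mu, forall x, wD k f x = wD k f' x}.
Proof.
move=> sf f2' kl ff' sf'; apply: (@weak_derivative_unique k f'); last exact: wD_is_weak_derivative sf' kl.
apply: is_weak_derivative_ae ff' (wD_is_weak_derivative sf kl).
exact: L2_locally_integrable.
Qed.

(** Only almost everywhere: [wD] chooses a representative for each function separately. *)
Lemma wD_lin l k (a : R) f g : Sobolev l f -> Sobolev l g -> (k <= l)%N ->
  {ae mu, forall x, wD k (fun x => a * f x + g x) x = a * wD k f x + wD k g x}.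
Proof.
move=> sf sg kl.
have w : is_weak_derivative k (fun x => a * f x + g x) (fun x => a * wD k f x + wD k g x).
  apply: is_weak_derivative_lin; [by case: sf|exact: L2_wD sf kl|by case: sg|exact: L2_wD sg kl
    |exact: wD_is_weak_derivative sf kl|exact: wD_is_weak_derivative sg kl].
by apply: (weak_derivative_unique _ w); rewrite /wD; apply: xgetPex; eexists; exact: w.
Qed.

Lemma Sobolev_lin l (a : R) f g : Sobolev l f -> Sobolev l g ->
  Sobolev l (fun x => a * f x + g x).
Proof.
move=> sf sg; split; first by apply: L2_lin; [case: sf|case: sg].
move=> k kl; exists (fun x => a * wD k f x + wD k g x).
  apply: is_weak_derivative_lin; [by case: sf|exact: L2_wD sf kl|by case: sg|exact: L2_wD sg kl
    |exact: wD_is_weak_derivative sf kl|exact: wD_is_weak_derivative sg kl].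
by apply: L2_lin; [exact: L2_wD sf kl|exact: L2_wD sg kl].
Qed.

Lemma L2norm_wD_le l k f : (k <= l)%N -> L2norm (wD k f) ^+ 2 <= Sobolev_norm l f ^+ 2.
Proof.
move=> kl; rewrite sqr_sqrtr; last by apply: sumr_ge0 => i _; exact: sqr_ge0.
rewrite (bigD1 (Ordinal (kl : (k < l.+1)%N)))//= lerDl.
by apply: sumr_ge0 => i _; exact: sqr_ge0.
Qed.

End WeakDerivative.

(** * Translations, difference quotients and multiplications as operators *)

Section Operators.
Context {R : realType}.
Local Notation mu := (@lebesgue_measure R).
Local Notation H := (L2space (R := R)).
Local Notation ip := (l2inner (R := R)).
Implicit Types (f g : H) (h : R) (b : R -> R).

Definition Hshift h f : H := toL2 (L2_shift h (L2_L2space f)).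

Definition Hdquot h f : H := h^-1 *: (Hshift h f - f).

Definition bounded_by (M : R) b := measurable_fun setT b /\ (forall x, `|b x| <= M).

Definition Hmul M b (bM : bounded_by M b) f : H :=
  toL2 (L2_mul_bounded bM.1 bM.2 (L2_L2space f)).

Lemma L2spaceP f g : (forall x, f x = g x) -> f = g.
Proof. by move=> fg; apply/LfuneqP. Qed.

Lemma l2inner_dominated (C : R) f g : (forall x, `|f x| <= C * `|g x|) ->
  ip f f <= C ^+ 2 * ip g g.
Proof.
move=> fg; have -> : C ^+ 2 * ip g g = ip (C *: g) (C *: g) by rewrite !ipE; ring.
apply: le_Rintegral => //.
- exact: (L2_mul_integrable (L2_L2space f) (L2_L2space f)).
- exact: (L2_mul_integrable (L2_L2space (C *: g)) (L2_L2space (C *: g))).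
move=> x _; rewrite -!expr2 -[X in X <= _]real_normK ?num_real//.
rewrite -[X in _ <= X]real_normK ?num_real// lerXn2r ?nnegrE//.
apply: (le_trans (fg x)); rewrite [X in _ <= X]normrM ler_wpM2r//; exact: ler_norm.
Qed.

Lemma Hshift_linear h a f g : Hshift h (a *: f + g) = a *: Hshift h f + Hshift h g.
Proof. exact: L2spaceP. Qed.

Lemma ip_Hshift h f g : ip (Hshift h f) (Hshift h g) = ip f g.
Proof.
apply: (Rintegral_shift h (f := fun x => f x * g x)).
by apply: measurable_funM; apply: L2_measurable; exact: L2_L2space.
Qed.


Lemma bounded_linear_Hdquot h : bounded_linear ip (Hdquot h).
Proof.
split=> [a f g|].
  rewrite /Hdquot Hshift_linear opprD addrACA -scalerBr scalerDr !scalerA mulrC.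
  by rewrite scalerDr.
exists (h^-1 ^+ 2 * 4) => f.
have -> : ip (Hdquot h f) (Hdquot h f) = h^-1 ^+ 2 * ip (Hshift h f - f) (Hshift h f - f).
  by rewrite /Hdquot ipZl ipZr mulrA expr2.
rewrite -[leRHS]mulrA ler_wpM2l ?sqr_ge0//.
have := ip_sqrD_le ip (Hshift h f) (- f); rewrite ip_Hshift ipNl ipNr opprK.
by move/le_trans; apply; lra.
Qed.

Lemma bounded_linear_Hmul M b (bM : bounded_by M b) : bounded_linear ip (Hmul bM).
Proof.
split=> [a f g|].
  apply: L2spaceP => x /=.
  by change (b x * (a * f x + g x) = a * (b x * f x) + b x * g x); ring.
exists (M ^+ 2) => f; apply: l2inner_dominated => x.
by change (`|b x * f x| <= M * `|f x|); rewrite normrM ler_wpM2r//; case: bM.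
Qed.

Lemma Hdquot_comm h k f : Hdquot h (Hdquot k f) = Hdquot k (Hdquot h f).
Proof.
apply: L2spaceP => x.
change (h^-1 * (k^-1 * (f (x + h + k) - f (x + h)) - k^-1 * (f (x + k) - f x)) =
  k^-1 * (h^-1 * (f (x + k + h) - f (x + k)) - h^-1 * (f (x + h) - f x))).
by rewrite addrAC; ring.
Qed.

(* Strong [L2] limit of difference quotients; unlike the weak derivative it
   satisfies skew-symmetry and the product rule by direct computation. *)
Definition Dx f f' := scvg ip (F := \oo) (fun n => Hdquot n.+1%:R^-1 f) f'.

Lemma is_weak_derivative_Dx f f' : is_weak_derivative 1 f f' -> Dx f f'.
Proof.
move=> ff'; exact: (dquot_strong_cvg (L2_L2space f) (L2_L2space f') ff').
Qed.

Lemma Hdquot_le h f f' : 0 < h -> is_weak_derivative 1 f f' ->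
  ip (Hdquot h f) (Hdquot h f) <= ip f' f'.
Proof.
move=> h0 ff'; exact: (dquot_le (L2_L2space f) (L2_L2space f') ff' h0).
Qed.

Lemma Dx_linear a f f' g g' : Dx f f' -> Dx g g' -> Dx (a *: f + g) (a *: f' + g').
Proof.
move=> ff' gg'; rewrite /Dx [X in scvg _ X](_ : _ =
    fun n => a *: Hdquot n.+1%:R^-1 f + Hdquot n.+1%:R^-1 g).
  by apply: scvgD => //; exact: scvgZ.
by apply/funext => n; have [-> _] := bounded_linear_Hdquot n.+1%:R^-1.
Qed.

Lemma Dx_Hdquot h f f' : Dx f f' -> Dx (Hdquot h f) (Hdquot h f').
Proof.
move=> ff'; rewrite /Dx; under eq_fun do rewrite Hdquot_comm.
exact: scvg_bounded (bounded_linear_Hdquot h) ff'.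
Qed.

Lemma Dx_shift f f' : Dx f f' -> scvg ip (F := \oo) (fun n => Hshift n.+1%:R^-1 f) f.
Proof.
move=> ff'; rewrite [X in scvg _ X](_ : _ =
    fun n => n.+1%:R^-1 *: Hdquot n.+1%:R^-1 f + f).
  rewrite -[X in scvg _ _ X]add0r; apply: scvgD; last exact: scvg_cst.
  by apply: scvgZ0 ff'; exact: cvg_harmonic.
by apply/funext => n; rewrite /Hdquot scalerA divff ?scale1r ?subrK// invr_eq0.
Qed.

(** Limit of summation by parts, (d_h f, g) = - (f(. + h), d_h g), which is translation
    invariance. *)
Lemma Dx_skew f f' g g' : Dx f f' -> Dx g g' -> ip f' g = - ip f g'.
Proof.
move=> ff' gg'.
have c1 : ip (Hdquot n.+1%:R^-1 f) g @[n --> \oo] --> ip f' g.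
  by apply: scvg_ip => //; exact: scvg_cst.
have c2 : ip (Hshift n.+1%:R^-1 f) (Hdquot n.+1%:R^-1 g) @[n --> \oo] --> ip f g'.
  by apply: scvg_ip => //; exact: Dx_shift ff'.
have E : (fun n => ip (Hdquot n.+1%:R^-1 f) g) =
    fun n => - ip (Hshift n.+1%:R^-1 f) (Hdquot n.+1%:R^-1 g).
  by apply/funext => n; rewrite /Hdquot !ipE ip_Hshift; ring.
by move: c1; rewrite E => c1; exact: (cvg_unique (@Rhausdorff R) c1 (cvgN c2)).
Qed.

End Operators.

(** * Pointwise bounds from the essential supremum *)

Section Supnorm.
Context {R : realType}.
Local Notation mu := (@lebesgue_measure R).

(** A violation at one point spreads to a ball, which has positive measure. *)
Lemma ae_continuous_le (f : R -> R) M : continuous f ->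
  {ae mu, forall x, `|f x| <= M} -> forall x, `|f x| <= M.
Proof.
move=> cf fM x; rewrite leNgt; apply/negP => Mfx.
have nbx : nbhs x [set y | M < `|f y|].
  have /cvgrPdist_lt/(_ (`|f x| - M)) := cf x.
  rewrite subr_gt0 => /(_ Mfx); apply: filterS => y /=.
  by have := lerB_dist (f x) (f y); lra.
have [e /= e0 xe] := (nbhs_ballP _ _).1 nbx.
have : mu.-negligible (ball x e).
  apply: negligibleS fM => y ye /=; apply/negP; rewrite -ltNge; exact: xe.
rewrite negligibleP; last exact: measurable_ball.
move=> ball0; have : lebesgue_measure (ball x e) = 0%E := ball0.
by rewrite lebesgue_measure_ball ?ltW// => -[] /eqP; rewrite mulrn_eq0/= gt_eqF.
Qed.

(** Boundedness guarantees that the essential supremum is finite, so that [fine] returns it and not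
    0. *)
Lemma le_supnorm (f : R -> R) : continuous f -> (exists M, forall x, `|f x| <= M) ->
  forall x, `|f x| <= supnorm f.
Proof.
move=> cf [M fM]; apply: ae_continuous_le => //.
have muT : (0 < mu [set: R])%E.
  apply: (@lt_le_trans _ _ (mu `[0, 1]%classic)).
    by rewrite lebesgue_measure_itv/= lte_fin ltr01 oppr0 adde0 lte_fin.
  by apply: le_measure => //; rewrite inE.
have E : ('N[mu]_(+oo)[EFin \o f] = ess_sup mu (abse \o (EFin \o f)))%E.
  by rewrite unlock /= muT.
rewrite /supnorm E.
have le1 : (ess_sup mu (abse \o (EFin \o f)) <= M%:E)%E.
  by apply/ess_supP; apply: aeW => x /=; rewrite lee_fin.
have ge0 : (0 <= ess_sup mu (abse \o (EFin \o f)))%E.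
  by apply: ess_sup_gee => //; apply: aeW => x /=; rewrite lee_fin.
have fin : ess_sup mu (abse \o (EFin \o f)) \is a fin_num.
  by rewrite ge0_fin_numE// (le_lt_trans le1) ?ltry.
have := ess_sup_ge mu (abse \o (EFin \o f)); apply: aeS => x.
by rewrite -(fineK fin) /= lee_fin.
Qed.

Lemma supnorm_ge0 (f : R -> R) : 0 <= supnorm f.
Proof. by rewrite fine_ge0// Lnorm_ge0. Qed.

Lemma lipschitz_of_derive (f f' : R -> R) M (x h : R) : (forall y : R, is_derive y 1 f (f' y)) ->
  (forall y, `|f' y| <= M) -> 0 <= h -> `|f (x + h) - f x| <= M * h.
Proof.
move=> df f'M h0; have [||c _ ->] := @MVT_segment R f f' x (x + h).
- by rewrite lerDl.
- apply: continuous_subspaceT => y; apply/differentiable_continuous/derivable1_diffP.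
  by case: (df y).
- by rewrite [x + h]addrC addrK normrM (ger0_norm h0) ler_wpM2r.
Qed.

Lemma taylor1_of_derive (f f' f'' : R -> R) M (x h : R) : (forall y : R, is_derive y 1 f (f' y)) ->
  (forall y : R, is_derive y 1 f' (f'' y)) -> (forall y, `|f'' y| <= M) -> 0 < h ->
  `|h^-1 * (f (x + h) - f x) - f' x| <= M * h.
Proof.
move=> df df' f''M h0; have [||c /[!in_itv]/= /andP[xc ch] ->] := @MVT_segment R f f' x (x + h).
- by rewrite lerDl ltW.
- apply: continuous_subspaceT => y; apply/differentiable_continuous/derivable1_diffP.
  by case: (df y).
rewrite [x + h]addrC addrK mulrCA mulVf ?gt_eqF// mulr1.
have := @lipschitz_of_derive f' f'' M x (c - x) df' f''M.
rewrite subr_ge0 subrKC => /(_ xc) /le_trans; apply.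
by rewrite ler_wpM2l ?lerBlDl// (le_trans (normr_ge0 _) (f''M x)).
Qed.

End Supnorm.

(** * The potential as a multiplication operator *)

Section Potential.
Context {R : realType}.
Local Notation H := (L2space (R := R)).
Local Notation ip := (l2inner (R := R)).
Variables (V V1 V2 : R -> R) (alpha M0 M1 M2 : R).
Hypothesis dV : forall x : R, is_derive x 1 V (V1 x).
Hypothesis dV1 : forall x : R, is_derive x 1 V1 (V2 x).
Hypothesis V_gt0 : forall x, 0 < V x.
Hypothesis V1_le : forall x, `|V1 x| <= alpha * V x.
Hypothesis VM : forall x, `|V x| <= M0.
Hypothesis V1M : forall x, `|V1 x| <= M1.
Hypothesis V2M : forall x, `|V2 x| <= M2.
Hypothesis alpha_gt0 : 0 < alpha.

Let measurable_derivable (f f' : R -> R) : (forall x : R, is_derive x 1 f (f' x)) ->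
  measurable_fun setT f.
Proof.
move=> df; apply: continuous_measurable_fun => x.
by apply/differentiable_continuous/derivable1_diffP; case: (df x).
Qed.

Lemma potential_bounded : bounded_by M0 V.
Proof. by split => //; exact: measurable_derivable dV. Qed.

Lemma dpotential_bounded : bounded_by M1 V1.
Proof. by split => //; exact: measurable_derivable dV1. Qed.

Lemma sqrt_potential_bounded : bounded_by (Num.sqrt M0) (fun x => Num.sqrt (V x)).
Proof.
split=> [|x].
  apply: continuous_measurable_fun => x; apply: continuous_comp; last exact: sqrt_continuous.
  by apply/differentiable_continuous/derivable1_diffP; case: (dV x).
by rewrite ger0_norm ?sqrtr_ge0// ler_wsqrtr// (le_trans (ler_norm _)).
Qed.

Lemma shift_potential_bounded h : bounded_by M0 (fun x => V (x + h)).
Proof. by split => //; apply: measurable_fun_shift; exact: measurable_derivable dV. Qed.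

Definition HV := Hmul potential_bounded.
Definition HV1 := Hmul dpotential_bounded.
Definition HS := Hmul sqrt_potential_bounded.
Definition HVshift h := Hmul (shift_potential_bounded h).

Lemma HV_HS f g : ip (HV f) g = ip (HS f) (HS g).
Proof.
apply: eq_Rintegral => x _.
change (V x * f x * g x = Num.sqrt (V x) * f x * (Num.sqrt (V x) * g x)).
by rewrite -{1}(sqr_sqrtr (ltW (V_gt0 x))); ring.
Qed.

Lemma HV_le f : ip (HV f) f <= M0 * ip f f.
Proof.
rewrite -ipZl; apply: le_Rintegral => //.
- exact: (L2_mul_integrable (L2_L2space (HV f)) (L2_L2space f)).
- exact: (L2_mul_integrable (L2_L2space (M0 *: f)) (L2_L2space f)).
move=> x _; change (V x * f x * f x <= M0 * f x * f x).
rewrite -!mulrA ler_wpM2r// -?expr2 ?sqr_ge0//; exact: le_trans (ler_norm _) (VM x).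
Qed.

Lemma HVshift_sym h f g : ip (HVshift h f) g = ip f (HVshift h g).
Proof.
apply: eq_Rintegral => x _; change (V (x + h) * f x * g x = f x * (V (x + h) * g x)); ring.
Qed.

Lemma HVshift_ge0 h f : 0 <= ip (HVshift h f) f.
Proof.
apply: Rintegral_ge0 => x _; change (0 <= V (x + h) * f x * f x).
by rewrite -mulrA; apply: mulr_ge0; [exact: ltW|rewrite -expr2 sqr_ge0].
Qed.

Lemma HVshift_le h f : ip (HVshift h f) f <= M0 * ip f f.
Proof.
rewrite -ipZl; apply: le_Rintegral => //.
- exact: (L2_mul_integrable (L2_L2space (HVshift h f)) (L2_L2space f)).
- exact: (L2_mul_integrable (L2_L2space (M0 *: f)) (L2_L2space f)).
move=> x _; change (V (x + h) * f x * f x <= M0 * f x * f x).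
rewrite -!mulrA ler_wpM2r// -?expr2 ?sqr_ge0//; exact: le_trans (ler_norm _) (VM _).
Qed.

Let kappa := alpha * Num.sqrt M0.

(** Pointwise |V'| <= alpha s^2 <= kappa s with s = sqrt(V); then Young's inequality for the product
    of s |f| and |g|. *)
Lemma HV1_le f g : `|ip (HV1 f) g| *+ 2 <= kappa * (ip (HV f) f + ip g g).
Proof.
suff K f' g' : ip (HV1 f') g' <= kappa / 2 * (ip (HV f') f' + ip g' g').
  have := K f g; have := K f (- g); rewrite !ipE opprK.
  by have [] := ger0P (ip (HV1 f) g); lra.
rewrite mulrDr -!ipZl.
have L1 := L2_mul_integrable (L2_L2space ((kappa / 2) *: HV f')) (L2_L2space f').
have L2 := L2_mul_integrable (L2_L2space ((kappa / 2) *: g')) (L2_L2space g').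
rewrite /= /l2ip -RintegralD//; apply: le_Rintegral => //.
- exact: (L2_mul_integrable (L2_L2space (HV1 f')) (L2_L2space g')).
- by have := integrableD measurableT L1 L2.
move=> x _; change (V1 x * f' x * g' x <=
  kappa / 2 * (V x * f' x) * f' x + kappa / 2 * g' x * g' x).
apply: le_trans (ler_norm _) _; rewrite !normrM.
set F := `|f' x|; set G := `|g' x|; set s := Num.sqrt (V x); set m := Num.sqrt M0.
have s0 : 0 <= s by exact: sqrtr_ge0.
have sm : s <= m by rewrite ler_wsqrtr// (le_trans (ler_norm _)).
have F2 : f' x * f' x = F ^+ 2 by rewrite real_normK ?num_real// expr2.
have G2 : g' x * g' x = G ^+ 2 by rewrite real_normK ?num_real// expr2.
have -> : kappa / 2 * (V x * f' x) * f' x + kappa / 2 * g' x * g' x =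
    kappa / 2 * (V x * F ^+ 2 + G ^+ 2) by rewrite -F2 -G2; ring.
have FG : 0 <= F * G by rewrite /F /G mulr_ge0.
have h1 : `|V1 x| * F * G <= alpha * V x * (F * G).
  by rewrite -mulrA ler_wpM2r.
apply: (le_trans h1); rewrite -(sqr_sqrtr (ltW (V_gt0 x))) -/s.
have h2 : alpha * s ^+ 2 * (F * G) <= alpha * m * (s * F * G).
  rewrite -subr_ge0 (_ : _ - _ = alpha * (m - s) * (s * (F * G))); last ring.
  by rewrite !mulr_ge0 ?subr_ge0 ?normr_ge0// ltW.
apply: (le_trans h2); rewrite -/kappa -/m.
have k0 : 0 <= kappa by rewrite mulr_ge0 ?sqrtr_ge0// ltW.
have -> : kappa / 2 * (s ^+ 2 * F ^+ 2 + G ^+ 2) = kappa * (2^-1 * ((s * F) ^+ 2 + G ^+ 2)).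
  by rewrite exprMn; ring.
rewrite /kappa -/m -/kappa ler_wpM2l//; have := sqr_ge0 (s * F - G); rewrite sqrrB; lra.
Qed.

Let dquot_sub_bounded n : bounded_by (M1 * n.+1%:R^-1) (fun x => V (x + n.+1%:R^-1) - V x).
Proof.
split=> [|x]; last exact: lipschitz_of_derive dV V1M _.
by apply: measurable_funB; [case: (shift_potential_bounded n.+1%:R^-1)|case: potential_bounded].
Qed.

Let dquot_taylor_bounded n : bounded_by (M2 * n.+1%:R^-1)
  (fun x => n.+1%:R^-1^-1 * (V (x + n.+1%:R^-1) - V x) - V1 x).
Proof.
split=> [|x]; last by apply: taylor1_of_derive dV dV1 V2M _; rewrite invr_gt0.
apply: measurable_funB; last by case: dpotential_bounded.
by apply: measurable_funM => //; case: (dquot_sub_bounded n).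
Qed.

Lemma Dx_HV f f' : Dx f f' -> Dx (HV f) (HV1 f + HV f').
Proof.
move=> ff'; have r0 : (n.+1%:R^-1 : R) @[n --> \oo] --> (0 : R) by exact: cvg_harmonic.
apply: (@cvg0_squeeze _ _ _ _ _ (fun n =>
  2 * (2 * (M0 ^+ 2 * ip (Hdquot n.+1%:R^-1 f - f') (Hdquot n.+1%:R^-1 f - f')) +
   2 * ((M1 * n.+1%:R^-1) ^+ 2 * ip f' f')) + 2 * ((M2 * n.+1%:R^-1) ^+ 2 * ip f f))); last first.
  have -> : (0 : R) = 2 * (2 * (M0 ^+ 2 * 0) + 2 * ((M1 * 0) ^+ 2 * ip f' f')) + 2 * ((M2 * 0) ^+ 2 * ip f f).
    by rewrite !mulr0 expr0n/= !mul0r !mulr0 !addr0 mulr0.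
  apply: cvgD; [apply: cvgMl_tmp; apply: cvgD|]; apply: cvgMl_tmp.
  - exact: cvgMl_tmp.
  - by apply: cvgMr_tmp; rewrite expr2; under eq_fun do rewrite expr2; apply: cvgM; exact: cvgMl_tmp.
  - by apply: cvgMr_tmp; rewrite expr2; under eq_fun do rewrite expr2; apply: cvgM; exact: cvgMl_tmp.
move=> n; rewrite ger0_norm ?ip_ge0//; set h := n.+1%:R^-1.
(* The three errors of the discrete Leibniz rule: the first is small by hypothesis on f, the second
   and third have operator norm at most M1 h and M2 h. *)
have -> : Hdquot h (HV f) - (HV1 f + HV f') = HVshift h (Hdquot h f - f') +
    Hmul (dquot_sub_bounded n) f' + Hmul (dquot_taylor_bounded n) f.
  apply: L2spaceP => x.
  change (h^-1 * (V (x + h) * f (x + h) - V x * f x) - (V1 x * f x + V x * f' x) =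
    V (x + h) * (h^-1 * (f (x + h) - f x) - f' x) + (V (x + h) - V x) * f' x +
    (h^-1 * (V (x + h) - V x) - V1 x) * f x); ring.
apply: le_trans (ip_sqrD_le _ _ _) _; apply: lerD; rewrite ler_wpM2l//; last first.
  apply: l2inner_dominated => x; change (`|(h^-1 * (V (x + h) - V x) - V1 x) * f x| <= M2 * h * `|f x|).
  by rewrite normrM ler_wpM2r//; have [_] := dquot_taylor_bounded n; apply.
apply: le_trans (ip_sqrD_le _ _ _) _; apply: lerD; rewrite ler_wpM2l//.
  apply: l2inner_dominated => x.
  change (`|V (x + h) * (Hdquot h f - f') x| <= M0 * `|(Hdquot h f - f') x|).
  by rewrite normrM ler_wpM2r.
apply: l2inner_dominated => x; change (`|(V (x + h) - V x) * f' x| <= M1 * h * `|f' x|).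
by rewrite normrM ler_wpM2r//; have [_] := dquot_sub_bounded n; apply.
Qed.

(** By the discrete Leibniz rule r = V'(. + h) d f + (d V') f + (d V) f'. Splitting the square twice
    gives the factors 2, 4, 4, with coefficients M1, M2, M1; since |d f| <= |f'|, the first and
    third add up to 6 M1^2. *)
Lemma dquot_commutator_le h f f' : 0 < h -> ip (Hdquot h f) (Hdquot h f) <= ip f' f' ->
  forall r, r = Hdquot h (HV1 f + HV f') - HVshift h (Hdquot h f') ->
  ip r r <= (6 * M1 ^+ 2 + 4 * M2 ^+ 2) * (ip f f + ip f' f').
Proof.
move=> h0 hf r rE.
have b1 : bounded_by M1 (fun x => V1 (x + h)).
  by split => //; apply: measurable_fun_shift; case: dpotential_bounded.
have b2 : bounded_by M2 (fun x => h^-1 * (V1 (x + h) - V1 x)).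
  split=> [|x].
    by apply: measurable_funM => //; apply: measurable_funB; [case: b1|case: dpotential_bounded].
  rewrite normrM normfV (gtr0_norm h0) ler_pdivrMl// mulrC.
  exact: lipschitz_of_derive dV1 V2M (ltW h0).
have b3 : bounded_by M1 (fun x => h^-1 * (V (x + h) - V x)).
  split=> [|x].
    by apply: measurable_funM => //; apply: measurable_funB;
      [case: (shift_potential_bounded h)|case: potential_bounded].
  rewrite normrM normfV (gtr0_norm h0) ler_pdivrMl// mulrC.
  exact: lipschitz_of_derive dV V1M (ltW h0).
have -> : r = Hmul b1 (Hdquot h f) + (Hmul b2 f + Hmul b3 f').
  rewrite rE; apply: L2spaceP => x.
  change (h^-1 * ((V1 (x + h) * f (x + h) + V (x + h) * f' (x + h)) -
     (V1 x * f x + V x * f' x)) - V (x + h) * (h^-1 * (f' (x + h) - f' x)) =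
    V1 (x + h) * (h^-1 * (f (x + h) - f x)) +
    (h^-1 * (V1 (x + h) - V1 x) * f x + h^-1 * (V (x + h) - V x) * f' x)); ring.
have B M b (bM : bounded_by M b) g : ip (Hmul bM g) (Hmul bM g) <= M ^+ 2 * ip g g.
  apply: l2inner_dominated => x; change (`|b x * g x| <= M * `|g x|).
  by rewrite normrM ler_wpM2r//; case: bM.
have h1 := ip_sqrD_le ip (Hmul b1 (Hdquot h f)) (Hmul b2 f + Hmul b3 f').
have h2 := ip_sqrD_le ip (Hmul b2 f) (Hmul b3 f').
have := B _ _ b1 (Hdquot h f); have := B _ _ b2 f; have := B _ _ b3 f'.
have : M1 ^+ 2 * ip (Hdquot h f) (Hdquot h f) <= M1 ^+ 2 * ip f' f' by rewrite ler_wpM2l ?sqr_ge0.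
have : 0 <= M1 ^+ 2 * ip f f by rewrite mulr_ge0 ?sqr_ge0 ?ip_ge0.
have : 0 <= M2 ^+ 2 * ip f' f' by rewrite mulr_ge0 ?sqr_ge0 ?ip_ge0.
move: h1 h2; lra.
Qed.

End Potential.

(** * Time integrals on the half line and Fatou's lemma *)

Section HalfLinePrimitive.
Context {R : realType}.
Local Notation mu := (@lebesgue_measure R).

(** Frozen at its initial value for negative times, hence continuous on the whole line although f is
    controlled only at nonnegative times. *)
Definition half_line (f : R -> R) s := f (Num.max s 0).

Lemma half_line_continuous (f f' : R -> R) : (forall t : R, 0 <= t -> is_derive t 1 f (f' t)) ->
  continuous (half_line f).
Proof.
move=> df s; apply: continuous_comp.
  by apply: continuous_max; [exact: id|exact: cst_continuous].
apply/differentiable_continuous/derivable1_diffP.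
by have [] // := df (Num.max s 0); rewrite le_max lexx orbT.
Qed.

(** The derivative serves the Lyapunov arguments, the Lebesgue integral serves Fatou's lemma. *)
Definition half_line_primitive (f q : R -> R) :=
  [/\ q 0 = 0, forall t : R, 0 <= t -> is_derive t 1 q (f t) &
    forall t : R, 0 <= t ->
      (q t)%:E = integral mu [set` Interval (BLeft 0) (BRight t)] (EFin \o half_line f)].

Lemma half_line_primitive_exists (f f' : R -> R) :
  (forall t : R, 0 <= t -> is_derive t 1 f (f' t)) ->
  exists q : R -> R, half_line_primitive f q.
Proof.
move=> df; have cg := half_line_continuous df.
have ig a b : mu.-integrable `[a, b] (EFin \o half_line f).
  apply: continuous_compact_integrable; first exact: segment_compact.
  exact: continuous_subspaceT.
(* Starting at -1 makes time 0 an interior point, as the two-sided derivative there requires. *)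
pose G t := (\int[mu]_(s in `[-1, t]%classic) half_line f s)%R.
exists (fun t => G t - G 0); split=> [|t t0|t t0]; first by rewrite subrr.
- have t1 : t < t + 1 by rewrite ltrDl.
  have t2 : -1 < t by lra.
  have [d e] := @continuous_FTC1_closed R (half_line f) (-1) t (t + 1) t1 (ig _ _) t2 (cg t).
  have dG : is_derive t 1 G (f t).
    apply: (DeriveDef d); rewrite -derive1E; apply: (etrans e).
    by rewrite /half_line max_l.
  by have := is_derive_add dG (is_derive_cst (- G 0) t 1); rewrite addr0.
- rewrite /G Rintegral_itvB//; [|by rewrite bnd_simp; lra].
  rewrite /Rintegral fineK; last first.
    apply: integrable_fin_num => //; apply: (integrableS _ _ _ (ig 0 t)) => //.
    by apply: subset_itvr; rewrite bnd_simp.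
  rewrite integral_itv_obnd_cbnd//.
  by apply: measurable_funTS; apply: measurableT_comp => //; exact: continuous_measurable_fun.
Qed.

Lemma half_line_fatou (f q : R -> R) (fn qn : nat -> R -> R) (K t : R) :
  0 <= t -> half_line_primitive f q -> (forall n, half_line_primitive (fn n) (qn n)) ->
  (forall n, continuous (half_line (fn n))) -> (forall n s, 0 <= fn n s) ->
  (forall s, 0 <= s -> fn n s @[n --> \oo] --> f s) ->
  (forall n, qn n t <= K) -> q t <= K.
Proof.
move=> t0 [_ _ qE] qnE fc f0 fnf qK; rewrite -lee_fin qE//.
have -> : integral mu [set` Interval (BLeft 0) (BRight t)] (EFin \o half_line f) =
    integral mu [set` Interval (BLeft 0) (BRight t)]
      (fun s => limn_einf (fun n => (half_line (fn n) s)%:E)).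
  apply: eq_integral => s _.
  have /cvg_limn_einf_sup[-> _] // : (half_line (fn n) s)%:E @[n --> \oo] --> (half_line f s)%:E.
  by apply: cvg_EFin; [exact: nearW|apply: fnf; rewrite le_max lexx orbT].
apply: le_trans.
  apply: (@fatou _ _ _ mu _ _ (fun n s => (half_line (fn n) s)%:E)) => // [n|n s _].
  by apply: measurable_funTS; apply: measurableT_comp => //; exact: continuous_measurable_fun.
  by rewrite lee_fin; exact: f0.
rewrite limn_einf_lim; apply: lime_le; first exact: is_cvg_einfs.
apply: nearW => n; apply: (@le_trans _ _ (qn n t)%:E); last by rewrite lee_fin.
have [_ _ ->//] := qnE n; apply: ereal_inf_lbound; exists n => //=.
Qed.

End HalfLinePrimitive.

(** The right-hand side of [wave_decay] in units of the data size: (3 + M0) / 2 bounds the initial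
    energy, l the initial [lyap], K the integral of |u_txx|^2; 5/4 is half the bound on
    [wave_cross2], and 3/4 half the bound 3/2 on the integral of |u|^2. *)
Definition decay_rate {R : realType} (kappa M0 B : R) : R :=
  let c := 1 - kappa in
  let l := 13 / 2 + 2 * M0 in
  let K := 3 + M0 + 2 * (B / c * l) + 3 / 2 * B in
  (3 + M0) / 2 + 2 / c * (l * (1 + (6 / c + 2^-1)) + 5 / 4 + K + 3 / 4).

(** * The abstract decay estimate with explicit constants *)

Section DampedWaveDecay.
Context {R : realType} {H : lmodType R} (p : semi_inner H).
Variables (D : H -> H -> Prop) (P P1 S : H -> H) (kappa : R).
Hypothesis D_skew : forall f f' g g', D f f' -> D g g' -> p f' g = - p f g'.
Hypothesis D_linear : forall a f f' g g', D f f' -> D g g' ->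
  D (a *: f + g) (a *: f' + g').
Hypothesis bP : bounded_linear p P.
Hypothesis P_sym : forall f g, p (P f) g = p (S f) (S g).
Hypothesis D_P : forall f f', D f f' -> D (P f) (P1 f + P f').
Hypothesis kappa01 : 0 <= kappa < 1.
Hypothesis P1_le : forall f g, `|p (P1 f) g| *+ 2 <= kappa * (p (P f) f + p g g).

Variables (a0 a1 a2 b0 b1 b2 c0 c1 c2 : R -> H).
Hypothesis Da0 : forall t, D (a0 t) (a1 t).
Hypothesis Da1 : forall t, D (a1 t) (a2 t).
Hypothesis Db0 : forall t, D (b0 t) (b1 t).
Hypothesis Db1 : forall t, D (b1 t) (b2 t).
Hypothesis Dc0 : forall t, D (c0 t) (c1 t).
Hypothesis Dc1 : forall t, D (c1 t) (c2 t).
Hypothesis da0 : tder p a0 b0.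
Hypothesis da1 : tder p a1 b1.
Hypothesis da2 : tder p a2 b2.
Hypothesis db0 : tder p b0 c0.
Hypothesis db1 : tder p b1 c1.
Hypothesis db2 : tder p b2 c2.
Hypothesis pde : forall t z, 0 <= t ->
  p (c0 t - c2 t - a2 t + P (a0 t) + b0 t) z = 0.

Variable f0 : H.
Hypothesis f0E : forall z, p (b0 0 - b2 0 + a0 0) z = p f0 (S z).

Variables (d Q : nat -> H -> H) (B : R).
Hypothesis bd : forall n, bounded_linear p (d n).
Hypothesis bQ : forall n, bounded_linear p (Q n).
Hypothesis Q_sym : forall n f g, p (Q n f) g = p f (Q n g).
Hypothesis Q_ge0 : forall n f, 0 <= p (Q n f) f.
Hypothesis D_d : forall n f f', D f f' -> D (d n f) (d n f').
Hypothesis d_cvg : forall f f', D f f' -> scvg p (F := \oo) (fun n => d n f) f'.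
Hypothesis B_ge0 : 0 <= B.
Hypothesis rest_le : forall n t, 0 <= t ->
  p (d n (P1 (a0 t) + P (a1 t)) - Q n (d n (a1 t)))
    (d n (P1 (a0 t) + P (a1 t)) - Q n (d n (a1 t))) <= B * (p (a0 t) (a0 t) + p (a1 t) (a1 t)).

Variables (M0 s : R).
Hypothesis M0_ge0 : 0 <= M0.
Hypothesis P_le : forall f, p (P f) f <= M0 * p f f.
Hypothesis Q_le : forall n f, p (Q n f) f <= M0 * p f f.
Hypothesis f0_le : p f0 f0 <= s.
Hypothesis a0_le : p (a0 0) (a0 0) <= s.
Hypothesis a1_le : p (a1 0) (a1 0) <= s.
Hypothesis a2_le : p (a2 0) (a2 0) <= s.
Hypothesis b0_le : p (b0 0) (b0 0) <= s.
Hypothesis b1_le : p (b1 0) (b1 0) <= s.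
Hypothesis b2_le : p (b2 0) (b2 0) <= s.
Hypothesis da1_le : forall n, p (d n (a1 0)) (d n (a1 0)) <= s.
Hypothesis da2_le : forall n, p (d n (a2 0)) (d n (a2 0)) <= s.
Hypothesis db1_le : forall n, p (d n (b1 0)) (d n (b1 0)) <= s.
Hypothesis db2_le : forall n, p (d n (b2 0)) (d n (b2 0)) <= s.

Let half_line_sq A A' : tder p A A' -> forall t : R, 0 <= t ->
  is_derive t 1 (fun t => p (A t) (A t)) (p (A' t) (A t) + p (A t) (A' t)).
Proof. by move=> dA t; exact: is_derive_ip. Qed.

Let sq_a0_time_integral q : half_line_primitive (fun t => p (a0 t) (a0 t)) q ->
  forall t, 0 <= t -> q t <= 3 / 2 * s.
Proof.
move=> [q0 dq _] t t0.
have := time_integral_le D_skew D_linear bP P_sym Da0 Da1 Db1 da0 da1 db0 db2 pde q0 dq f0E t0.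
have := ip_ge0 p (a0 t); have := ip_ge0 p (a1 t); move: a0_le a1_le f0_le; lra.
Qed.

Local Notation E := (wave_energy p P a0 a1 b0 b1).
Local Notation L := (lyap p P a0 a1 a2 b0 b1 b2).

Let pot_le f : p f f <= s -> p (P f) f <= M0 * s.
Proof. by move=> fs; apply: le_trans (P_le f) _; rewrite ler_wpM2l. Qed.

Let wave_energy_initial : E 0 <= (3 + M0) / 2 * s.
Proof.
by rewrite /wave_energy; have := pot_le a0_le; move: a1_le b0_le b1_le; lra.
Qed.

Let lyap_initial : L 0 <= (13 / 2 + 2 * M0) * s.
Proof.
have := lyap_le P_sym a0 a1 a2 b0 b1 b2 0; have := wave_energy_initial.
rewrite /wave_energy2; have := pot_le a1_le; move: a0_le b1_le b2_le a2_le; lra.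
Qed.

Let wave_cross2_initial : wave_cross2 p a1 a2 b1 b2 0 <= 5 / 2 * s.
Proof.
rewrite /wave_cross2.
have := ip_young p (b1 0) (a1 0) ltr01; have := ip_young p (b2 0) (a2 0) ltr01.
rewrite invr1 !mul1r; have := ler_norm (p (b1 0) (a1 0)); have := ler_norm (p (b2 0) (a2 0)).
move: a1_le a2_le b1_le b2_le; lra.
Qed.

Let K2 := (3 + M0 + 2 * (B / (1 - kappa) * (13 / 2 + 2 * M0)) + 3 / 2 * B) * s.

Let d_time_integral n q : half_line_primitive (fun t => p (d n (b1 t)) (d n (b1 t))) q ->
  forall t, 0 <= t -> q t <= K2.
Proof.
move=> [q0 dq _] t t0.
have [q1 hq1] := half_line_primitive_exists (half_line_sq da0).
have q1K := sq_a0_time_integral hq1 t0; case: hq1 => q10 dq1 _.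
have := third_order_dissipation D_skew bP P_sym D_P kappa01 P1_le Da0 Da1 Db0 Db1 Dc0 Dc1
  da0 da1 da2 db0 db1 db2 pde (bd n) (bQ n) (Q_sym n) (Q_ge0 n) (D_d n) (rest_le n)
  B_ge0 q10 dq1 q0 dq t0.
have B1 : 0 <= B / (1 - kappa) by rewrite divr_ge0// subr_ge0 ltW//; case/andP: kappa01.
have h1 := ler_wpM2l B1 lyap_initial; have h2 := ler_wpM2l B_ge0 q1K.
have h3 : p (Q n (d n (a1 0))) (d n (a1 0)) <= M0 * s.
  by apply: le_trans (Q_le _ _) _; rewrite ler_wpM2l.
rewrite /wave_energy3 /=; move: (da2_le n) (db1_le n) (db2_le n) h1 h2 h3; rewrite /K2.
rewrite mulrA [B * (_ * _)]mulrA; lra.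
Qed.

Let sq_b2_time_integral q : half_line_primitive (fun t => p (b2 t) (b2 t)) q ->
  forall t, 0 <= t -> q t <= K2.
Proof.
move=> hq t t0.
have df n := half_line_sq (tder_bounded (bd n) db1).
have [qn hqn] := choice (fun n => half_line_primitive_exists (df n)).
apply: (half_line_fatou t0 hq hqn).
- by move=> n; exact: half_line_continuous (df n).
- by move=> n t'; exact: ip_ge0.
- by move=> t' _; apply: scvg_ip; exact: d_cvg.
- by move=> n; exact: d_time_integral (hqn n) _ t0.
Qed.

Lemma wave_decay_bound t : 0 <= t ->
  (1 + t) ^+ 2 * E t + 4^-1 / (1 - kappa) * (1 + t) * p (a0 t) (a0 t) <=
  decay_rate kappa M0 B * s.
Proof.
move=> t0.
have [q1 hq1] := half_line_primitive_exists (half_line_sq da0).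
have [q2 hq2] := half_line_primitive_exists (half_line_sq db2).
have q1K := sq_a0_time_integral hq1; case: hq1 => q10 dq1 _.
have q2K := sq_b2_time_integral hq2; case: hq2 => q20 dq2 _.
have := wave_decay D_skew bP P_sym D_P kappa01 P1_le Da0 Da1 Db0 Db1 Dc0 Dc1
  da0 da1 da2 db0 db1 db2 pde q10 dq1 q20 dq2 q1K q2K t0.
move=> h; apply: (le_trans h); rewrite /decay_rate; cbv zeta.
have k1 : 0 < 1 - kappa by rewrite subr_gt0; case/andP: kappa01.
rewrite [leRHS]mulrDl; apply: lerD; first exact: wave_energy_initial.
rewrite -[leRHS]mulrA; apply: ler_wpM2l; first by apply: divr_ge0 => //; exact: ltW.
have l0 : 0 <= 1 + (6 / (1 - kappa) + 2^-1) by rewrite !addr_ge0// divr_ge0// ltW.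
have := ler_wpM2r l0 lyap_initial; have := wave_cross2_initial; rewrite /K2.
move: (6 / _) (B / _) => x y; lra.
Qed.

End DampedWaveDecay.

(** * Strong solutions as curves in L^2 *)

Section Lift.
Context {R : realType}.
Local Notation mu := (@lebesgue_measure R).
Local Notation H := (L2space (R := R)).
Local Notation ip := (l2inner (R := R)).
Implicit Types f g : R -> R.

Definition lift f : H := if pselect (L2 f) is left f2 then toL2 f2 else 0.

Lemma liftE f : L2 f -> lift f = f :> (R -> R).
Proof. by rewrite /lift; case: pselect. Qed.

Lemma ip_ae (F G : H) z : {ae mu, forall x, F x = G x} -> ip F z = ip G z.
Proof. exact: (l2ip_ae (L2_L2space F) (L2_L2space G) (L2_L2space z)). Qed.

Lemma sqr_ip_ae (F G : H) : {ae mu, forall x, F x = G x} -> ip F F = ip G G.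
Proof. by move=> FG; rewrite (ip_ae F FG) ipC (ip_ae G FG). Qed.

Lemma ip_lift f : L2 f -> ip (lift f) (lift f) = L2norm f ^+ 2.
Proof. by move=> f2; rewrite sqr_L2norm// /= liftE. Qed.

Lemma sqr_L2norm_ae f g : L2 f -> L2 g -> {ae mu, forall x, f x = g x} ->
  L2norm f ^+ 2 = L2norm g ^+ 2.
Proof.
move=> f2 g2 fg; rewrite -!ip_lift//; apply: sqr_ip_ae.
by apply: aeS fg => x; rewrite !liftE.
Qed.

Lemma sqr_L2norm_wD0 l f : Sobolev l f -> L2norm (wD 0 f) ^+ 2 = L2norm f ^+ 2.
Proof.
by move=> sf; apply: sqr_L2norm_ae; [exact: L2_wD sf _|case: sf|exact: wD0_ae sf].
Qed.

Lemma lift_sqr_le l k f : Sobolev l f -> (k <= l)%N ->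
  ip (lift (wD k f)) (lift (wD k f)) <= Sobolev_norm l f ^+ 2.
Proof. by move=> sf kl; rewrite ip_lift ?L2norm_wD_le//; exact: L2_wD sf kl. Qed.

Lemma is_weak_derivative_wD l k f : Sobolev l f -> (k < l)%N ->
  is_weak_derivative 1 (lift (wD k f)) (lift (wD k.+1 f)).
Proof.
move=> sf kl; rewrite !liftE; [|exact: L2_wD sf _|exact: L2_wD sf (ltnW kl)].
exact: is_weak_derivativeS (wD_is_weak_derivative sf (ltnW kl)) (wD_is_weak_derivative sf kl).
Qed.

Lemma wD_increment l k (a : R) f g v : Sobolev l f -> Sobolev l g -> Sobolev l v ->
  (* The parentheses follow the difference quotient of a curve minus its derivative. *)
  (k <= l)%N -> let F x := a * (f x - g x) - v x in
  Sobolev l F /\ {ae mu, forall x, wD k F x = a * (wD k f x - wD k g x) - wD k v x}.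
Proof.
move=> sf sg sv kl F; pose X x := -1 * g x + f x; pose Y x := (a - 1) * X x + X x.
have sX : Sobolev l X by exact: Sobolev_lin.
have sY : Sobolev l Y by exact: Sobolev_lin.
(* Every combination is built from the shape a f + g that [wD_lin] handles: X is f - g and Y is a X,
   written as (a - 1) X + X. *)
have FE : F = fun x => -1 * v x + Y x by apply/funext => x; rewrite /F /Y /X; ring.
split; first by rewrite FE; exact: Sobolev_lin.
have h1 := wD_lin (-1) sg sf kl; have h2 := wD_lin (a - 1) sX sX kl.
have h3 := wD_lin (-1) sv sY kl; rewrite FE.
apply: aeS2 (aeS2 (fun x => @conj _ _) h1 h2) h3 => x [e1 e2] ->.
by rewrite e2 e1; ring.
Qed.

Lemma Sobolev_le k l f : (k <= l)%N -> Sobolev l f -> Sobolev k f.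
Proof. by move=> kl [f2 fl]; split=> // j jk; apply: fl; exact: leq_trans kl. Qed.

Lemma scvg_at_right (u : R -> H) z : scvg ip (F := 0^') u z -> scvg ip (F := 0^'+) u z.
Proof.
move=> uz; apply: cvg_trans uz; apply: cvg_app => A.
rewrite !nbhs_nearE !near_withinE; apply: filterS => x Ax x0; apply: Ax.
by rewrite gt_eqF.
Qed.

End Lift.

Lemma sqr_cvg0 {R : realType} {T : Type} (F : set_system T) {FF : Filter F} (f : T -> R) :
  f x @[x --> F] --> (0 : R) -> f x ^+ 2 @[x --> F] --> (0 : R).
Proof.
move=> f0; have : f x * f x @[x --> F] --> (0 * 0 : R) by exact: cvgM.
by rewrite mulr0.
Qed.

Section Curves.
Context {R : realType}.
Local Notation mu := (@lebesgue_measure R).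
Local Notation H := (L2space (R := R)).
Local Notation ip := (l2inner (R := R)).
Implicit Types (u v w : R -> R -> R) (k : nat).

(* Two-sided time derivatives are wanted at time 0, hence the affine
   continuation to negative times. *)
Definition curve k u v t : H :=
  if 0 <= t then lift (wD k (u t)) else t *: lift (wD k (v 0)) + lift (wD k (u 0)).

Lemma curveE k u v t : 0 <= t -> curve k u v t = lift (wD k (u t)).
Proof. by rewrite /curve => ->. Qed.

Lemma sqr_curve k u v t : (k <= 2)%N -> 0 <= t -> Sobolev 2 (u t) ->
  ip (curve k u v t) (curve k u v t) = L2norm (wD k (u t)) ^+ 2.
Proof. by move=> k2 t0 su; rewrite curveE// ip_lift//; exact: L2_wD su k2. Qed.

Lemma curve_Dx k u v t : (forall t, 0 <= t -> Sobolev 2 (u t)) -> Sobolev 2 (v 0) ->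
  (k < 2)%N -> Dx (curve k u v t) (curve k.+1 u v t).
Proof.
move=> su sv k2; rewrite /curve; case: ifP => t0.
  by apply: is_weak_derivative_Dx; exact: is_weak_derivative_wD (su _ t0) k2.
apply: Dx_linear; apply: is_weak_derivative_Dx; first exact: is_weak_derivative_wD sv k2.
exact: is_weak_derivative_wD (su _ (lexx _)) k2.
Qed.

Lemma curve_increment_le k u v w (a t s : R) : (forall t, 0 <= t -> Sobolev 2 (u t)) ->
  Sobolev 2 (v t) -> (k <= 2)%N -> 0 <= t -> 0 <= s ->
  ip (a *: (curve k u v s - curve k u v t) - curve k v w t)
     (a *: (curve k u v s - curve k u v t) - curve k v w t) <=
  Sobolev_norm 2 (fun x => a * (u s x - u t x) - v t x) ^+ 2.
Proof.
move=> su sv k2 t0 s0; rewrite !curveE//.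
have [sF FE] := wD_increment a (su _ s0) (su _ t0) sv k2.
apply: le_trans (lift_sqr_le sF k2); rewrite le_eqVlt; apply/orP; left; apply/eqP.
apply: sqr_ip_ae; rewrite [X in {ae _, forall x, _ = X x}]liftE; last exact: L2_wD sF k2.
apply: aeS FE => x ->.
change (a * (lift (wD k (u s)) x - lift (wD k (u t)) x) - lift (wD k (v t)) x =
  a * (wD k (u s) x - wD k (u t) x) - wD k (v t) x).
by rewrite !liftE//; [exact: L2_wD sv k2|exact: L2_wD (su _ t0) k2|exact: L2_wD (su _ s0) k2].
Qed.

Lemma curve_tder k u v w : (forall t, 0 <= t -> Sobolev 2 (u t)) ->
  (forall t, 0 <= t -> Sobolev 2 (v t)) -> time_derivative 2 u v -> (k <= 2)%N ->
  tder ip (curve k u v) (curve k v w).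
Proof.
move=> su sv uv k2 t t0.
pose N h := Sobolev_norm 2 (fun x => h^-1 * (u (t + h) x - u t x) - v t x).
have N0 : N h ^+ 2 @[h --> within [set h : R | 0 <= t + h] (0:R)^'] --> (0 : R).
  exact: sqr_cvg0 (uv t t0).
apply/cvgrPdist_lt => e e0; move/cvgrPdist_lt : N0 => /(_ e e0); rewrite !near_withinE /=.
(* For t > 0 the constraint 0 <= t + h holds for all small h. For t = 0 it excludes h < 0, where the
   affine continuation makes the difference quotient exact. *)
have [t_gt0|t_le0] := ltP 0 t.
  have : \forall h \near (0:R), 0 <= t + h.
    exists t => //= h /=; rewrite sub0r normrN => ht; have := ler_norm (- h); rewrite normrN.
    by move: ht; lra.
  move=> + ht; apply: filterS2 ht => h Nh ht h0.
  rewrite sub0r normrN ger0_norm ?l2ip_ge0//.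
  apply: le_lt_trans (curve_increment_le _ _ su (sv _ t0) k2 t0 ht) _.
  by have := Nh h0 ht; rewrite sub0r normrN ger0_norm ?sqr_ge0.
have {t_le0}t_0 : t = 0 by apply/eqP; rewrite eq_le t_le0.
apply: filterS => h Nh h0; rewrite sub0r normrN ger0_norm ?l2ip_ge0//.
have [ht|ht] := leP 0 (t + h).
  apply: le_lt_trans (curve_increment_le _ _ su (sv _ t0) k2 t0 ht) _.
  by have := Nh h0 ht; rewrite sub0r normrN ger0_norm ?sqr_ge0.
move: ht; rewrite t_0 add0r => ht.
have E : h^-1 *: (curve k u v h - curve k u v 0) - curve k v w 0 = 0.
  by rewrite {1}/curve leNgt ht/= !curveE// addrK scalerA mulVf// scale1r subrr.
suff : ip (h^-1 *: (curve k u v h - curve k u v 0) - curve k v w 0)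
  (h^-1 *: (curve k u v h - curve k u v 0) - curve k v w 0) < e by [].
by rewrite E ip0l.
Qed.

Lemma curve_right_continuous k u v : (forall t, 0 <= t -> Sobolev 2 (u t)) ->
  time_continuous 2 u -> (k <= 2)%N -> scvg ip (F := 0^'+) (curve k u v) (curve k u v 0).
Proof.
move=> su cu k2.
have N0 : Sobolev_norm 2 (fun x => u s x - u 0 x) ^+ 2
    @[s --> within [set s : R | 0 <= s] (nbhs (0:R))] --> (0 : R).
  exact: sqr_cvg0 (cu 0 (lexx _)).
apply/cvgrPdist_lt => e e0; move/cvgrPdist_lt : N0 => /(_ e e0); rewrite !near_withinE /=.
apply: filterS => h Nh h0; rewrite sub0r normrN ger0_norm ?l2ip_ge0//.
rewrite /curve lexx (ltW h0).
have [sF FE] : let F x := u h x - u 0 x in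
    Sobolev 2 F /\ {ae mu, forall x, wD k F x = wD k (u h) x - wD k (u 0) x}.
  have FE : (fun x => u h x - u 0 x) = fun x => -1 * u 0 x + u h x.
    by apply/funext => x; ring.
  split; first by rewrite FE; apply: Sobolev_lin; apply: su => //; exact: ltW.
  have := wD_lin (-1) (su 0 (lexx _)) (su h (ltW h0)) k2; rewrite -FE.
  by apply: aeS => x ->; ring.
have := Nh (ltW h0); rewrite sub0r normrN ger0_norm ?sqr_ge0//.
apply: le_lt_trans; apply: le_trans (lift_sqr_le sF k2).
rewrite le_eqVlt; apply/orP; left; apply/eqP.
apply: (@sqr_ip_ae _ (lift (wD k (u h)) - lift (wD k (u 0)))); rewrite [X in {ae _, forall x, _ = X x}]liftE; last exact: L2_wD sF k2.
apply: aeS FE => x ->.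
change (lift (wD k (u h)) x - lift (wD k (u 0)) x = wD k (u h) x - wD k (u 0) x).
by rewrite !liftE//; [exact: L2_wD (su 0 _) k2|exact: L2_wD (su _ (ltW h0)) k2].
Qed.

End Curves.

(** Since c <= 1 the weight of y is at least (1 + t) / 4, whence the factor 4. *)
Lemma decay_of_weighted {R : realType} (c t x y K : R) : 0 < c <= 1 -> 0 <= t ->
  0 <= x -> 0 <= y -> (1 + t) ^+ 2 * x + 4^-1 / c * (1 + t) * y <= K ->
  x <= K * (1 + t) ^- 2 /\ y <= 4 * K * (1 + t)^-1.
Proof.
move=> /andP[c0 c1] t0 x0 y0 h; have t1 : 0 < 1 + t by rewrite ltr_wpDr.
have c4 : 4^-1 <= 4^-1 / c by rewrite ler_peMr// invf_ge1.
have h1 : 0 <= (1 + t) ^+ 2 * x by rewrite mulr_ge0// sqr_ge0.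
have h2 : 4^-1 * ((1 + t) * y) <= 4^-1 / c * ((1 + t) * y).
  by apply: ler_wpM2r => //; rewrite mulr_ge0// ltW.
have h3 : 0 <= (1 + t) * y by rewrite mulr_ge0// ltW.
rewrite !ler_pdivlMr ?exprn_gt0// [x * _]mulrC [y * _]mulrC.
by move: h; rewrite -mulrA; split; lra.
Qed.

(** * Application to a strong solution *)

Section Decay.
Context {R : realType}.
Local Notation mu := (@lebesgue_measure R).
Local Notation H := (L2space (R := R)).
Local Notation ip := (l2inner (R := R)).

Variables (alpha : R) (V u0 u1 : R -> R) (u ut utt : R -> R -> R).
Hypothesis BCV : BC 2 V.
Hypothesis alpha_gt0 : 0 < alpha.
Hypothesis V_gt0 : forall x, 0 < V x.
Hypothesis V1_le : forall x, `|derive1 V x| <= alpha * V x.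
Hypothesis alphaV : alpha ^+ 2 * supnorm V < 1.
Hypothesis su0 : Sobolev 3 u0.
Hypothesis su1 : Sobolev 3 u1.
Hypothesis wL2 : L2 (weighted_data V u0 u1).
Hypothesis sol : strong_solution V u0 u1 u ut utt.

Local Notation V1 := (derive1 V).
Local Notation V2 := (derive1n 2 V).
Local Notation M0 := (supnorm V).
Local Notation M1 := (supnorm V1).
Local Notation M2 := (supnorm V2).

Let dV (x : R) : is_derive x 1 V (V1 x).
Proof. by rewrite derive1E; apply/derivableP; case: BCV => -[+ _] _ => /(_ 0%N isT x). Qed.

Let dV1 (x : R) : is_derive x 1 V1 (V2 x).
Proof.
rewrite [V2 x]derive1E; apply/derivableP.
by case: BCV => -[+ _] _ => /(_ 1%N isT x).
Qed.

Let VM x : `|V x| <= M0.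
Proof.
apply: le_supnorm; last by case: BCV => _ /(_ 0%N isT).
by move=> y; apply/differentiable_continuous/derivable1_diffP; case: (dV y).
Qed.

Let V1M x : `|V1 x| <= M1.
Proof.
apply: le_supnorm; last by case: BCV => _ /(_ 1%N isT).
by move=> y; apply/differentiable_continuous/derivable1_diffP; case: (dV1 y).
Qed.

Let V2M x : `|V2 x| <= M2.
Proof. by apply: le_supnorm; [case: BCV => -[]|case: BCV => _ /(_ 2%N isT)]. Qed.

Let kappa := alpha * Num.sqrt M0.
Let kappa01 : 0 <= kappa < 1.
Proof.
have k0 : 0 <= kappa by rewrite mulr_ge0 ?sqrtr_ge0// ltW.
by rewrite k0 -(@ltr_pXn2r _ 2) ?nnegrE// expr1n exprMn sqr_sqrtr ?supnorm_ge0.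
Qed.

Let su t : 0 <= t -> Sobolev 2 (u t).
Proof. by case: sol => -[+ _ _ _] _ _ _ => /[apply] -[]. Qed.
Let sut t : 0 <= t -> Sobolev 2 (ut t).
Proof. by case: sol => -[+ _ _ _] _ _ _ => /[apply] -[]. Qed.
Let sutt t : 0 <= t -> Sobolev 2 (utt t).
Proof. by case: sol => -[+ _ _ _] _ _ _ => /[apply] -[]. Qed.

Let a k := curve k u ut.
Let b k := curve k ut utt.
(** There is no third time derivative to continue u_tt with; the slope u_tt is an arbitrary H^2
    choice that keeps [De] true at negative times. *)
Let e k := curve k utt utt.

Let Da t k : (k < 2)%N -> Dx (a k t) (a k.+1 t).
Proof. by move=> k2; apply: curve_Dx su (sut (lexx _)) k2. Qed.
Let Db t k : (k < 2)%N -> Dx (b k t) (b k.+1 t).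
Proof. by move=> k2; apply: curve_Dx sut (sutt (lexx _)) k2. Qed.
Let De t k : (k < 2)%N -> Dx (e k t) (e k.+1 t).
Proof. by move=> k2; apply: curve_Dx sutt (sutt (lexx _)) k2. Qed.

Let da k : (k <= 2)%N -> tder ip (a k) (b k).
Proof. by move=> k2; apply: curve_tder su sut _ k2; case: sol => -[]. Qed.
Let db k : (k <= 2)%N -> tder ip (b k) (e k).
Proof. by move=> k2; apply: curve_tder sut sutt _ k2; case: sol => -[]. Qed.

Let P := HV dV VM.
Let bP : bounded_linear ip P. Proof. exact: bounded_linear_Hmul. Qed.

Let pde_pos (t : R) z : 0 < t -> ip (e 0 t - e 2 t - a 2 t + P (a 0 t) + b 0 t) z = 0.
Proof.
move=> t0; have t0' := ltW t0; rewrite -[RHS](ip0l ip z); apply: ip_ae.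
have h0 := wD0_ae (su t0'); have h1 := wD0_ae (sut t0'); have h2 := wD0_ae (sutt t0').
case: sol => _ /(_ t t0) eq _ _.
apply: aeS2 (aeS2 (fun x => @conj _ _) h0 h1) (aeS2 (fun x => @conj _ _) h2 eq).
move=> x [e0 e1] [e2 eq0]; apply: etrans _ eq0.
change (e 0 t x - e 2 t x - a 2 t x + V x * a 0 t x + b 0 t x =
  utt t x - wD 2 (utt t) x - wD 2 (u t) x + V x * u t x + ut t x).
have ua : a 0 t x = u t x by rewrite /a curveE// liftE//; exact: L2_wD (su t0') _.
have ue : e 0 t x = utt t x by rewrite /e curveE// liftE//; exact: L2_wD (sutt t0') _.
have ub : b 0 t x = ut t x by rewrite /b curveE// liftE//; exact: L2_wD (sut t0') _.
have a2 : a 2 t x = wD 2 (u t) x by rewrite /a curveE// liftE//; exact: L2_wD (su t0') _.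
have e2' : e 2 t x = wD 2 (utt t) x by rewrite /e curveE// liftE//; exact: L2_wD (sutt t0') _.
congr (_ - _ - _ + _ * _ + _); [exact: ue|exact: e2'|exact: a2|exact: ua|exact: ub].
Qed.

Let right_cvg A A' : tder ip A A' -> scvg ip (F := 0^'+) A (A 0).
Proof.
move=> dA; apply: scvg_at_right; have := tder_cvg dA (lexx 0).
by under eq_fun do rewrite add0r.
Qed.

(** The equation is given for positive times only; at time 0 it follows by right continuity, for
    u_tt from the continuity required of a strong solution. *)
Let pde t z : 0 <= t -> ip (e 0 t - e 2 t - a 2 t + P (a 0 t) + b 0 t) z = 0.
Proof.
rewrite le_eqVlt => /predU1P[<-|]; last exact: pde_pos.
have ce k : (k <= 2)%N -> scvg ip (F := 0^'+) (e k) (e k 0).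
  by move=> k2; apply: curve_right_continuous sutt _ k2; case: sol => -[].
have FF : ProperFilter (0 : R)^'+ := at_right_proper_filter 0.
pose m s := e 0 s + (-1) *: e 2 s + (-1) *: a 2 s + P (a 0 s) + b 0 s.
have mE s : m s = e 0 s - e 2 s - a 2 s + P (a 0 s) + b 0 s.
  by rewrite /m (scaleN1r (e 2 s)) (scaleN1r (a 2 s)).
have mc : scvg ip (F := 0^'+) m (m 0).
  apply: scvgD; last exact: right_cvg (db _).
  apply: scvgD; last exact: scvg_bounded bP (right_cvg (da _)).
  apply: scvgD; last exact: scvgZ (right_cvg (da _)).
  by apply: scvgD; [|apply: scvgZ]; exact: ce.
rewrite -mE; apply: (cvg_unique (@Rhausdorff R) (scvg_ip mc (scvg_cst ip z))).
apply: cvg_near_cst; near=> s; rewrite mE; apply: pde_pos.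
by near: s; exact: nbhs_right_gt.
Unshelve. all: by end_near. Qed.

Let S := data_size V u0 u1.
Let f0 := lift (weighted_data V u0 u1).
Let Q h := HVshift dV VM h.

Let S_ge : Sobolev_norm 3 u0 ^+ 2 <= S /\ Sobolev_norm 3 u1 ^+ 2 <= S /\ ip f0 f0 <= S.
Proof.
have K (x y z : R) : 0 <= x -> 0 <= y -> 0 <= z ->
    x <= x + y + z /\ y <= x + y + z /\ z <= x + y + z by move=> ? ? ?; lra.
by rewrite ip_lift//; apply: K; exact: sqr_ge0.
Qed.

Let initial_ae k : (k <= 2)%N ->
  {ae mu, forall x, a k 0 x = wD k u0 x} /\ {ae mu, forall x, b k 0 x = wD k u1 x}.
Proof.
move=> k2; case: sol => _ _ uu0 uu1; rewrite /a /b !curveE// !liftE; first split.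
- apply: (wD_ae (l := 2)) => //; [exact: su|by case: su0|exact: Sobolev_le su0].
- apply: (wD_ae (l := 2)) => //; [exact: sut|by case: su1|exact: Sobolev_le su1].
- exact: L2_wD (sut (lexx _)) k2.
- exact: L2_wD (su (lexx _)) k2.
Qed.

Let sqr_initial_le k : (k <= 2)%N -> ip (a k 0) (a k 0) <= S /\ ip (b k 0) (b k 0) <= S.
Proof.
move=> k2; have k3 : (k <= 3)%N by exact: leq_trans k2 _.
have [S0 [S1 _]] := S_ge; have [ha hb] := initial_ae k2; split.
  apply: le_trans S0; apply: le_trans (lift_sqr_le su0 k3); rewrite le_eqVlt.
  by rewrite (@sqr_ip_ae _ _ (lift (wD k u0))) ?eqxx// liftE//; exact: L2_wD su0 k3.
apply: le_trans S1; apply: le_trans (lift_sqr_le su1 k3); rewrite le_eqVlt.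
by rewrite (@sqr_ip_ae _ _ (lift (wD k u1))) ?eqxx// liftE//; exact: L2_wD su1 k3.
Qed.

(** The third derivative of the data enters here: a difference quotient of the k-th derivative is
    bounded, uniformly in h, by the derivative of order k + 1 <= 3. *)
Let dquot_initial_le h k : 0 < h -> (k <= 2)%N ->
  ip (Hdquot h (a k 0)) (Hdquot h (a k 0)) <= S /\
  ip (Hdquot h (b k 0)) (Hdquot h (b k 0)) <= S.
Proof.
move=> h0 k2; have [S0 [S1 _]] := S_ge; have [ha hb] := initial_ae k2.
have K g (F : H) : Sobolev 3 g -> {ae mu, forall x, F x = wD k g x} ->
    ip (Hdquot h F) (Hdquot h F) <= Sobolev_norm 3 g ^+ 2.
  move=> sg Fg; apply: le_trans (lift_sqr_le sg (k2 : (k.+1 <= 3)%N)); apply: Hdquot_le => //.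
  have k3 : (k <= 3)%N by exact: leq_trans k2 _.
  rewrite liftE; last exact: L2_wD sg _.
  apply: (@is_weak_derivative_ae _ 1 (wD k g)).
  - exact/L2_locally_integrable/L2_L2space.
  - by apply: aeS Fg => x ->.
  - exact: is_weak_derivativeS (wD_is_weak_derivative sg k3)
      (wD_is_weak_derivative sg (k2 : (k.+1 <= 3)%N)).
by split; [exact: le_trans (K u0 _ su0 ha) S0|exact: le_trans (K u1 _ su1 hb) S1].
Qed.

(** The weighted data times sqrt(V) is u_0 + u_1 - u_1'', and multiplication by sqrt(V) is
    symmetric. *)
Let f0E z : ip (b 0 0 - b 2 0 + a 0 0) z = ip f0 (HS dV VM z).
Proof.
transitivity (ip (HS dV VM f0) z); last first.
  apply: eq_Rintegral => x _.
  change (Num.sqrt (V x) * f0 x * z x = f0 x * (Num.sqrt (V x) * z x)); ring.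
have [b0 b2] : (0 <= 2)%N /\ (2 <= 2)%N by [].
have [ha0 hb0] := initial_ae b0; have [_ hb2] := initial_ae b2.
have w0 := wD0_ae su0; have w1 := wD0_ae su1.
apply: ip_ae; apply: aeS2 (aeS2 (fun x => @conj _ _) hb0 hb2)
  (aeS2 (fun x => @conj _ _) ha0 (aeS2 (fun x => @conj _ _) w0 w1)).
move=> x [e1 e2] [e3 [e4 e5]].
change (b 0 0 x - b 2 0 x + a 0 0 x = Num.sqrt (V x) * f0 x).
rewrite e1 e2 e3 e4 e5 /f0 liftE// /weighted_data mulrCA mulfV ?mulr1; last first.
  by rewrite gt_eqF// sqrtr_gt0.
by ring.
Qed.

Let B := 6 * M1 ^+ 2 + 4 * M2 ^+ 2.
Let E := wave_energy ip P (a 0) (a 1) (b 0) (b 1).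

Let rest_le h s : 0 < h -> 0 <= s ->
  ip (Hdquot h (HV1 dV1 V1M (a 0 s) + P (a 1 s)) - Q h (Hdquot h (a 1 s)))
    (Hdquot h (HV1 dV1 V1M (a 0 s) + P (a 1 s)) - Q h (Hdquot h (a 1 s))) <=
  B * (ip (a 0 s) (a 0 s) + ip (a 1 s) (a 1 s)).
Proof.
move=> h0 s0; have hq : ip (Hdquot h (a 0 s)) (Hdquot h (a 0 s)) <= ip (a 1 s) (a 1 s).
  by apply: Hdquot_le => //; rewrite /a !curveE//; exact: is_weak_derivative_wD (su s0) _.
exact: (@dquot_commutator_le _ _ _ _ _ _ _ dV dV1 VM V1M V2M _ _ _ h0 hq _ erefl).
Qed.

Let decay t : 0 <= t ->
  (1 + t) ^+ 2 * E t + 4^-1 / (1 - kappa) * (1 + t) * ip (a 0 t) (a 0 t) <=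
  decay_rate kappa M0 B * S.
Proof.
have [k0 [k1 k2]] : (0 <= 2)%N /\ (1 <= 2)%N /\ (2 <= 2)%N by [].
have [l0 l1] : (0 < 2)%N /\ (1 < 2)%N by [].
have [A0 B0] := sqr_initial_le k0; have [A1 B1] := sqr_initial_le k1.
have [A2 B2] := sqr_initial_le k2; have [_ [_ F0]] := S_ge.
have n0 n : 0 < n.+1%:R^-1 :> R by rewrite invr_gt0.
pose dn n := Hdquot (R := R) n.+1%:R^-1; pose Qn n := Q n.+1%:R^-1.
have B_ge0 : 0 <= B by rewrite addr_ge0// mulr_ge0// sqr_ge0.
exact: (@wave_decay_bound _ _ ip Dx P (HV1 dV1 V1M) (HS dV VM) kappa (@Dx_skew R) (@Dx_linear R)
  bP (HV_HS dV V_gt0 VM) (Dx_HV dV dV1 VM V1M V2M) kappa01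
  (HV1_le dV dV1 V_gt0 V1_le VM V1M alpha_gt0)
  (a 0) (a 1) (a 2) (b 0) (b 1) (b 2) (e 0) (e 1) (e 2)
  (fun t => @Da t _ l0) (fun t => @Da t _ l1) (fun t => @Db t _ l0) (fun t => @Db t _ l1) (fun t => @De t _ l0) (fun t => @De t _ l1)
  (da k0) (da k1) (da k2) (db k0) (db k1) (db k2) pde f0 f0E dn Qn B
  (fun n => bounded_linear_Hdquot _) (fun n => bounded_linear_Hmul _)
  (fun n => HVshift_sym dV VM _) (fun n => HVshift_ge0 dV V_gt0 VM _)
  (fun n => Dx_Hdquot _) (fun f f' => id) B_ge0 (fun n s => @rest_le _ s (n0 n)) M0 S (supnorm_ge0 V)
  (HV_le dV VM) (fun n => HVshift_le dV VM _) F0 A0 A1 A2 B0 B1 B2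
  (fun n => (dquot_initial_le (n0 n) k1).1) (fun n => (dquot_initial_le (n0 n) k2).1)
  (fun n => (dquot_initial_le (n0 n) k1).2) (fun n => (dquot_initial_le (n0 n) k2).2)).
Qed.

Let energyE t : 0 <= t -> energy V u ut t = E t.
Proof.
move=> t0; have s0 := su t0; have s1 := sut t0.
rewrite /energy /E /wave_energy /a /b !sqr_curve// (sqr_L2norm_wD0 s1).
congr (_ * (_ + _)); rewrite (HV_HS dV V_gt0 VM).
have u2 : L2 (u t) by case: s0.
have [ms Ms] := sqrt_potential_bounded dV VM.
have w2 := L2_mul_bounded ms Ms u2.
rewrite -ip_lift//; apply: sqr_ip_ae.
rewrite liftE//; apply: aeS (wD0_ae s0) => x <-.
change (Num.sqrt (V x) * wD 0 (u t) x = Num.sqrt (V x) * curve 0 u ut t x).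
by rewrite curveE// liftE//; exact: L2_wD s0 _.
Qed.

Lemma energy_decay t : 0 <= t ->
  energy V u ut t <= decay_rate kappa M0 B * data_size V u0 u1 * (1 + t) ^- 2 /\
  L2norm (u t) ^+ 2 <= 4 * (decay_rate kappa M0 B * data_size V u0 u1) * (1 + t)^-1.
Proof.
move=> t0; rewrite -(sqr_L2norm_wD0 (su t0)) -(sqr_curve ut _ t0 (su t0))// energyE//.
apply: (decay_of_weighted (c := 1 - kappa)) => //.
- by have /andP[] := kappa01; lra.
- exact: wave_energy_ge0 (HV_HS dV V_gt0 VM) _ _ _ _ _.
- exact: ip_ge0.
- exact: decay.
Qed.

End Decay.

Theorem theorem1p1 (R : realType) :
  exists C : R -> R -> R -> R -> R,
    (forall a b c d, 0 < C a b c d) /\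
    forall (alpha : R) (V u0 u1 : R -> R) (u ut utt : R -> R -> R),
      BC 2 V ->
      0 < alpha ->
      (forall x, 0 < V x) ->
      (forall x, `|derive1 V x| <= alpha * V x) ->
      alpha ^+ 2 * supnorm V < 1 ->
      Sobolev 3 u0 ->
      Sobolev 3 u1 ->
      L2 (weighted_data V u0 u1) ->
      strong_solution V u0 u1 u ut utt ->
      forall t, 0 <= t ->
        energy V u ut t
          <= C alpha (supnorm V) (supnorm (derive1 V)) (supnorm (derive1n 2 V))
             * data_size V u0 u1 * (1 + t) ^- 2 /\
        L2norm (u t) ^+ 2
          <= C alpha (supnorm V) (supnorm (derive1 V)) (supnorm (derive1n 2 V))
             * data_size V u0 u1 * (1 + t)^-1.
Proof.
pose r (a b c d : R) := decay_rate (a * Num.sqrt b) b (6 * c ^+ 2 + 4 * d ^+ 2).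
(* Positivity is required for all arguments, also where kappa >= 1 and r may be negative, hence the
   absolute value. The 4 comes from the bound on |u|^2. *)
exists (fun a b c d => 1 + 4 * `|r a b c d|); split.
  by move=> a b c d; rewrite ltr_pwDl// mulr_ge0.
move=> alpha V u0 u1 u ut utt BCV a0 V0 V1 aV su0 su1 wL2 sol t t0.
have [h1 h2] := energy_decay BCV a0 V0 V1 aV su0 su1 wL2 sol t0.
have S0 : 0 <= data_size V u0 u1 by rewrite !addr_ge0// sqr_ge0.
have t1 : 0 < 1 + t by rewrite ltr_wpDr.
have r0 := normr_ge0 (r alpha (supnorm V) (supnorm (derive1 V)) (supnorm (derive1n 2 V))).
have r1 := ler_norm (r alpha (supnorm V) (supnorm (derive1 V)) (supnorm (derive1n 2 V))).
split.
  apply: le_trans h1 _; rewrite -mulrA -[leRHS]mulrA ler_wpM2r//.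
    by rewrite mulr_ge0// invr_ge0 sqr_ge0.
  by move: r0 r1; rewrite /r; lra.
apply: le_trans h2 _; rewrite mulrA -mulrA -[leRHS]mulrA ler_wpM2r//.
  by rewrite mulr_ge0// invr_ge0 ltW.
by move: r0 r1; rewrite /r; lra.
Qed.
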